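(* Let one of the following conditions hold: (i) $\ell\in\mathbb{N}$ and $p\ge2$ is an integer; (ii) $\ell\in\{3,4,5,6,7\}$ and $p>2$ (real); (iii) $\ell\in\{1,2\}$ and $p>1$ (real). Let $$\tilde{\mathfrak{g}}_n^{(\ell,p)}:=n^{1-1/p}\prod_{j=1}^{\ell-1}(n-j)\quad\text{for } n\in\mathbb{N}_0,\qquad \tilde{\mathfrak{g}}_n^{(\ell,p)}:=0\quad\text{for } n<0,$$ and $$\tilde{\rho}_{n}^{(\ell,p)}:=\frac{-\Delta_p^{(\ell)}\tilde{\mathfrak{g}}_n^{(\ell,p)}}{\bigl(\tilde{\mathfrak{g}}_n^{(\ell,p)}\bigr)^{p-1}}\quad\text{for } n\ge\ell.$$ Then $\tilde{\rho}^{(\ell,p)}=\{\tilde\rho_n^{(\ell,p)}\}_{n\ge\ell}$ is a discrete $p$-Hardy--Rellich--Birman weight (of order $\ell$), which is critical, non-attainable in $\mathcal{H}_0^\ell$, and optimal near infinity.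
   Context: $\mathbb{N}=\{1,2,\dots\}$, $\mathbb{N}_0=\mathbb{N}\cup\{0\}$. $C(\mathbb{Z})$ is the space of complex sequences indexed by $\mathbb{Z}$, and $C_0(\mathbb{Z})$ its subspace of finitely supported sequences. For $u\in C(\mathbb{Z})$ put $\nabla u_n=(\nabla u)_n:=u_n-u_{n-1}$ and $\mathrm{div}\,u_n=(\mathrm{div}\,u)_n:=u_{n+1}-u_n$, $n\in\mathbb{Z}$. For $m\in\mathbb{N}$, $\mathcal{H}_0^m:=\{u\in C_0(\mathbb{Z}) : u_n=0 \text{ for all } n<m\}$. For $\nu\in\mathbb{C}$ and $a>0$, $\nu^{\langle a\rangle}:=\nu|\nu|^{a-1}$ with $0^{\langle a\rangle}:=0$ (applied entrywise to sequences). The discrete $p$-Laplacian of order $\ell$ is $-\Delta_p^{(\ell)}u:=(-1)^\ell\,\mathrm{div}^\ell\bigl((\nabla^\ell u)^{\langle p-1\rangle}\bigr)$. A non-negative sequence $\rho=\{\rho_n\}_{n=\ell}^\infty$ is a discrete $p$-Hardy--Rellich--Birman weight if $$(\ast)\qquad\sum_{n=\ell}^{\infty}\bigl|\nabla^\ell u_n\bigr|^p\ge\sum_{n=\ell}^{\infty}\rho_n|u_n|^p$$ holds for all $u\in\mathcal{H}_0^\ell$. Such a weight $\rho$ is: critical, if for any discrete $p$-Hardy--Rellich--Birman weight $\tilde\rho$ with $\tilde\rho_n\ge\rho_n$ for all $n\ge\ell$, it follows that $\tilde\rho=\rho$; non-attainable in $\mathcal{H}_0^\ell$, if whenever equality in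 $(\ast)$ is attained for some $u\in\mathcal{H}_0^\ell$, then $u\equiv0$; optimal near infinity, if for any $m\ge\ell$ and $\varepsilon>0$ there exists $u\in\mathcal{H}_0^m$ such that $\sum_{n=\ell}^{\infty}|\nabla^\ell u_n|^p<(1+\varepsilon)\sum_{n=\ell}^{\infty}\rho_n|u_n|^p$. *)

(* Defs.v *)
From mathcomp Require Import all_boot all_order all_algebra.
From mathcomp Require Import complex.
From mathcomp Require Import all_classical all_reals all_analysis.

Set Implicit Arguments.
Unset Strict Implicit.
Unset Printing Implicit Defensive.

Import Order.TTheory GRing.Theory Num.Theory.

Local Open Scope classical_set_scope.
Local Open Scope ring_scope.
Local Open Scope complex_scope.

Definition nabla (V : zmodType) (u : int -> V) : int -> V :=
  fun n => u n - u (n - 1).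

Definition div1 (V : zmodType) (u : int -> V) : int -> V :=
  fun n => u (n + 1) - u n.

Definition cmod (R : realType) (z : R[i]) : R := ComplexField.Normc.normc z.

(* Since [0 `^ b] is [0] or [1], the convention 0^<a> = 0 comes from the
   factor [z]. *)
Definition spow (R : realType) (a : R) (z : R[i]) : R[i] :=
  z * (cmod z `^ (a - 1))%:C.

(* $-\Delta_p^{(\ell)} u$, minus sign included. *)
Definition plaplacian (R : realType) (l : nat) (p : R) (u : int -> R[i]) :
    int -> R[i] :=
  fun n => (-1) ^+ l *
    iter l (@div1 _) (fun k => spow (p - 1) (iter l (@nabla _) u k)) n.

Definition H0 (R : realType) (m : nat) : set (int -> R[i]) :=
  [set u | finite_set [set n | u n != 0] /\ forall n : int, n < m%:Z -> u n = 0].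

(* Sequences indexed by n >= l are total functions on [nat] whose values below
   [l] are never used. The sums are extended-real limits of partial sums; for
   u in H0 only finitely many terms are nonzero. *)
Definition energy (R : realType) (l : nat) (p : R) (u : int -> R[i]) : \bar R :=
  (\sum_(l <= n <oo) (cmod (iter l (@nabla _) u n%:Z) `^ p)%:E)%E.

Definition wnorm (R : realType) (l : nat) (p : R) (rho : nat -> R)
    (u : int -> R[i]) : \bar R :=
  (\sum_(l <= n <oo) (rho n * cmod (u n%:Z) `^ p)%:E)%E.

Definition hrb_weight (R : realType) (l : nat) (p : R) (rho : nat -> R) : Prop :=
  (forall n, (l <= n)%N -> 0 <= rho n) /\
  (forall u, H0 l u -> (wnorm l p rho u <= energy l p u)%E).

Definition critical (R : realType) (l : nat) (p : R) (rho : nat -> R) : Prop :=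
  forall rho' : nat -> R, hrb_weight l p rho' ->
    (forall n, (l <= n)%N -> rho n <= rho' n) ->
    forall n, (l <= n)%N -> rho' n = rho n.

Definition non_attainable (R : realType) (l : nat) (p : R) (rho : nat -> R) :
    Prop :=
  forall u, H0 l u -> energy l p u = wnorm l p rho u -> forall n, u n = 0.

Definition optimal_near_infinity (R : realType) (l : nat) (p : R)
    (rho : nat -> R) : Prop :=
  forall (m : nat) (eps : R), (l <= m)%N -> 0 < eps ->
    exists2 u, H0 m u & (energy l p u < (1 + eps)%:E * wnorm l p rho u)%E.

Definition gtilde (R : realType) (l : nat) (p : R) (n : int) : R :=
  if 0 <= n then
    (n%:~R `^ (1 - p^-1)) * \prod_(1 <= j < l) (n%:~R - j%:R)
  else 0.

(* [complex.Re] only turns a real-valued complex number into an element of [R]: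
   see [plaplacian_real] below. *)
Definition rhotilde (R : realType) (l : nat) (p : R) (n : nat) : R :=
  complex.Re (plaplacian l p (fun k => (gtilde l p k)%:C) n%:Z)
  / gtilde l p n%:Z `^ (p - 1).

Lemma plaplacian_real (R : realType) (l : nat) (p : R) (x : int -> R) (n : int) :
  plaplacian l p (fun k => (x k)%:C) n =
  (complex.Re (plaplacian l p (fun k => (x k)%:C) n))%:C.
Proof.
suff [y ->] : exists y : R, plaplacian l p (fun k => (x k)%:C) n = y%:C by [].
have nablaC k : exists v : int -> R,
    iter k (@nabla _) (fun i => (x i)%:C) =1 (fun i => (v i)%:C).
  elim: k => [|k [v hv]]; first by exists x.
  exists (nabla v) => i.
  by rewrite iterS {1}/nabla !hv -rmorphB.
have [v hv] := nablaC l.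
have divC k : exists w : int -> R,
    iter k (@div1 _) (fun i => spow (p - 1) (iter l (@nabla _)
      (fun i => (x i)%:C) i)) =1 (fun i => (w i)%:C).
  elim: k => [|k [w hw]].
    exists (fun i => v i * (cmod (v i)%:C `^ (p - 1 - 1))) => i.
    by rewrite /= hv /spow -rmorphM.
  exists (div1 w) => i.
  by rewrite iterS {1}/div1 !hw -rmorphB.
have [w hw] := divC l.
exists ((-1) ^+ l * w n).
by rewrite /plaplacian hw rmorphM rmorphXn rmorphN rmorph1.
Qed.

(* Main.v *)
(* Let g be the ground state, h its l-th difference, and s = 1/p. The weight
   is obtained by applying l times the one-step Picone inequality |v_n -
   v_(n-1)|^p >= (psi_n - psi_(n-1))^(p-1) (|v_n|^p / psi_n^(p-1) -
   |v_(n-1)|^p / psi_(n-1)^(p-1)), with v running over the successive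
   differences of u, psi over those of g, and a summation by parts after
   each step; the weights stay nonnegative because the differences of
   h^(p-1) up to order l alternate in sign.

   For the latter, n^(-s) is a limit of positive combinations of 1/(n + y),
   and the l-th difference of n(n-1)...(n-l+1)/(n + y) is l!
   y(y+1)...(y+l-1) / ((n+y)(n+y-1)...(n+y-l)), so h is a limit of positive
   exponential sums f. Integer powers of f are exponential sums again. For
   other powers f^a, Faa di Bruno's formula expresses the derivatives of f^a
   as f^a times a polynomial in the moments of a probability measure; up to
   order 7 and for 1 <= a <= 2 this polynomial is nonnegative.

   Criticality and optimality use g times a logarithmic cut-off with L
   scales: every level of the chain then loses only O(L^(-1-e)) / n at n. *)

Require Import Defs.
From mathcomp Require Import all_boot all_order all_algebra.
From mathcomp Require Import complex ring lra zify.
From mathcomp Require Import all_classical all_reals all_analysis.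

Set Implicit Arguments.
Unset Strict Implicit.
Unset Printing Implicit Defensive.

Import Order.TTheory GRing.Theory Num.Theory numFieldNormedType.Exports.
Local Open Scope classical_set_scope.
Local Open Scope ring_scope.

(** * Fractional powers of exponential sums *)

Section MomentSums.
Variable R : realType.
Implicit Types (s : seq (R * R)) (x a : R).

(** Dividing each Picone step by (psi_n - psi_(n-1))^(p-1) is what lets the steps be chained: stage
    k compares the sum of a_k |D^(l-k) u|^p / (D^(l-k) g)^(p-1) with the same sum for k + 1, where
    a_k is the k-th difference of h^(p-1) alone and a_(k+1) arises from the summation by parts. The
    last stage is the Hardy term with weight a_l / g^(p-1), and the whole loss is an explicit sum of
    nonnegative Picone terms, on which strictness, criticality and optimality all rest.

    The obstacle is the sign of a_k when p - 1 is not an integer: it is settled only through moment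
    inequalities, hence the bound 7. An exponent a >= 2 is split into an integer and a number in
    [1, 2]; for l <= 2 a variance inequality suffices and admits every p > 1.

    The choice s = 1/p makes h^p of size 1/n, so the energy of g diverges like a logarithm: a
    logarithmic cut-off can lose a vanishing amount while its energy tends to infinity. *)

Definition expmom s k x : R := \sum_(q <- s) q.1 * q.2 ^+ k * expR (- q.2 * x).

Definition wfexp s := s != [::] /\ forall q, q \in s -> 0 < q.1 /\ 0 <= q.2.

Lemma is_derive_mulfun (f g : R -> R) (x df dg : R) :
  is_derive x 1 f df -> is_derive x 1 g dg ->
  is_derive x 1 (fun y => f y * g y) (df * g x + f x * dg).
Proof.
move=> hf hg; rewrite (_ : (fun _ => _) = (f : R -> R) * g) //.
apply: (trigger_derive (is_deriveM hf hg)).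
by rewrite /GRing.scale /= addrC mulrC.
Qed.

Lemma is_derive_cmul (f : R -> R) (c x df : R) : is_derive x 1 f df ->
  is_derive x 1 (fun y => c * f y) (c * df).
Proof.
move=> hf; rewrite (_ : (fun _ => _) = c \*: (f : R -> R)) //.
exact: (is_deriveZ c hf).
Qed.

Lemma is_derive_big (I : Type) (r : seq I) (F : I -> R -> R) (dF : I -> R) x :
  (forall i, is_derive x 1 (F i) (dF i)) ->
  is_derive x 1 (fun y => \sum_(i <- r) F i y) (\sum_(i <- r) dF i).
Proof.
move=> h; elim: r => [|i r IH].
  rewrite big_nil (_ : (fun _ => _) = cst 0); first exact: is_derive_cst.
  by apply/funext => y; rewrite big_nil.
rewrite big_cons (_ : (fun _ => _) = F i + (fun y => \sum_(i <- r) F i y)).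
  exact: is_deriveD.
by apply/funext => y; rewrite big_cons.
Qed.

Lemma is_derive_expmom s k x : is_derive x 1 (expmom s k) (- expmom s k.+1 x).
Proof.
rewrite -sumrN; apply: is_derive_big => q.
have h : is_derive x 1 (fun y => expR (- q.2 * y)) (- q.2 * expR (- q.2 * x)).
  have d := is_derive_cmul (- q.2) (is_derive_id x (1 : R)).
  by have := is_derive1_comp (is_derive_expR _) d; rewrite mulr1 mulrC.
apply: (trigger_derive (is_derive_cmul (q.1 * q.2 ^+ k) h)).
by rewrite exprSr; ring.
Qed.

Lemma expmom_gt0 s x : wfexp s -> 0 < expmom s 0 x.
Proof.
move=> [s0 h]; case: s s0 h => // q s _ h; rewrite /expmom big_cons.
have [q1 q2] := h q (mem_head _ _).
apply: ltr_wpDr; last by rewrite expr0 mulr1 mulr_gt0 ?expR_gt0.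
rewrite big_seq sumr_ge0 // => r rs.
have [r1 r2] := h r (mem_behead (s := q :: s) rs).
by rewrite !mulr_ge0 ?expR_ge0 // ltW.
Qed.

Fixpoint increments (pi : seq nat) : seq (seq nat) :=
  if pi is b :: pi' then (b.+1 :: pi') :: map (cons b) (increments pi')
  else [::].

(* Going from the set partitions of k points to those of k + 1 points: the new
   point is a block by itself, or it joins an existing block. *)
Definition extensions (pi : seq nat) := (1%N :: pi) :: increments pi.

Definition falling a n : R := \prod_(i < n) (a - i%:R).

Definition blockprod (M : nat -> R) (pi : seq nat) : R := \prod_(b <- pi) M b.

Lemma is_derive_blockprod s pi x :
  is_derive x 1 (fun y => blockprod (expmom s ^~ y) pi)
    (- \sum_(sg <- increments pi) blockprod (expmom s ^~ x) sg).
Proof.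
elim: pi => [|b pi IH] /=.
  rewrite big_nil oppr0 (_ : (fun _ => _) = cst 1); first exact: is_derive_cst.
  by apply/funext => y; rewrite /blockprod big_nil.
rewrite (_ : (fun _ => _) =
    (fun y => expmom s b y * blockprod (expmom s ^~ y) pi)); last first.
  by apply/funext => y; rewrite /blockprod big_cons.
apply: (trigger_derive (is_derive_mulfun (is_derive_expmom s b x) IH)).
rewrite big_cons big_map {3}/blockprod big_cons opprD mulNr mulrN.
congr (_ + - _).
by rewrite mulr_sumr; apply: eq_bigr => i _; rewrite {2}/blockprod big_cons.
Qed.

(** With f = [expmom s 0], the contribution to (-1)^k (f^a)^(k) of one set partition of k points
    with block sizes [pi]. No sign is left, since [expmom s b] is (-1)^b f^(b) and the block sizes
    add up to k. *)
Definition blockterm a s x pi :=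
  falling a (size pi) * expmom s 0 x `^ (a - (size pi)%:R) *
  blockprod (expmom s ^~ x) pi.

Lemma size_increments pi sg : sg \in increments pi -> size sg = size pi.
Proof.
elim: pi sg => //= b pi IH sg; rewrite inE => /orP[/eqP->//|/mapP[r /IH <-
    ->]//].
Qed.

(* Faa di Bruno's formula, one derivative at a time. *)
Lemma is_derive_blockterm a s x pi : wfexp s ->
  is_derive x 1 (blockterm a s ^~ pi)
    (- \sum_(sg <- extensions pi) blockterm a s x sg).
Proof.
move=> ws; set c := falling a (size pi).
have d1 := is_derive_expmom s 0 x.
have d2 := is_derive1_comp
  (is_derive1_powR (a - (size pi)%:R) (expmom_gt0 x ws)) d1.
have d3 := is_derive_mulfun d2 (is_derive_blockprod s pi x).
rewrite (_ : (fun _ => _) = (fun y => c * (((@powR R)^~ (a - (size pi)%:R) \o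
    expmom s 0) y * blockprod (expmom s ^~ y) pi))); last first.
  by apply/funext => y; rewrite /= /blockterm -mulrA.
apply: (trigger_derive (is_derive_cmul c d3)).
rewrite big_cons opprD mulrDr; congr (_ + _).
  rewrite /blockterm /= /falling big_ord_recr /= -/(falling _ _) -/c.
  rewrite {2}/blockprod big_cons -/(blockprod _ _) -natr1 opprD addrA.
  by ring.
rewrite mulrN mulrN mulrA mulr_sumr [in RHS]big_seq [in LHS]big_seq.
by congr (- _); apply: eq_bigr => i /size_increments e; rewrite /blockterm e.
Qed.

Fixpoint insertp (c : nat) (pi : seq nat) (l : seq (nat * seq nat)) :=
  if l is (c', pi') :: l' then
    if pi == pi' then (c + c', pi)%N :: l' else (c', pi') :: insertp c pi l'
  else [:: (c, pi)].

(** Sorting the blocks merges equal types, so that [partitions 7] has 15 entries instead of one for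
    each of the 877 set partitions and can be expanded term by term. *)
Definition extend_all (l : seq (nat * seq nat)) :=
  foldr (fun q l' => foldr (fun sg => insertp q.1 (sort geq sg)) l'
                       (extensions q.2)) [::] l.

(* Integer partitions of k, each with the number of set partitions of that
   type. *)
Definition partitions k := iter k extend_all [:: (1%N, [::])].

Definition partsum (phi : seq nat -> R) (l : seq (nat * seq nat)) : R :=
  \sum_(q <- l) q.1%:R * phi q.2.

Lemma partsum_cons phi q l :
  partsum phi (q :: l) = q.1%:R * phi q.2 + partsum phi l.
Proof. by rewrite /partsum big_cons. Qed.

Lemma partsum_insertp phi c pi l :
  partsum phi (insertp c pi l) = c%:R * phi pi + partsum phi l.
Proof.
elim: l => [|[c' pi'] l IH] /=; first by rewrite /partsum big_cons.
case: eqP => [->|_]; rewrite !partsum_cons /=; first by rewrite natrD; ring.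
by rewrite IH; ring.
Qed.

Lemma partsum_extend_all phi l : (forall pi, phi (sort geq pi) = phi pi) ->
  partsum phi (extend_all l) =
  partsum (fun pi => \sum_(sg <- extensions pi) phi sg) l.
Proof.
move=> hphi; elim: l => [|q l IH]; first by rewrite /partsum !big_nil.
rewrite partsum_cons -IH.
rewrite (_ : extend_all (q :: l) = foldr (fun sg => insertp q.1 (sort geq sg))
  (extend_all l) (extensions q.2)) //.
elim: (extensions q.2) => [|sg r IHr].
  by rewrite big_nil /= mulr0 add0r.
by rewrite big_cons [foldr _ _ _]/= partsum_insertp hphi IHr; ring.
Qed.

Lemma blockterm_sort a s x pi : blockterm a s x (sort geq pi) = blockterm a s x
    pi.
Proof.
rewrite /blockterm size_sort /blockprod; congr (_ * _).
by apply: perm_big; rewrite perm_sort.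
Qed.

Lemma is_derive_partsum a s x k : wfexp s ->
  is_derive x 1 (fun y => partsum (blockterm a s y) (partitions k))
    (- partsum (blockterm a s x) (partitions k.+1)).
Proof.
move=> ws; rewrite [partitions k.+1]iterS partsum_extend_all; last exact:
    blockterm_sort.
rewrite /partsum -sumrN; apply: is_derive_big => q.
apply: (trigger_derive (is_derive_cmul q.1%:R (is_derive_blockterm a x q.2
    ws))).
by rewrite mulrN.
Qed.

End MomentSums.

(** * Moment sequences and two families of inequalities *)

Section Moments.
Variable R : realType.
Implicit Types (m : nat -> R) (th : R).

(** Moments of a finitely supported probability measure on the nonnegative half-line: [q.1] is the
    mass of the atom [q.2]. *)
Definition moments m := m 0 = 1 /\ exists s : seq (R * R),
  (forall q, q \in s -> 0 <= q.1 /\ 0 <= q.2) /\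
  forall k, m k = \sum_(q <- s) q.1 * q.2 ^+ k.

Lemma moments0 m : moments m -> m 0 = 1. Proof. by case. Qed.

Lemma moments_ge0 m k : moments m -> 0 <= m k.
Proof.
move=> [_ [s [hs ->]]]; rewrite big_seq sumr_ge0 // => q /hs[q1 q2].
by rewrite mulr_ge0 ?exprn_ge0.
Qed.

Definition gapD m c d i j : R := m c * m d - m i * m j.

Definition gapQ m k l n c : R := m n - 2 * c * m l + c ^+ 2 * m k.

(** Chebyshev's correlation inequality: x^(i-c) and x^(j-c) increase together on x >= 0. Twice the
    gap is a double sum over pairs of atoms in which both differences have the same sign. *)
Lemma gapD_ge0 m c d i j : moments m -> (c <= i)%N -> (c <= j)%N ->
  (c + d = i + j)%N -> 0 <= gapD m c d i j.
Proof.
move=> [_ [s [hs hm]]] ci cj cd.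
have e : gapD m c d i j *+ 2 = \sum_(q <- s) \sum_(r <- s) q.1 * r.1 *
    ((q.2 * r.2) ^+ c * ((q.2 ^+ (i - c) - r.2 ^+ (i - c)) *
                         (q.2 ^+ (j - c) - r.2 ^+ (j - c)))).
  have hp k l : m k * m l =
      \sum_(q <- s) \sum_(r <- s) q.1 * r.1 * (q.2 ^+ k * r.2 ^+ l).
    rewrite !hm mulr_suml; apply: eq_bigr => q _; rewrite mulr_sumr.
    by apply: eq_bigr => r _; ring.
  have -> : gapD m c d i j *+ 2 =
      (m c * m d + m d * m c) - (m i * m j + m j * m i).
    by rewrite /gapD; ring.
  rewrite !hp -!big_split -sumrB /=; apply: eq_bigr => q _.
  rewrite -!big_split -sumrB /=; apply: eq_bigr => r _.
  have [i' ei] : exists i', i = (c + i')%N by exists (i - c)%N; rewrite subnKC.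
  have [j' ej] : exists j', j = (c + j')%N by exists (j - c)%N; rewrite subnKC.
  have -> : d = (c + i' + j')%N.
    by lia.
  rewrite ei ej !addKn !exprD exprMn; ring.
rewrite -(pmulrn_lge0 _ (isT : (0 < 2)%N)) e.
rewrite big_seq sumr_ge0 // => q /hs[q1 q2]; rewrite big_seq sumr_ge0 // => r
    /hs[r1 r2].
apply: mulr_ge0; first exact: mulr_ge0.
apply: mulr_ge0; first by rewrite exprn_ge0 ?mulr_ge0.
have [qr|/ltW qr] := leP q.2 r.2.
  by rewrite mulr_le0 // subr_le0 lerXn2r.
by rewrite mulr_ge0 // subr_ge0 lerXn2r.
Qed.

(** The gap is the integral of x^k (x^(l-k) - c)^2, whatever the real centre c. *)
Lemma gapQ_ge0 m k l n c : moments m -> (k <= l)%N -> (k + n = l + l)%N ->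
  0 <= gapQ m k l n c.
Proof.
move=> [_ [s [hs hm]]] kl kn.
have [i ei] : exists i, l = (k + i)%N by exists (l - k)%N; rewrite subnKC.
have -> : n = (k + i + i)%N by lia.
have -> : gapQ m k l (k + i + i) c =
    \sum_(q <- s) q.1 * q.2 ^+ k * (q.2 ^+ i - c) ^+ 2.
  rewrite /gapQ !hm !mulr_sumr -sumrB -big_split /=; apply: eq_bigr => q _.
  by rewrite ei !exprD; ring.
rewrite big_seq sumr_ge0 // => q /hs[q1 q2].
by apply: mulr_ge0; rewrite ?sqr_ge0 // mulr_ge0 ?exprn_ge0.
Qed.

End Moments.

Ltac partsum_expand :=
  match goal with |- context [partsum _ ?l] =>
    let l' := eval vm_compute in l in
    rewrite (_ : l = l'); last by vm_compute
  end;
  rewrite /partsum !big_cons big_nil /blockprod !big_cons big_nil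
    /falling /= !big_ord_recr !big_ord0 /=.

(* The cases are ordered so that no numeral is ever compared by conversion. *)
Ltac moments_pos :=
  repeat match goal with
  | |- is_true (0 <= _%:R) => exact: ler0n
  | H : is_true ?P |- is_true ?P => exact: H
  | |- is_true (0 <= gapD _ _ _ _ _) => by apply: gapD_ge0
  | |- is_true (0 <= gapQ _ _ _ _ _) => by apply: gapQ_ge0
  | hm : moments ?m |- is_true (0 <= ?m _) => exact: moments_ge0 hm
  | |- is_true (0 <= _ + _) => apply: addr_ge0
  | |- is_true (0 <= _ * _) => apply: mulr_ge0
  | |- is_true (0 <= _ ^+ _) => apply: exprn_ge0
  | |- is_true (0 <= _ ^-1) => rewrite invr_ge0
  | |- is_true (0 <= 1) => exact: ler01
  end.

Section MomentInequalities.
Variable R : realType.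
Implicit Types (m : nat -> R) (th : R).

(* [partsum] is a polynomial in [th], which is written in the Bernstein basis.
   Each coefficient is a nonnegative combination of products of moments, of
   [gapD] and of [gapQ]; these combinations were found by linear programming. *)
Lemma partsum_moments3 m th : moments m -> 0 <= th <= 1 ->
  0 <= partsum (fun pi => falling (1 + th) (size pi) * blockprod m pi)
         (partitions 3).
Proof.
move=> hm /andP[th0 th1].
have ? : 0 <= 1 - th by rewrite subr_ge0.
pose B1 : R := m 3.
pose B2 : R := 3 * m 1 * m 2.
pose B3 : R := m 1 ^+ 3.
have b0 : 0 <= B1.
  rewrite [leRHS](_ : _ = m 3).
    by moments_pos.
  by rewrite /B1 /gapD /gapQ ?(moments0 hm); field.
have b1 : 0 <= B1 + 1 / 2 * B2 - 1 / 2 * B3.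
  rewrite [leRHS](_ : _ = 3 / 2 * m 1 * gapD m 0 2 1 1 + m 1 ^+ 3 + m 3).
    by moments_pos.
  by rewrite /B1 /B2 /B3 /gapD /gapQ ?(moments0 hm); field.
have b2 : 0 <= B1 + B2.
  rewrite [leRHS](_ : _ = 3 * m 1 * m 2 + m 3).
    by moments_pos.
  by rewrite /B1 /B2 /gapD /gapQ ?(moments0 hm); field.
have -> : partsum (fun pi => falling (1 + th) (size pi) * blockprod m pi)
    (partitions 3) = (1 + th) * (
    B1 + th * B2 + th * (th - 1) * B3).
  by rewrite /B1 /B2 /B3; partsum_expand; ring.
clearbody B1 B2 B3.
rewrite [leRHS](_ : _ = (1 + th) * (
    (1 - th) ^+ 2 * (B1) + 2 * th * (1 - th) * (B1 + 1 / 2 * B2 - 1 / 2 * B3)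
    + th ^+ 2 * (B1 + B2))).
  by moments_pos.
by field.
Qed.

(** [Bj] collects the partitions into j blocks. Once the common factor 1 + th is taken out, [bi] is
    the sign of the i-th Bernstein coefficient of degree 3 in th. *)
Lemma partsum_moments4 m th : moments m -> 0 <= th <= 1 ->
  0 <= partsum (fun pi => falling (1 + th) (size pi) * blockprod m pi)
         (partitions 4).
Proof.
move=> hm /andP[th0 th1].
have ? : 0 <= 1 - th by rewrite subr_ge0.
pose B1 : R := m 4.
pose B2 : R := 4 * m 1 * m 3 + 3 * m 2 ^+ 2.
pose B3 : R := 6 * m 1 ^+ 2 * m 2.
pose B4 : R := m 1 ^+ 4.
have b0 : 0 <= B1.
  rewrite [leRHS](_ : _ = m 4).
    by moments_pos.
  by rewrite /B1 /gapD /gapQ ?(moments0 hm); field.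
have b1 : 0 <= B1 + 1 / 3 * B2 - 1 / 3 * B3 + 2 / 3 * B4.
  rewrite [leRHS](_ : _ = 4 / 3 * m 1 * gapD m 0 3 1 2 + 4 / 3 * m 1 ^+ 2 * gapD
      m 0 2 1 1
      + (gapD m 0 2 1 1) ^+ 2 + m 1 ^+ 4 + m 4).
    by moments_pos.
  by rewrite /B1 /B2 /B3 /B4 /gapD /gapQ ?(moments0 hm); field.
have b2 : 0 <= B1 + 2 / 3 * B2 - 1 / 3 * B3 + 1 / 3 * B4.
  rewrite [leRHS](_ : _ = 8 / 3 * m 1 * m 3 + 2 * (gapD m 0 2 1 1) ^+ 2
      + 2 * m 1 ^+ 2 * gapD m 0 2 1 1 + m 4 + 1 / 3 * m 1 ^+ 4).
    by moments_pos.
  by rewrite /B1 /B2 /B3 /B4 /gapD /gapQ ?(moments0 hm); field.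
have b3 : 0 <= B1 + B2.
  rewrite [leRHS](_ : _ = 4 * m 1 * m 3 + 3 * m 2 ^+ 2 + m 4).
    by moments_pos.
  by rewrite /B1 /B2 /gapD /gapQ ?(moments0 hm); field.
have -> : partsum (fun pi => falling (1 + th) (size pi) * blockprod m pi)
    (partitions 4) = (1 + th) * (
    B1 + th * B2 + th * (th - 1) * B3 + th * (th - 1) * (th - 2) * B4).
  by rewrite /B1 /B2 /B3 /B4; partsum_expand; ring.
(* The change of basis is an identity in th and in the [Bj] as free variables; hiding their bodies
   keeps the moments out of [field]. *)
clearbody B1 B2 B3 B4.
rewrite [leRHS](_ : _ = (1 + th) * (
    (1 - th) ^+ 3 * (B1)
    + 3 * th * (1 - th) ^+ 2 * (B1 + 1 / 3 * B2 - 1 / 3 * B3 + 2 / 3 * B4)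
    + 3 * th ^+ 2 * (1 - th) * (B1 + 2 / 3 * B2 - 1 / 3 * B3 + 1 / 3 * B4)
    + th ^+ 3 * (B1 + B2))).
  by moments_pos.
by field.
Qed.

Lemma partsum_moments5 m th : moments m -> 0 <= th <= 1 ->
  0 <= partsum (fun pi => falling (1 + th) (size pi) * blockprod m pi)
         (partitions 5).
Proof.
move=> hm /andP[th0 th1].
have ? : 0 <= 1 - th by rewrite subr_ge0.
pose B1 : R := m 5.
pose B2 : R := 5 * m 1 * m 4 + 10 * m 2 * m 3.
pose B3 : R := 10 * m 1 ^+ 2 * m 3 + 15 * m 1 * m 2 ^+ 2.
pose B4 : R := 10 * m 1 ^+ 3 * m 2.
pose B5 : R := m 1 ^+ 5.
have b0 : 0 <= B1.
  rewrite [leRHS](_ : _ = m 5).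
    by moments_pos.
  by rewrite /B1 /gapD /gapQ ?(moments0 hm); field.
have b1 : 0 <= B1 + 1 / 4 * B2 - 1 / 4 * B3 + 1 / 2 * B4 - 3 / 2 * B5.
  rewrite [leRHS](_ : _ = 25 / 8 * gapD m 0 2 1 1 * gapD m 0 3 1 2
      + 15 / 8 * m 1 ^+ 3 * gapD m 0 2 1 1 + 5 / 4 * m 1 * m 4
      + gapD m 0 5 2 3 + 5 / 8 * m 1 * gapD m 1 3 2 2 + 3 / 8 * m 1 ^+ 5
      + 3 / 8 * m 2 * m 3).
    by moments_pos.
  by rewrite /B1 /B2 /B3 /B4 /B5 /gapD /gapQ ?(moments0 hm); field.
have b2 : 0 <= B1 + 1 / 2 * B2 - 1 / 3 * B3 + 1 / 2 * B4 - 7 / 6 * B5.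
  rewrite [leRHS](_ : _ = 5 * gapD m 0 2 1 1 * gapD m 0 3 1 2 + 5 / 2 * m 1 * m
      4
      + 5 / 3 * m 1 ^+ 2 * gapD m 0 3 1 2 + 5 / 3 * m 1 ^+ 3 * gapD m 0 2 1 1
      + m 5 + 1 / 2 * m 1 ^+ 5).
    by moments_pos.
  by rewrite /B1 /B2 /B3 /B4 /B5 /gapD /gapQ ?(moments0 hm); field.
have b3 : 0 <= B1 + 3 / 4 * B2 - 1 / 4 * B3 + 1 / 4 * B4 - 1 / 2 * B5.
  rewrite [leRHS](_ : _ = 15 / 2 * m 1 ^+ 3 * gapD m 0 2 1 1
      + 15 / 2 * gapD m 0 2 1 1 * gapD m 0 3 1 2
      + 5 * m 1 ^+ 2 * gapD m 0 3 1 2 + 15 / 4 * m 1 * (gapD m 0 2 1 1) ^+ 2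
      + 15 / 4 * m 1 * m 4 + 13 / 4 * m 1 ^+ 5 + m 5).
    by moments_pos.
  by rewrite /B1 /B2 /B3 /B4 /B5 /gapD /gapQ ?(moments0 hm); field.
have b4 : 0 <= B1 + B2.
  rewrite [leRHS](_ : _ = 10 * m 2 * m 3 + 5 * m 1 * m 4 + m 5).
    by moments_pos.
  by rewrite /B1 /B2 /gapD /gapQ ?(moments0 hm); field.
have -> : partsum (fun pi => falling (1 + th) (size pi) * blockprod m pi)
    (partitions 5) = (1 + th) * (
    B1 + th * B2 + th * (th - 1) * B3 + th * (th - 1) * (th - 2) * B4
    + th * (th - 1) * (th - 2) * (th - 3) * B5).
  by rewrite /B1 /B2 /B3 /B4 /B5; partsum_expand; ring.
clearbody B1 B2 B3 B4 B5.
rewrite [leRHS](_ : _ = (1 + th) * (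
    (1 - th) ^+ 4 * (B1)
    + 4 * th * (1 - th) ^+ 3 * (B1 + 1 / 4 * B2 - 1 / 4 * B3 + 1 / 2 * B4 - 3 /
        2 * B5)
    + 6 * th ^+ 2 * (1 - th) ^+ 2 * (B1 + 1 / 2 * B2 - 1 / 3 * B3 + 1 / 2 * B4 -
        7 / 6 * B5)
    + 4 * th ^+ 3 * (1 - th) * (B1 + 3 / 4 * B2 - 1 / 4 * B3 + 1 / 4 * B4 - 1 /
        2 * B5)
    + th ^+ 4 * (B1 + B2))).
  by moments_pos.
by field.
Qed.

(** From this order on the certificates use [gapQ] besides [gapD]. Its centres [m 1], [m 1 ^+ 2] and
    [m 2] are chosen so that every term stays homogeneous of degree 6. *)
Lemma partsum_moments6 m th : moments m -> 0 <= th <= 1 ->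
  0 <= partsum (fun pi => falling (1 + th) (size pi) * blockprod m pi)
         (partitions 6).
Proof.
move=> hm /andP[th0 th1].
have ? : 0 <= 1 - th by rewrite subr_ge0.
pose B1 : R := m 6.
pose B2 : R := 6 * m 1 * m 5 + 15 * m 2 * m 4 + 10 * m 3 ^+ 2.
pose B3 : R := 15 * m 1 ^+ 2 * m 4 + 60 * m 1 * m 2 * m 3 + 15 * m 2 ^+ 3.
pose B4 : R := 20 * m 1 ^+ 3 * m 3 + 45 * m 1 ^+ 2 * m 2 ^+ 2.
pose B5 : R := 15 * m 1 ^+ 4 * m 2.
pose B6 : R := m 1 ^+ 6.
have b0 : 0 <= B1.
  rewrite [leRHS](_ : _ = m 6).
    by moments_pos.
  by rewrite /B1 /gapD /gapQ ?(moments0 hm); field.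
have b1 : 0 <= B1 + 1 / 5 * B2 - 1 / 5 * B3 + 2 / 5 * B4 - 6 / 5 * B5 + 24 / 5 *
    B6.
  rewrite [leRHS](_ : _ = 24 / 5 * m 1 ^+ 4 * gapD m 0 2 1 1
      + 39 / 10 * m 1 ^+ 3 * gapQ m 1 2 3 (m 1)
      + 15 / 4 * (gapQ m 1 2 3 (m 1)) ^+ 2
      + 3 * gapD m 0 2 1 1 * gapD m 1 3 2 2 + 2 * m 1 * gapQ m 3 4 5 (m 1)
      + 7 / 4 * gapD m 2 4 3 3 + 5 / 4 * m 2 * gapD m 0 4 2 2
      + 5 / 4 * m 2 ^+ 3 + 6 / 5 * m 1 * gapQ m 1 3 5 (m 1 ^+ 2)
      + gapQ m 4 5 6 (m 1) + 3 / 4 * m 1 ^+ 6).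
    by moments_pos.
  by rewrite /B1 /B2 /B3 /B4 /B5 /B6 /gapD /gapQ ?(moments0 hm); field.
have b2 : 0 <= B1 + 2 / 5 * B2 - 3 / 10 * B3 + 1 / 2 * B4 - 13 / 10 * B5 + 23 /
    5 * B6.
  rewrite [leRHS](_ : _ = 71 / 10 * gapD m 0 2 1 1 * gapD m 0 4 2 2
      + 23 / 5 * m 1 ^+ 4 * gapD m 0 2 1 1 + 9 / 2 * (gapQ m 1 2 3 (m 1)) ^+ 2
      + 37 / 10 * m 1 ^+ 3 * gapQ m 1 2 3 (m 1)
      + 14 / 5 * m 1 ^+ 2 * gapD m 0 4 1 3 + 9 / 4 * m 1 * m 5
      + 13 / 10 * m 2 * (gapD m 0 2 1 1) ^+ 2 + m 1 ^+ 6 + 3 / 4 * m 2 ^+ 3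
      + 11 / 20 * gapQ m 2 4 6 (m 2) + 9 / 20 * gapD m 0 6 3 3
      + 1 / 10 * m 1 * gapQ m 3 4 5 (m 1) + 1 / 20 * gapD m 1 5 3 3).
    by moments_pos.
  by rewrite /B1 /B2 /B3 /B4 /B5 /B6 /gapD /gapQ ?(moments0 hm); field.
have b3 : 0 <= B1 + 3 / 5 * B2 - 3 / 10 * B3 + 2 / 5 * B4 - 9 / 10 * B5 + 29 /
    10 * B6.
  rewrite [leRHS](_ : _ = 17 / 2 * m 1 ^+ 3 * gapD m 0 3 1 2
      + 17 / 2 * gapD m 0 2 1 1 * gapD m 0 4 2 2 + 7 * (gapD m 0 3 1 2) ^+ 2
      + 4 * m 2 ^+ 3 + 18 / 5 * m 1 * m 5 + 7 / 2 * m 1 * gapD m 1 4 2 3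
      + 5 / 2 * m 1 ^+ 2 * (gapD m 0 2 1 1) ^+ 2 + m 1 ^+ 2 * gapD m 0 4 1 3
      + gapD m 0 6 3 3 + 1 / 2 * gapD m 0 2 1 1 * gapD m 0 4 1 3
      + 2 / 5 * m 1 ^+ 6).
    by moments_pos.
  by rewrite /B1 /B2 /B3 /B4 /B5 /B6 /gapD /gapQ ?(moments0 hm); field.
have b4 : 0 <= B1 + 4 / 5 * B2 - 1 / 5 * B3 + 1 / 5 * B4 - 2 / 5 * B5 + 6 / 5 *
    B6.
  rewrite [leRHS](_ : _ = 9 * gapD m 0 2 1 1 * gapD m 0 4 1 3 + 8 * m 3 ^+ 2
      + 6 * m 1 ^+ 2 * (gapD m 0 2 1 1) ^+ 2 + 6 * m 1 ^+ 2 * gapD m 0 4 1 3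
      + 6 * m 1 ^+ 4 * gapD m 0 2 1 1 + 24 / 5 * m 1 * m 5
      + 3 * m 1 * gapD m 1 4 2 3 + 3 * gapD m 0 2 1 1 * gapD m 0 4 2 2
      + 6 / 5 * m 1 ^+ 6 + m 1 ^+ 3 * m 3 + m 6).
    by moments_pos.
  by rewrite /B1 /B2 /B3 /B4 /B5 /B6 /gapD /gapQ ?(moments0 hm); field.
have b5 : 0 <= B1 + B2.
  rewrite [leRHS](_ : _ = 15 * m 2 * m 4 + 10 * m 3 ^+ 2 + 6 * m 1 * m 5 + m 6).
    by moments_pos.
  by rewrite /B1 /B2 /gapD /gapQ ?(moments0 hm); field.
have -> : partsum (fun pi => falling (1 + th) (size pi) * blockprod m pi)
    (partitions 6) = (1 + th) * (
    B1 + th * B2 + th * (th - 1) * B3 + th * (th - 1) * (th - 2) * B4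
    + th * (th - 1) * (th - 2) * (th - 3) * B5
    + th * (th - 1) * (th - 2) * (th - 3) * (th - 4) * B6).
  by rewrite /B1 /B2 /B3 /B4 /B5 /B6; partsum_expand; ring.
clearbody B1 B2 B3 B4 B5 B6.
rewrite [leRHS](_ : _ = (1 + th) * (
    (1 - th) ^+ 5 * (B1)
    + 5 * th * (1 - th) ^+ 4 * (B1 + 1 / 5 * B2 - 1 / 5 * B3 + 2 / 5 * B4 - 6 /
        5 * B5 + 24 / 5 * B6)
    + 10 * th ^+ 2 * (1 - th) ^+ 3 * (B1 + 2 / 5 * B2 - 3 / 10 * B3 + 1 / 2 * B4
        - 13 / 10 * B5 + 23 / 5 * B6)
    + 10 * th ^+ 3 * (1 - th) ^+ 2 * (B1 + 3 / 5 * B2 - 3 / 10 * B3 + 2 / 5 * B4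
        - 9 / 10 * B5 + 29 / 10 * B6)
    + 5 * th ^+ 4 * (1 - th) * (B1 + 4 / 5 * B2 - 1 / 5 * B3 + 1 / 5 * B4 - 2 /
        5 * B5 + 6 / 5 * B6)
    + th ^+ 5 * (B1 + B2))).
  by moments_pos.
by field.
Qed.

Lemma partsum_moments7 m th : moments m -> 0 <= th <= 1 ->
  0 <= partsum (fun pi => falling (1 + th) (size pi) * blockprod m pi)
         (partitions 7).
Proof.
move=> hm /andP[th0 th1].
have ? : 0 <= 1 - th by rewrite subr_ge0.
pose B1 : R := m 7.
pose B2 : R := 7 * m 1 * m 6 + 21 * m 2 * m 5 + 35 * m 3 * m 4.
pose B3 : R := 21 * m 1 ^+ 2 * m 5 + 105 * m 1 * m 2 * m 4 + 70 * m 1 * m 3 ^+ 2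
    + 105 * m 2 ^+ 2 * m 3.
pose B4 : R := 35 * m 1 ^+ 3 * m 4 + 210 * m 1 ^+ 2 * m 2 * m 3 + 105 * m 1 * m
    2 ^+ 3.
pose B5 : R := 35 * m 1 ^+ 4 * m 3 + 105 * m 1 ^+ 3 * m 2 ^+ 2.
pose B6 : R := 21 * m 1 ^+ 5 * m 2.
pose B7 : R := m 1 ^+ 7.
have b0 : 0 <= B1.
  rewrite [leRHS](_ : _ = m 7).
    by moments_pos.
  by rewrite /B1 /gapD /gapQ ?(moments0 hm); field.
have b1 : 0 <= B1 + 1 / 6 * B2 - 1 / 6 * B3 + 1 / 3 * B4 - B5 + 4 * B6 - 20 *
    B7.
  rewrite [leRHS](_ : _ = 67 / 6 * gapD m 0 2 1 1 * gapD m 1 4 2 3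
      + 22 / 3 * gapD m 1 3 2 2 * gapQ m 1 2 3 (2 * m 1)
      + 7 * m 1 ^+ 2 * m 3 * gapD m 0 2 1 1
      + 20 / 3 * m 1 * gapD m 0 2 1 1 * gapD m 0 4 1 3
      + 31 / 6 * m 1 * m 2 * (gapD m 0 2 1 1) ^+ 2
      + 5 * m 1 ^+ 2 * gapD m 0 2 1 1 * gapQ m 1 2 3 (2 * m 1)
      + 5 / 2 * gapD m 0 2 1 1 * gapQ m 3 4 5 (2 * m 1)
      + 2 * gapQ m 1 2 3 (2 * m 1) * gapQ m 2 3 4 (2 * m 1)
      + 3 / 2 * gapD m 2 5 3 4
      + 4 / 3 * gapQ m 2 3 4 (m 1) * gapQ m 1 2 3 (2 * m 1)
      + 7 / 6 * m 1 * gapQ m 2 4 6 (m 1 ^+ 2)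
      + gapQ m 1 2 3 (m 1) * gapQ m 2 3 4 (m 1)
      + gapD m 0 3 1 2 * gapQ m 2 3 4 (2 * m 1)
      + gapD m 0 2 1 1 * gapQ m 3 4 5 (m 1) + gapQ m 3 5 7 (m 2)
      + 5 / 6 * gapD m 0 4 2 2 * gapQ m 1 2 3 (2 * m 1)
      + 2 / 3 * gapD m 0 4 1 3 * gapQ m 1 2 3 (2 * m 1)
      + 2 / 3 * m 1 ^+ 2 * gapD m 0 2 1 1 * gapD m 0 3 1 2
      + 1 / 2 * gapQ m 1 2 3 (m 1) * gapQ m 2 3 4 (2 * m 1)
      + 1 / 2 * m 1 * gapD m 0 2 1 1 * gapQ m 2 3 4 (2 * m 1)
      + 1 / 2 * m 1 * gapD m 0 2 1 1 * gapD m 0 4 2 2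
      + 1 / 2 * m 2 ^+ 2 * gapQ m 1 2 3 (m 1)
      + 1 / 2 * m 2 * gapQ m 3 4 5 (m 1)
      + 1 / 3 * m 2 * gapD m 0 2 1 1 * gapQ m 1 2 3 (2 * m 1)
      + 1 / 3 * m 1 * (gapD m 0 3 1 2) ^+ 2).
    by moments_pos.
  by rewrite /B1 /B2 /B3 /B4 /B5 /B6 /B7 /gapD /gapQ ?(moments0 hm); field.
have b2 : 0 <= B1 + 1 / 3 * B2 - 4 / 15 * B3 + 7 / 15 * B4 - 19 / 15 * B5 + 14 /
    3 * B6 - 326 / 15 * B7.
  rewrite [leRHS](_ : _ = 349 / 15 * m 1 ^+ 2 * gapD m 0 2 1 1 * gapQ m 1 2 3 (m
      1)
      + 239 / 15 * gapD m 1 3 2 2 * gapQ m 1 2 3 (m 1)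
      + 226 / 15 * gapQ m 1 2 3 (m 1) * gapQ m 2 3 4 (m 1)
      + 437 / 30 * m 1 ^+ 2 * m 2 * gapQ m 1 2 3 (m 1)
      + 136 / 15 * m 1 ^+ 2 * m 3 * gapD m 0 2 1 1
      + 197 / 30 * m 1 * gapD m 2 4 3 3
      + 71 / 15 * gapD m 0 2 1 1 * gapQ m 1 3 5 (m 2)
      + 37 / 10 * m 1 * m 2 ^+ 3 + 31 / 10 * m 1 * m 2 ^+ 2 * gapD m 0 2 1 1
      + 11 / 6 * gapD m 1 6 3 4 + 8 / 5 * m 1 ^+ 3 * (gapD m 0 2 1 1) ^+ 2
      + 3 / 2 * gapD m 0 4 2 2 * gapQ m 1 2 3 (m 1)
      + 3 / 2 * m 1 * (gapD m 0 2 1 1) ^+ 3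
      + 6 / 5 * gapD m 0 2 1 1 * gapQ m 3 4 5 (m 1)
      + 17 / 15 * m 1 ^+ 4 * gapQ m 1 2 3 (m 1)
      + 11 / 10 * gapD m 0 3 1 2 * gapD m 1 3 2 2 + 16 / 15 * gapD m 2 5 3 4
      + gapQ m 1 4 7 (m 3)
      + 29 / 30 * m 1 * gapD m 0 2 1 1 * gapQ m 2 3 4 (m 1)
      + 1 / 2 * m 1 * gapQ m 2 4 6 (m 1 ^+ 2)
      + 1 / 3 * m 1 ^+ 2 * gapQ m 3 4 5 (m 1) + 3 / 10 * m 1 ^+ 7).
    by moments_pos.
  by rewrite /B1 /B2 /B3 /B4 /B5 /B6 /B7 /gapD /gapQ ?(moments0 hm); field.
have b3 : 0 <= B1 + 1 / 2 * B2 - 3 / 10 * B3 + 9 / 20 * B4 - 11 / 10 * B5 + 15 /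
    4 * B6 - 329 / 20 * B7.
  rewrite [leRHS](_ : _ = 879 / 40 * m 1 ^+ 2 * gapD m 0 2 1 1 * gapQ m 1 2 3 (m
      1)
      + 157 / 8 * gapD m 1 3 2 2 * gapQ m 1 2 3 (m 1)
      + 239 / 20 * m 1 ^+ 3 * gapD m 0 4 2 2
      + 119 / 10 * gapQ m 1 2 3 (m 1) * gapQ m 2 3 4 (m 1)
      + 47 / 4 * m 1 ^+ 2 * m 3 * gapD m 0 2 1 1
      + 327 / 40 * gapD m 0 3 1 2 * gapQ m 2 3 4 (m 1)
      + 8 * gapD m 0 2 1 1 * gapQ m 1 3 5 (m 2) + 33 / 8 * m 2 ^+ 2 * m 3
      + 17 / 5 * m 1 ^+ 7 + 13 / 5 * m 1 ^+ 2 * gapQ m 3 4 5 (m 1)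
      + 103 / 40 * gapD m 1 6 3 4 + 5 / 2 * m 5 * gapD m 0 2 1 1
      + 8 / 5 * m 1 ^+ 2 * gapQ m 1 3 5 (m 1 ^+ 2)
      + 37 / 40 * m 1 * gapQ m 2 4 6 (m 1 ^+ 2)
      + 21 / 40 * gapQ m 1 4 7 (m 1 ^+ 3) + 19 / 40 * m 1 * gapD m 2 4 3 3
      + 19 / 40 * m 7).
    by moments_pos.
  by rewrite /B1 /B2 /B3 /B4 /B5 /B6 /B7 /gapD /gapQ ?(moments0 hm); field.
have b4 : 0 <= B1 + 2 / 3 * B2 - 4 / 15 * B3 + 1 / 3 * B4 - 11 / 15 * B5 + 7 / 3
    * B6 - 146 / 15 * B7.
  rewrite [leRHS](_ : _ = 70 / 3 * gapD m 0 3 1 2 * gapD m 0 4 1 3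
      + 56 / 3 * m 1 * m 2 ^+ 2 * gapD m 0 2 1 1
      + 91 / 5 * m 1 ^+ 3 * gapD m 0 4 1 3
      + 84 / 5 * gapD m 0 2 1 1 * gapD m 0 5 2 3
      + 49 / 3 * m 1 * (gapD m 0 2 1 1) ^+ 3
      + 14 * m 1 ^+ 2 * m 3 * gapD m 0 2 1 1 + 56 / 5 * m 1 * gapD m 1 5 2 4
      + 28 / 3 * m 1 ^+ 2 * m 2 * gapD m 0 3 1 2 + 33 / 5 * m 1 ^+ 7
      + 98 / 15 * m 1 ^+ 4 * m 3 + 98 / 15 * gapD m 0 2 1 1 * gapD m 1 4 2 3
      + 14 / 3 * m 3 * gapD m 1 3 2 2 + 43 / 15 * m 1 * m 6
      + 9 / 5 * gapD m 1 6 2 5 + gapD m 0 7 2 5).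
    by moments_pos.
  by rewrite /B1 /B2 /B3 /B4 /B5 /B6 /B7 /gapD /gapQ ?(moments0 hm); field.
have b5 : 0 <= B1 + 5 / 6 * B2 - 1 / 6 * B3 + 1 / 6 * B4 - 1 / 3 * B5 + B6 - 4 *
    B7.
  rewrite [leRHS](_ : _ = 70 / 3 * gapD m 0 3 1 2 * gapD m 0 4 1 3
      + 125 / 6 * m 1 ^+ 3 * gapD m 0 4 1 3 + 257 / 18 * m 2 * m 5
      + 35 / 3 * m 1 * m 3 ^+ 2 + 35 / 3 * gapD m 0 2 1 1 * gapD m 1 4 2 3
      + 181 / 18 * m 1 * (gapD m 0 2 1 1) ^+ 3
      + 55 / 6 * m 1 ^+ 4 * gapD m 0 3 1 2 + 41 / 6 * m 1 * gapD m 0 6 1 5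
      + 109 / 18 * m 1 ^+ 7 + 35 / 6 * gapD m 0 3 1 2 * gapD m 0 4 2 2
      + 29 / 6 * m 1 * m 2 ^+ 2 * gapD m 0 2 1 1
      + 10 / 3 * m 1 ^+ 2 * gapD m 0 5 1 4 + 29 / 9 * m 2 * gapD m 0 5 1 4
      + 29 / 9 * m 1 * m 2 * gapD m 0 4 2 2 + gapD m 0 7 1 6).
    by moments_pos.
  by rewrite /B1 /B2 /B3 /B4 /B5 /B6 /B7 /gapD /gapQ ?(moments0 hm); field.
have b6 : 0 <= B1 + B2.
  rewrite [leRHS](_ : _ = 35 * m 3 * m 4 + 21 * m 2 * m 5 + 7 * m 1 * m 6 + m
      7).
    by moments_pos.
  by rewrite /B1 /B2 /gapD /gapQ ?(moments0 hm); field.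
have -> : partsum (fun pi => falling (1 + th) (size pi) * blockprod m pi)
    (partitions 7) = (1 + th) * (
    B1 + th * B2 + th * (th - 1) * B3 + th * (th - 1) * (th - 2) * B4
    + th * (th - 1) * (th - 2) * (th - 3) * B5
    + th * (th - 1) * (th - 2) * (th - 3) * (th - 4) * B6
    + th * (th - 1) * (th - 2) * (th - 3) * (th - 4) * (th - 5) * B7).
  by rewrite /B1 /B2 /B3 /B4 /B5 /B6 /B7; partsum_expand; ring.
clearbody B1 B2 B3 B4 B5 B6 B7.
rewrite [leRHS](_ : _ = (1 + th) * (
    (1 - th) ^+ 6 * (B1)
    + 6 * th * (1 - th) ^+ 5 * (B1 + 1 / 6 * B2 - 1 / 6 * B3 + 1 / 3 * B4 - B5 +
        4 * B6 - 20 * B7)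
    + 15 * th ^+ 2 * (1 - th) ^+ 4 * (B1 + 1 / 3 * B2 - 4 / 15 * B3 + 7 / 15 *
        B4 - 19 / 15 * B5 + 14 / 3 * B6 - 326 / 15 * B7)
    + 20 * th ^+ 3 * (1 - th) ^+ 3 * (B1 + 1 / 2 * B2 - 3 / 10 * B3 + 9 / 20 *
        B4 - 11 / 10 * B5 + 15 / 4 * B6 - 329 / 20 * B7)
    + 15 * th ^+ 4 * (1 - th) ^+ 2 * (B1 + 2 / 3 * B2 - 4 / 15 * B3 + 1 / 3 * B4
        - 11 / 15 * B5 + 7 / 3 * B6 - 146 / 15 * B7)
    + 6 * th ^+ 5 * (1 - th) * (B1 + 5 / 6 * B2 - 1 / 6 * B3 + 1 / 6 * B4 - 1 /
        3 * B5 + B6 - 4 * B7)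
    + th ^+ 6 * (B1 + B2))).
  by moments_pos.
by field.
Qed.

End MomentInequalities.

(** * Completely monotone sequences of finite order *)

Section CompletelyMonotone.
Variable R : realType.
Implicit Types (f g : nat -> R) (k n : nat).

Definition fdif f : nat -> R := fun n => f n - f n.+1.

Fixpoint cmon k f : Prop :=
  if k is k'.+1 then (forall n, 0 <= f n) /\ cmon k' (fdif f)
  else forall n, 0 <= f n.

Lemma cmon_ge0 k f n : cmon k f -> 0 <= f n.
Proof. by case: k => [|k] /=; [exact|case]. Qed.

Lemma cmonW k f : cmon k.+1 f -> cmon k f.
Proof. by elim: k f => [|k IH] f /= [h0 h1]; [|split => //; apply: IH]. Qed.

Lemma cmon_shift k f : cmon k f -> cmon k (fun n => f n.+1).
Proof. by elim: k f => [|k IH] f /=; [|move=> [h0 /IH h1]]. Qed.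

Lemma eq_cmon k f g : f =1 g -> cmon k f -> cmon k g.
Proof. by move=> /funext ->. Qed.

Lemma cmonD k f g : cmon k f -> cmon k g -> cmon k (fun n => f n + g n).
Proof.
elim: k f g => [|k IH] f g /=; first by move=> hf hg n; rewrite addr_ge0.
move=> [f0 f1] [g0 g1]; split=> [n|]; first by rewrite addr_ge0.
by apply: eq_cmon (IH _ _ f1 g1) => n; rewrite /fdif; ring.
Qed.

(** Leibniz's rule: the difference of f g at n is [fdif f n * g n + f n.+1 * fdif g n], and both
    products fall under the induction hypothesis. *)
Lemma cmonM k f g : cmon k f -> cmon k g -> cmon k (fun n => f n * g n).
Proof.
elim: k f g => [|k IH] f g; first by move=> hf hg n; rewrite mulr_ge0.
move=> hf hg; split=> [n|].
  by rewrite mulr_ge0 // (cmon_ge0 n hf, cmon_ge0 n hg).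
have [_ f1] := hf; have [_ g1] := hg.
have := cmonD (IH _ _ f1 (cmonW hg)) (IH _ _ (cmon_shift (cmonW hf)) g1).
by apply: eq_cmon => n; rewrite /fdif; ring.
Qed.

Lemma cmonX k f i : cmon k f -> cmon k (fun n => f n ^+ i).
Proof.
move=> hf; elim: i => [|i IH].
  have h0 : forall j, cmon j (fun=> 0 : R).
    by elim=> [|j IH] //=; split=> //; apply: eq_cmon IH => n; rewrite /fdif
        subrr.
  case: k hf => [|k] _ /=; first by move=> n; rewrite expr0.
  split=> [n|]; first by rewrite expr0.
  by apply: eq_cmon (h0 k) => n; rewrite /fdif subrr.
by apply: eq_cmon (cmonM hf IH) => n; rewrite exprS.
Qed.

Lemma cmon_lim k (F : nat -> nat -> R) f :
  (forall i, cmon k (F i)) -> (forall n, F i n @[i --> \oo] --> f n) ->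
  cmon k f.
Proof.
have ge0lim (F' : nat -> nat -> R) f' : (forall i n, 0 <= F' i n) ->
    (forall n, F' i n @[i --> \oo] --> f' n) -> forall n, 0 <= f' n.
  move=> h0 hl n; rewrite -(cvg_lim (@Rhausdorff R) (hl n)).
  apply: limr_ge; first by apply/cvg_ex; exists (f' n).
  by apply: nearW => i.
elim: k F f => [|k IH] F f hF hl; first exact: ge0lim hl.
split; first by apply: ge0lim hl => i n; exact: cmon_ge0 (hF i).
apply: (IH (fun i => fdif (F i))) => [i|n]; first by case: (hF i).
by apply: cvgB; apply: hl.
Qed.

(** From derivatives to differences: the functions F_j(x) - F_j(x + 1) form a tower of the same
    kind, and they are nonnegative for j < k because F_j has derivative -F_(j+1) <= 0. *)
Lemma cmon_tower k (F : nat -> R -> R) :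
  (forall j (x : R), is_derive x 1 (F j) (- F j.+1 x)) ->
  (forall j x, (j <= k)%N -> 0 <= F j x) -> cmon k (fun n => F 0 n%:R).
Proof.
elim: k F => [|k IH] F dF F0 /=; first by move=> n; apply: F0.
split=> [n|]; first exact: F0.
apply: (@eq_cmon _ (fun n => F 0 n%:R - F 0 (n%:R + 1))) => [n|].
  by rewrite /fdif natr1.
apply: (IH (fun j x => F j x - F j (x + 1))).
- move=> j x.
  have h := dF j (x + 1).
  have sh : is_derive x (1 : R) (fun y : R => y + 1) 1.
    exact: (is_derive_shift x (1 : R) 1).
  have := @is_derive1_comp R (F j) (fun y => y + 1) x _ 1 h sh.
  rewrite mulr1 => {}h.
  apply: (trigger_derive (is_deriveB (dF j x) h)).
  by rewrite opprK opprB addrC.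
move=> j x jk; rewrite subr_ge0.
have dv y : derivable (F j) y 1 by case: (dF j y).
apply: (@ler0_derive1_nincr R (F j) x (x + 1)) => //.
- move=> y _; rewrite derive1E; have -> := @derive_val _ _ _ _ _ _ _ (dF j y).
  by rewrite oppr_le0 F0.
- by apply: derivable_within_continuous.
- by rewrite lerDl.
Qed.

Lemma cmon_expmom (s : seq (R * R)) k : wfexp s ->
  cmon k (fun n => expmom s 0 n%:R).
Proof.
move=> ws; apply: (cmon_tower (F := expmom s)) => [j x|j x _].
  exact: is_derive_expmom.
rewrite /expmom big_seq sumr_ge0 // => q /(ws.2)[q1 q2].
by rewrite !mulr_ge0 ?exprn_ge0 ?expR_ge0 // ltW.
Qed.

(** The probability measure is the exponential sum f tilted at x: the atom [q.2] receives the mass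
    q.1 exp(- q.2 x) / f(x). *)
Lemma moments_expmom (s : seq (R * R)) (x : R) : wfexp s ->
  moments (fun k => expmom s k x / expmom s 0 x).
Proof.
move=> ws; have f0 := expmom_gt0 x ws; split; first by rewrite divff ?gt_eqF.
exists [seq (q.1 * expR (- q.2 * x) / expmom s 0 x, q.2) | q <- s]; split.
  move=> _ /mapP[q /(ws.2)[q1 q2] ->] /=; split => //.
  by rewrite !mulr_ge0 ?expR_ge0 ?invr_ge0 // ltW.
move=> k; rewrite big_map mulr_suml; apply: eq_bigr => q _ /=; ring.
Qed.

Lemma partsum_blockterm (a x : R) (s : seq (R * R)) l : wfexp s ->
  partsum (blockterm a s x) l = expmom s 0 x `^ a *
    partsum (fun pi => falling a (size pi) *
               blockprod (fun k => expmom s k x / expmom s 0 x) pi) l.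
Proof.
move=> ws; have f0 := expmom_gt0 x ws.
rewrite /partsum mulr_sumr; apply: eq_bigr => q _.
rewrite /blockterm powRB; last by apply/implyP => _; rewrite gt_eqF.
rewrite powR_mulrn ?ltW // /blockprod.
have -> : \prod_(b <- q.2) (expmom s b x / expmom s 0 x) =
    (\prod_(b <- q.2) expmom s b x) / expmom s 0 x ^+ size q.2.
  elim: q.2 => [|b r IH]; first by rewrite !big_nil expr0 divr1.
  by rewrite !big_cons IH exprS invfM; ring.
ring.
Qed.

Lemma cmon_expmom_powR (s : seq (R * R)) (a : R) k : wfexp s ->
  (forall j m, (j <= k)%N -> moments m ->
     0 <= partsum (fun pi => falling a (size pi) * blockprod m pi)
            (partitions j)) ->
  cmon k (fun n => expmom s 0 n%:R `^ a).
Proof.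
move=> ws h.
apply: (@eq_cmon _ (fun n => partsum (blockterm a s n%:R) (partitions 0))).
  move=> n; rewrite /partsum big_cons big_nil /blockterm /falling /blockprod.
  by rewrite big_ord0 big_nil subr0 addr0 !mul1r mulr1.
apply: (cmon_tower (F := fun j x => partsum (blockterm a s x) (partitions j))).
  by move=> j x; apply: is_derive_partsum.
move=> j x jk; rewrite partsum_blockterm //; apply: mulr_ge0.
  exact: powR_ge0.
by apply: h => //; apply: moments_expmom.
Qed.

(** At order 2 the sum a m_2 + a (a - 1) m_1^2 is a times the variance plus a^2 m_1^2, so a >= 0 is
    enough. This is what admits 1 < p < 2 when l <= 2. *)
Lemma partsum_small (a : R) j (m : nat -> R) : (j <= 2)%N -> 0 <= a -> moments m ->
  0 <= partsum (fun pi => falling a (size pi) * blockprod m pi) (partitions j).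
Proof.
case: j => [|[|[|//]]] _ a0 hm.
- by rewrite /partsum big_cons big_nil /blockprod big_nil /falling big_ord0
    addr0 !mulr1.
- partsum_expand; rewrite !(mulr1, mul1r, subr0, addr0).
  by rewrite mulr_ge0 // moments_ge0.
have h : 0 <= gapD m 0 2 1 1 by apply: gapD_ge0.
have -> : partsum (fun pi => falling a (size pi) * blockprod m pi)
    (partitions 2) = a * (gapD m 0 2 1 1 + a * m 1 ^+ 2).
  by rewrite /gapD (moments0 hm); partsum_expand; ring.
by rewrite mulr_ge0 // addr_ge0 // mulr_ge0 // sqr_ge0.
Qed.

Lemma partsum_moments (th : R) j (m : nat -> R) : (j <= 7)%N -> 0 <= th <= 1 ->
  moments m ->
  0 <= partsum (fun pi => falling (1 + th) (size pi) * blockprod m pi)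
         (partitions j).
Proof.
case: j => [|[|[|[|[|[|[|[|//]]]]]]]] _ h hm.
- by apply: partsum_small => //; rewrite addr_ge0 //; case/andP: h.
- by apply: partsum_small => //; rewrite addr_ge0 //; case/andP: h.
- by apply: partsum_small => //; rewrite addr_ge0 //; case/andP: h.
- exact: partsum_moments3.
- exact: partsum_moments4.
- exact: partsum_moments5.
- exact: partsum_moments6.
- exact: partsum_moments7.
Qed.

Definition explim f := exists s : nat -> seq (R * R), (forall i, wfexp (s i)) /\
  forall n, expmom (s i) 0 n%:R @[i --> \oo] --> f n.

Lemma cmon_explim f k : explim f -> cmon k f.
Proof. by move=> [s [ws]]; apply: cmon_lim => i; apply: cmon_expmom. Qed.

Lemma powR_cvg (a l : R) (u : nat -> R) : 0 < l ->
  u i @[i --> \oo] --> l -> u i `^ a @[i --> \oo] --> l `^ a.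
Proof.
move=> l0 ul.
have d : derivable (@powR R ^~ a) l 1.
  by have [] := is_derive1_powR a l0.
have c : {for l, continuous (@powR R ^~ a)}.
  exact/differentiable_continuous/derivable1_diffP.
by have := continuous_cvg _ c ul; apply.
Qed.

Lemma cmon_explim_powR f (a : R) k : explim f -> (forall n, 0 < f n) ->
  (k <= 7)%N /\ 1 <= a \/ (k <= 2)%N /\ 0 <= a ->
  cmon k (fun n => f n `^ a).
Proof.
move=> [s [ws sf]] f0 ka.
have hlim (b : R) : (forall i, cmon k (fun n => expmom (s i) 0 n%:R `^ b)) ->
    cmon k (fun n => f n `^ b).
  by move=> /cmon_lim; apply => n; apply: powR_cvg.
case: ka => [[k7 a1]|[k2 a0]]; last first.
  apply: hlim => i; apply: cmon_expmom_powR => // j m jk hm.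
  by apply: partsum_small => //; apply: leq_trans k2.
(* N is the integer part of a minus 1: f^N is covered by the product rule, and f^(1+th) with 0 <= th
   <= 1 by the moment inequalities. *)
have [N [th [th01 ea]]] : exists (N : nat) (th : R), 0 <= th <= 1 /\
    a = N%:R + (1 + th).
  have /andP[t1 t2] := truncn_itv (le_trans ler01 a1).
  have : (0 < Num.truncn a)%N by rewrite truncn_gt0.
  move: t1 t2; case: (Num.truncn a) => [//|N]; rewrite -!natr1 => t1 t2 _.
  exists N, (a - (N%:R + 1)); split; last by ring.
  by apply/andP; split; lra.
rewrite ea; apply: (@eq_cmon _ (fun n => f n ^+ N * f n `^ (1 + th))) => [n|].
  rewrite [in RHS]powRD ?powR_mulrn ?ltW //.
  by apply/implyP => _; rewrite gt_eqF.
apply: cmonM; first by apply/cmonX/cmon_explim; exists s.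
apply: hlim => i; apply: cmon_expmom_powR => // j m jk hm.
by apply: partsum_moments => //; apply: leq_trans k7.
Qed.

End CompletelyMonotone.

(** * Differences of the ground state *)

Lemma ffact_le_exp m t : (m ^_ t <= m ^ t)%N.
Proof.
elim: t => [|t IH]; first by rewrite ffactn0.
by rewrite ffactnSr expnSr leq_mul // leq_subr.
Qed.

Section BackwardDifference.

(* [n.-1 = 0] at [n = 0]: [iter i bdif u n] is the i-th backward difference
   only for [i <= n], or when [u] vanishes for small indices. *)
Definition bdif (V : zmodType) (u : nat -> V) : nat -> V :=
  fun n => u n - u n.-1.

Variable R : realType.
Implicit Types (u v : nat -> R).

Lemma iter_bdif0 (V : zmodType) (u : nat -> V) i n l : (forall k, (k < l)%N -> u
    k = 0) ->
  (n < l)%N -> iter i (@bdif V) u n = 0.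
Proof.
move=> u0; elim: i n => [|i IH] n nl /=; first exact: u0.
by rewrite /bdif !IH ?subr0 //; apply: leq_ltn_trans nl; apply: leq_pred.
Qed.

Lemma iter_bdif_large (V : zmodType) (u : nat -> V) i n T :
  (forall k, (T <= k)%N -> u k = 0) -> (T + i <= n)%N ->
  iter i (@bdif V) u n = 0.
Proof.
move=> uT; elim: i n => [|i IH] n /= h; first by rewrite uT // -[T]addn0.
by rewrite /bdif !IH ?subr0 //; lia.
Qed.

Lemma iter_bdifD u v i n :
  iter i (@bdif R) (fun k => u k + v k) n =
  iter i (@bdif R) u n + iter i (@bdif R) v n.
Proof. by elim: i n => [|i IH] n //=; rewrite /bdif !IH; ring. Qed.

Lemma iter_bdifZ c u i n :
  iter i (@bdif R) (fun k => c * u k) n = c * iter i (@bdif R) u n.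
Proof. by elim: i n => [|i IH] n //=; rewrite /bdif !IH; ring. Qed.

Lemma eq_iter_bdif (V : zmodType) (u v : nat -> V) i : u =1 v ->
  iter i (@bdif V) u =1 iter i (@bdif V) v.
Proof. by move=> /funext ->. Qed.

Lemma iter_bdif_sum (I : Type) (r : seq I) (F : I -> nat -> R) i n :
  iter i (@bdif R) (fun k => \sum_(j <- r) F j k) n =
  \sum_(j <- r) iter i (@bdif R) (F j) n.
Proof.
elim: r => [|j r IH].
  by rewrite big_nil (@iter_bdif0 _ _ i n n.+1) // => k _; rewrite big_nil.
rewrite big_cons -IH -iter_bdifD.
by apply: eq_iter_bdif => k; rewrite big_cons.
Qed.

Lemma cvg_iter_bdif (U : nat -> nat -> R) u i :
  (forall n, U j n @[j --> \oo] --> u n) ->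
  forall n, iter i (@bdif R) (U j) n @[j --> \oo] --> iter i (@bdif R) u n.
Proof.
by move=> h; elim: i => [|i IH] n /=; [exact: h|apply: cvgB; apply: IH].
Qed.

(** Leibniz's rule with a factor of degree one, whose second difference is zero. The bound [i <= n]
    keeps the recursion away from [0.-1 = 0]. *)
Lemma iter_bdif_linear (c : R) u i n : (i <= n)%N ->
  iter i (@bdif R) (fun k => (k%:R - c) * u k) n =
  (n%:R - c) * iter i (@bdif R) u n + i%:R * iter i.-1 (@bdif R) u n.-1.
Proof.
elim: i n => [|i IH] n; first by rewrite mul0r addr0.
case: n => [//|n]; rewrite ltnS => leq_in.
rewrite iterS {1}/bdif IH; last exact: leq_trans leq_in _.
rewrite IH //= /bdif /= -!natr1.
case: i leq_in {IH} => [|i] leq_in /=; first by ring.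
rewrite /bdif /=; ring.
Qed.

Definition fallfrac l (y : R) : nat -> R :=
  fun n => (n ^_ l)%:R / (n%:R + y).

(** Induction on l: passing to l + 1 multiplies the fraction by the linear factor n - l and takes
    one more difference, so Leibniz's rule has only two terms. *)
Lemma iter_bdif_fallfrac l (y : R) n : 0 < y -> (l <= n)%N ->
  iter l (@bdif R) (fallfrac l y) n =
  l`!%:R * (\prod_(i < l) (y + i%:R)) / \prod_(j < l.+1) (n%:R + y - j%:R).
Proof.
move=> y0; elim: l n => [|l IH] n ln.
  by rewrite /= /fallfrac ffactn0 big_ord0 big_ord_recl big_ord0 subr0 !mulr1.
have -> : iter l.+1 (@bdif R) (fallfrac l.+1 y) n =
    iter l.+1 (@bdif R) (fun k => (k%:R - l%:R) * fallfrac l y k) n.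
  apply: eq_iter_bdif => k; rewrite /fallfrac ffactnSr natrM mulrA.
  congr (_ / _); rewrite mulrC.
  have [lk|kl] := leqP l k; first by rewrite natrB.
  by rewrite ffact_small // !mulr0.
rewrite iter_bdif_linear //= {1}/bdif.
case: n ln => [//|n]; rewrite ltnS => ln.
rewrite !IH //=; last exact: leq_trans ln _.
set P := \prod_(i < l) _.
have nz k : (k <= n.+1)%N -> n.+1%:R + y - k%:R != 0.
  move=> kn; by rewrite gt_eqF // -addrA addrCA -natrB // ltr_wpDr.
set Q := \prod_(j < l) (n%:R + y - j%:R).
have Q0 : Q != 0.
  apply/prodf_neq0 => i _; have := nz i.+1; rewrite -!natr1.
  have -> : n%:R + 1 + y - (i%:R + 1) = n%:R + y - i%:R :> R by ring.
  by apply; rewrite ltnS; apply: leq_trans ln; apply: ltnW.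
have -> : \prod_(j < l.+1) (n%:R + y - j%:R) = Q * (n%:R + y - l%:R).
  by rewrite big_ord_recr.
have sh k : \prod_(j < k.+1) (n.+1%:R + y - j%:R) =
    (n.+1%:R + y) * \prod_(j < k) (n%:R + y - j%:R).
  rewrite big_ord_recl subr0; congr (_ * _); apply: eq_bigr => i _.
  by rewrite /= -!natr1; ring.
rewrite !sh big_ord_recr /= -/Q big_ord_recr /= -/P.
have n1 := nz 0%N isT; rewrite subr0 in n1.
have n2 := nz l.+1 ln; rewrite -!natr1 in n1 n2 *.
have n3 : n%:R + y - l%:R != 0.
  by move: n2; congr (_ != _); ring.
rewrite factS natrM -natr1.
by rewrite -/Q; field; rewrite n1 n3 Q0.
Qed.

End BackwardDifference.

(** * Closure properties of limits of exponential sums *)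

Section ExponentialLimits.
Variable R : realType.
Implicit Types (f g : nat -> R) (s t : seq (R * R)).

Lemma explimD f g : explim f -> explim g -> explim (fun n => f n + g n).
Proof.
move=> [s [ws sf]] [t [wt tg]]; exists (fun i => s i ++ t i); split=> [i|n].
  split; first by have := (ws i).1; case: (s i).
  by move=> q; rewrite mem_cat => /orP[/(ws i).2|/(wt i).2].
rewrite (_ : (fun _ => _) =
    (fun i => expmom (s i) 0 n%:R + expmom (t i) 0 n%:R)); first exact: cvgD.
by apply/funext => i; rewrite /expmom big_cat.
Qed.

Lemma explimZ (c : R) f : 0 < c -> explim f -> explim (fun n => c * f n).
Proof.
move=> c0 [s [ws sf]].
exists (fun i => [seq (c * q.1, q.2) | q <- s i]); split=> [i|n].
  split; first by have := (ws i).1; case: (s i).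
  by move=> _ /mapP[q /(ws i).2[q1 q2] ->] /=; rewrite mulr_gt0.
rewrite (_ : (fun _ => _) = (fun i => c * expmom (s i) 0 n%:R)).
  by apply: cvgM => //; apply: cvg_cst.
apply/funext => i; rewrite /expmom big_map mulr_sumr.
by apply: eq_bigr => q _ /=; rewrite !mulrA.
Qed.

Lemma explimM f g : explim f -> explim g -> explim (fun n => f n * g n).
Proof.
move=> [s [ws sf]] [t [wt tg]].
exists (fun i => [seq (q.1 * r.1, q.2 + r.2) | q <- s i, r <- t i]).
split=> [i|n].
  split.
    have := (ws i).1; have := (wt i).1.
    by case: (s i) => [|q s'] //; case: (t i).
  move=> _ /allpairsP[[q r] [/(ws i).2[q1 q2] /(wt i).2[r1 r2] ->]] /=.
  by rewrite mulr_gt0 ?addr_ge0.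
rewrite (_ : (fun _ => _) =
    (fun i => expmom (s i) 0 n%:R * expmom (t i) 0 n%:R)); first exact: cvgM.
apply/funext => i; rewrite /expmom big_allpairs_dep mulr_suml.
apply: eq_bigr => q _; rewrite mulr_sumr; apply: eq_bigr => r _ /=.
by rewrite opprD mulrDl expRD !expr0; ring.
Qed.

Lemma explim_sum (I : eqType) (r : seq I) (F : I -> nat -> R) : r != [::] ->
  (forall i, i \in r -> explim (F i)) -> explim (fun n => \sum_(i <- r) F i n).
Proof.
case: r => // i r _; elim: r i => [|j r IH] i h.
  have := h i (mem_head _ _).
  by congr explim; apply/funext => n; rewrite big_seq1.
have := explimD (h i (mem_head _ _)) (IH j _).
rewrite (_ : (fun n => \sum_(k <- [:: i, j & r]) F k n) =
    (fun n => F i n + \sum_(k <- j :: r) F k n)).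
  by apply => k kr; apply: h; rewrite inE kr orbT.
by apply/funext => n; rewrite big_cons.
Qed.

Lemma explim_prod k (F : nat -> nat -> R) : (forall i, explim (F i)) ->
  explim (fun n => \prod_(i < k.+1) F i n).
Proof.
move=> h; elim: k => [|k IH].
  by have := h 0%N; congr explim; apply/funext => n; rewrite big_ord1.
have := explimM IH (h k.+1).
by congr explim; apply/funext => n; rewrite [in RHS]big_ord_recr.
Qed.

Lemma expRN_le (x : R) : 0 <= x -> expR (- x) <= (1 + x)^-1.
Proof.
by move=> x0; rewrite expRN lef_pV2 ?posrE ?expR_gt0 ?expR_ge1Dx // ltr_wpDr.
Qed.

(* A Riemann sum for the integral of [expR (- (n + z) * t)] over [t >= 0]. *)
Lemma explim_inv (z : R) : 0 < z -> explim (fun n => (n%:R + z)^-1).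
Proof.
move=> z0; pose d (j : nat) : R := j.+1%:R^-1.
have d0 j : 0 < d j by rewrite invr_gt0.
exists (fun j => [seq (d j * expR (- (d j * k%:R) * z), d j * k%:R) |
                   k <- iota 0 (j.+1 ^ 2)]).
split=> [j|n].
  split; first by rewrite -size_eq0 size_map size_iota expn_eq0.
  move=> _ /mapP[k _ ->] /=; split; first by rewrite mulr_gt0 ?expR_gt0.
  by rewrite mulr_ge0 // ltW.
set c := n%:R + z.
have c0 : 0 < c by rewrite ltr_wpDl.
pose r j := expR (- (d j * c)).
have r1 j : r j < 1 by rewrite expR_lt1 oppr_lt0 mulr_gt0.
(* With mesh 1/(j+1) and (j+1)^2 nodes, hence up to t = j + 1, the sum is geometric with ratio r_j
   and has a closed form. *)
rewrite (_ : (fun _ => _) =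
    (fun j => d j * (1 - expR (- (j.+1%:R * c))) / (1 - r j))); last first.
  apply/funext => j; rewrite /expmom big_map.
  have -> : expR (- (j.+1%:R * c)) = r j ^+ (j.+1 ^ 2).
    rewrite /r -expRM_natl; congr expR.
    have : j.+1%:R != 0 :> R by rewrite pnatr_eq0.
    by rewrite natrX /d; move: (j.+1%:R : R) => a an; field.
  rewrite -mulrA; have /eqP := subrX1 (r j) (j.+1 ^ 2).
  rewrite -(inj_eq oppr_inj) opprB => /eqP ->.
  rewrite -mulNr opprB mulrAC divff ?mul1r; last by rewrite gt_eqF // subr_gt0.
  rewrite -(big_mkord xpredT (fun i => r j ^+ i)) mulr_sumr /index_iota subn0.
  apply: eq_bigr => k _ /=; rewrite expr0 mulr1 -mulrA -expRD.
  by rewrite /r -expRM_natl; congr (_ * expR _); rewrite /c; ring.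
apply: (@squeeze_cvgr _ _ _ _ (fun j => c^-1 * (1 - c^-1 * d j))
   (fun j => c^-1 * (1 + c * d j))).
- apply: nearW => j.
  have x0 : 0 < d j * c by rewrite mulr_gt0.
  have e1 := expRN_le (ltW x0); have e2 := expR_ge1Dx (- (d j * c)).
  have den : 0 < 1 - r j by rewrite subr_gt0.
  have e3 : expR (- (j.+1%:R * c)) <= c^-1 * d j.
    apply: le_trans (expRN_le _) _; first by rewrite mulr_ge0 // ltW.
    rewrite /d -invfM lef_pV2 ?posrE ?mulr_gt0 // ?ltr_wpDl ?mulr_gt0 //.
    by rewrite mulrC lerDr.
  apply/andP; split.
    rewrite ler_pdivlMr //.
    have h1 : c^-1 * (1 - r j) <= d j by rewrite ler_pdivrMl // mulrC /r; lra.
    have h2 : 0 <= 1 - expR (- (j.+1%:R * c)).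
      by rewrite subr_ge0 -expR0 ler_expR oppr_le0 mulr_ge0 // ltW.
    rewrite mulrAC; apply: le_trans (ler_wpM2r h2 h1).
    by rewrite ler_pM2l ?mulr_gt0 ?invr_gt0 //; lra.
  rewrite ler_pdivrMr //; apply: le_trans (_ : d j * 1 <= _).
    by rewrite ler_pM2l // gerBl expR_ge0.
  have h4 : (1 + d j * c) * (1 - r j) >= d j * c.
    have : (1 + d j * c) * r j <= 1.
      by rewrite mulrC -ler_pdivlMr ?div1r // ltr_wpDl ?ltW.
    by lra.
  have -> : d j * 1 = c^-1 * (d j * c) by field; rewrite gt_eqF.
  by rewrite -mulrA ler_pM2l ?invr_gt0 // [c * _]mulrC.
- rewrite -[X in _ --> X]mulr1; apply: cvgM; first exact: cvg_cst.
  rewrite -[X in _ --> X]subr0; apply: cvgB; first exact: cvg_cst.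
  by rewrite -(mulr0 c^-1); apply: cvgM; [exact: cvg_cst|exact: cvg_harmonic].
- rewrite -[X in _ --> X]mulr1; apply: cvgM; first exact: cvg_cst.
  rewrite -[X in _ --> X]addr0; apply: cvgD; first exact: cvg_cst.
  by rewrite -(mulr0 c); apply: cvgM; [exact: cvg_cst|exact: cvg_harmonic].
Qed.

End ExponentialLimits.

(** * Negative powers as limits of positive combinations of simple fractions *)

Section NegativePower.
Variable R : realType.

(* Interlacing zeros and poles make every residue positive. *)
Lemma partial_fractions (a b : nat -> R) N :
  (forall k, 0 < a k) -> (forall k, a k < b k) -> (forall k, b k < a k.+1) ->
  exists r : seq (R * R), [/\ r != [::],
    forall q, q \in r -> [/\ 0 < q.1, 0 < q.2 & q.2 <= a N] &
    forall x, 0 <= x ->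
      (x + a N)^-1 * \prod_(k < N) ((x + b k) / (x + a k)) =
      \sum_(q <- r) q.1 / (x + q.2)].
Proof.
move=> a0 ab ba; elim: N => [|N [r [r0 hr rE]]].
  exists [:: (1, a 0%N)]; split => // [q|x x0].
    by rewrite inE => /eqP -> /=.
  by rewrite big_ord0 big_seq1 mulr1 div1r.
set A := a N.+1; set B := b N.
have BA : B < A by apply: ba.
(* Multiplying 1/(x + q) by (x + B)/(x + A) leaves the residue (B - q)/(A - q) at the old pole and
   creates (A - B)/(A - q) at the new one; both are positive because q < B < A. *)
pose r' := [seq (q.1 * ((B - q.2) / (A - q.2)), q.2) | q <- r].
pose C := \sum_(q <- r) q.1 * ((A - B) / (A - q.2)).
have hq q : q \in r -> q.2 < B by move=> /hr[_ _ h]; apply: le_lt_trans (ab N).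
have C0 : 0 < C.
  case: r r0 hr {rE r'} @C hq => [//|q r] _ hr C hq.
  have pos i : i \in q :: r -> 0 < i.1 * ((A - B) / (A - i.2)).
    move=> ir; have [i1 _ _] := hr i ir; have iB := hq i ir.
    by rewrite mulr_gt0 // divr_gt0 // subr_gt0 // (lt_trans iB).
  rewrite /C big_cons ltr_wpDr //; last exact: pos (mem_head _ _).
  by rewrite big_seq sumr_ge0 // => i ir; rewrite ltW // pos // inE ir orbT.
exists ((C, A) :: r'); split => // [q|x x0].
  rewrite inE => /orP[/eqP -> /=|/mapP[i ir ->] /=]; first by split=> //; apply:
      a0.
  have [i1 i2 _] := hr i ir; have iB := hq i ir.
  split=> //; last by apply/ltW/(lt_trans iB).
  by rewrite mulr_gt0 // divr_gt0 // subr_gt0 // (lt_trans iB).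
rewrite big_ord_recr /= -/A -/B big_cons big_map /= /C.
have xa k : x + a k != 0 by rewrite gt_eqF // ltr_wpDl.
have -> : (x + A)^-1 * (\prod_(k < N) ((x + b k) / (x + a k)) *
     ((x + B) / (x + a N))) = (x + B) / (x + A) *
  ((x + a N)^-1 * \prod_(k < N) ((x + b k) / (x + a k))) by ring.
rewrite rE // mulr_sumr mulr_suml -big_split /= big_seq [RHS]big_seq.
apply: eq_bigr => q qr; have [q1 q2 _] := hr q qr; have qB := hq q qr.
have n1 : x + q.2 != 0 by rewrite gt_eqF // ltr_wpDl.
have n2 : A - q.2 != 0 by rewrite gt_eqF // subr_gt0 (lt_trans qB).
have n3 := xa N.+1; rewrite -/A in n3.
by field; rewrite n1 n2 n3.
Qed.

(** Young's inequality for the product of (1 + u)^t and 1, with exponents 1/t and 1/(1 - t). *)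
Lemma bernoulli_powR (t u : R) : 0 <= t <= 1 -> 0 <= u ->
  (1 + u) `^ t <= 1 + t * u.
Proof.
move=> /andP[t0 t1] u0.
have [->|tn0] := eqVneq t 0; first by rewrite powRr0 mul0r addr0.
have [->|tn1] := eqVneq t 1; first by rewrite powRr1 ?mul1r // addr_ge0.
have u1 : 0 <= 1 + u by rewrite addr_ge0.
have t0' : 0 < t by rewrite lt_neqAle eq_sym tn0.
have t1' : 0 < 1 - t by rewrite subr_gt0 lt_neqAle tn1.
have := @conjugate_powR R ((1 + u) `^ t) 1 t^-1 (1 - t)^-1.
rewrite powR_ge0 ler01 !invr_gt0 !invrK => /(_ isT isT t0' t1').
rewrite addrC subrK => /(_ erefl).
rewrite -powRrM mulfV // powRr1 // powR1 mulr1 => h; apply: le_trans h _.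
by rewrite mul1r; lra.
Qed.

(** Bernoulli's inequality for 1 - t gives 1 + u <= (1 + u)^t (1 + (1 - t) u); the rest is (1 + t
    u)(1 + (1 - t) u) <= (1 + u)(1 + u^2). *)
Lemma bernoulli_powR_rev (t u : R) : 0 <= t <= 1 -> 0 <= u ->
  1 + t * u <= (1 + u) `^ t * (1 + u ^+ 2).
Proof.
move=> /andP[t0 t1] u0.
have := @bernoulli_powR (1 - t) u; rewrite subr_ge0 t1 gerBl t0 => /(_ isT u0)
    h.
have u1 : 0 < 1 + u by rewrite ltr_wpDr.
have pt : 0 < (1 + u) `^ t by rewrite powR_gt0.
have p1 : (1 + u) `^ (1 - t) = (1 + u) / (1 + u) `^ t.
  by rewrite powRB ?powRr1 ?ltW //; apply/implyP => _; rewrite gt_eqF.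
have : 1 + u <= (1 + u) `^ t * (1 + (1 - t) * u).
  by rewrite -ler_pdivrMl // mulrC -p1.
have d0 : 0 < 1 + (1 - t) * u by rewrite ltr_wpDr // mulr_ge0 // subr_ge0.
move=> h2; rewrite -(ler_pM2r d0).
apply: le_trans (_ : (1 + u) * (1 + u ^+ 2) <= _); last first.
  by rewrite mulrAC ler_wpM2r // addr_ge0 // sqr_ge0.
have : t * (1 - t) <= 1 by nra.
have u2 : 0 <= u ^+ 2 by rewrite sqr_ge0.
have u3 : 0 <= u ^+ 3 by rewrite exprn_ge0.
move=> ht; have := ler_wpM2r u2 ht.
have -> : (1 + t * u) * (1 + (1 - t) * u) = 1 + u + t * (1 - t) * u ^+ 2 by
    ring.
have -> : (1 + u) * (1 + u ^+ 2) = 1 + u + u ^+ 2 + u ^+ 3 by ring.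
by lra.
Qed.

(* With mesh 1/A^2 and A^3 factors the product of (x + b k) / (x + a k)
   approximates ((x + A) / x)^s. *)
Definition mesh (i : nat) : R := (i.+1%:R ^+ 2)^-1.

Definition pole i k : R := k.+1%:R * mesh i.

Definition zero_ s i k : R := (k.+1%:R + s) * mesh i.

Definition negpow_approx s i x : R := i.+1%:R `^ (1 - s) *
  ((x + pole i (i.+1 ^ 3))^-1 *
   \prod_(k < i.+1 ^ 3) ((x + zero_ s i k) / (x + pole i k))).

Lemma negpow_approx_sum s i : 0 < s < 1 ->
  exists r : seq (R * R), [/\ r != [::],
    forall q, q \in r -> 0 < q.1 /\ 0 < q.2 &
    forall x, 0 <= x -> negpow_approx s i x = \sum_(q <- r) q.1 / (x + q.2)].
Proof.
move=> /andP[s0 s1].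
have m0 : 0 < mesh i by rewrite invr_gt0 exprn_gt0.
have [||| r [r0 hr rE]] := @partial_fractions (pole i) (zero_ s i) (i.+1 ^ 3).
- by move=> k; rewrite mulr_gt0.
- by move=> k; rewrite ltr_pM2r // ltrDl.
- by move=> k; rewrite ltr_pM2r // -[k.+2%:R]natr1 ltrD2l.
have A0 : 0 < i.+1%:R `^ (1 - s) :> R by rewrite powR_gt0.
exists [seq (i.+1%:R `^ (1 - s) * q.1, q.2) | q <- r]; split.
- by case: (r) r0.
- by move=> _ /mapP[q /hr[q1 q2 _] ->] /=; rewrite mulr_gt0.
move=> x x0; rewrite /negpow_approx rE // big_map mulr_sumr.
by apply: eq_bigr => q _ /=; rewrite mulrA.
Qed.

Definition negpow_low s i x : R :=
  (1 + (x + mesh i) / i.+1%:R) `^ (- (1 - s)) * (x + mesh i) `^ (- s).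

(** Each factor is 1 + s u_k with u_k = mesh/(x + pole k). Bernoulli's inequality compares it with
    (1 + u_k)^s, and the product of the 1 + u_k telescopes. As x >= 1, each relative error u_k^2 is
    at most A^(-4), and A^3 factors accumulate at most exp(1/A). *)
Lemma negpow_approx_bounds s i x : 0 < s < 1 -> 1 <= x ->
  negpow_low s i x <= negpow_approx s i x <=
  negpow_low s i x * expR (i.+1%:R^-1).
Proof.
move=> /andP[s0 s1] x1; set L := negpow_low s i x.
pose y := x + mesh i; set A : R := i.+1%:R; set N := (i.+1 ^ 3)%N.
have s01 : 0 <= s <= 1 by rewrite !ltW.
have A0 : 0 < A by [].
have m0 : 0 < mesh i by rewrite invr_gt0 exprn_gt0.
have xp k : 0 < x + pole i k.
  by rewrite ltr_wpDr ?(lt_le_trans ltr01) // mulr_ge0 // ltW.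
pose u k := mesh i / (x + pole i k).
have u0 k : 0 <= u k by rewrite divr_ge0 // ltW.
have u1 k : 0 <= 1 + u k by rewrite addr_ge0.
have y0 : 0 < y by rewrite /y; have := xp 0%N; rewrite /pole mul1r.
have tel n : \prod_(k < n) (1 + u k) = (x + pole i n) / y.
  elim: n => [|n IH]; first by rewrite big_ord0 /pole mul1r divff // gt_eqF.
  rewrite big_ord_recr IH /= /u.
  have -> : x + pole i n.+1 = x + pole i n + mesh i by rewrite /pole
      -[n.+2%:R]natr1; ring.
  by field; rewrite !gt_eqF.
have facE k : (x + zero_ s i k) / (x + pole i k) = 1 + s * u k.
  have h : x + pole i k != 0 by rewrite gt_eqF.
  have -> : x + zero_ s i k = x + pole i k + s * mesh i by rewrite /zero_ /pole;
      ring.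
  by rewrite /u; field.
pose P := \prod_(k < N) ((x + zero_ s i k) / (x + pole i k)).
have powprod n : (\prod_(k < n) (1 + u k)) `^ s = \prod_(k < n) (1 + u k) `^ s.
  elim: n => [|n IH]; first by rewrite !big_ord0 powR1.
  by rewrite !big_ord_recr /= powRM ?IH // prodr_ge0.
have P1 : ((x + pole i N) / y) `^ s <= P.
  rewrite -tel powprod; apply: ler_prod => k _.
  by rewrite powR_ge0 facE bernoulli_powR.
have P2 : P <= ((x + pole i N) / y) `^ s * expR A^-1.
  apply: le_trans (_ : \prod_(k < N) ((1 + u k) `^ s * expR (mesh i ^+ 2)) <=
      _).
    apply: ler_prod => k _; rewrite facE; apply/andP; split.
      by rewrite addr_ge0 // mulr_ge0 // ltW.
    apply: le_trans (bernoulli_powR_rev s01 (u0 k)) _.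
    rewrite ler_wpM2l ?powR_ge0 //; apply: le_trans (expR_ge1Dx _).
    rewrite lerD2l; apply: lerXn2r; rewrite ?nnegrE ?u0 ?(ltW m0) //.
    rewrite /u ler_pdivrMr // ler_peMr ?(ltW m0) //.
    by apply: le_trans x1 _; rewrite lerDl mulr_ge0 // ltW.
  rewrite big_split /= -powprod tel ler_wpM2l ?powR_ge0 //.
  rewrite prodr_const card_ord -expRM_natl ler_expR /mesh.
  rewrite natrX -/A.
  have -> : A ^+ 3 * (A ^+ 2)^-1 ^+ 2 = A^-1 by field; rewrite gt_eqF.
  by [].
have pN : x + pole i N = A * (1 + y * A^-1).
  rewrite /pole /y -natr1 natrX -/A mulrDl.
  have -> : A ^+ 3 * mesh i = A by rewrite /mesh -/A; field; rewrite gt_eqF.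
  by field; rewrite gt_eqF.
have yA : 0 < 1 + y * A^-1 by rewrite addr_gt0 // divr_gt0.
have LE : L = A `^ (1 - s) * ((x + pole i N)^-1 * ((x + pole i N) / y) `^ s).
  have xN := xp N.
  have e1 : ((x + pole i N) / y) `^ s = (x + pole i N) `^ s * y `^ (- s).
    by rewrite powRM ?invr_ge0 ?ltW // -powR_inv1 ?ltW // -powRrM mulN1r.
  have e2 : (x + pole i N)^-1 * (x + pole i N) `^ s = (x + pole i N) `^ (- (1 -
      s)).
    rewrite -powR_inv1 ?ltW // -powRD; last by apply/implyP => _; rewrite
        gt_eqF.
    by congr (_ `^ _); ring.
  rewrite e1 [_^-1 * (_ * _)]mulrA e2 pN powRM ?ltW // 2!mulrA.
  rewrite -powRD; last by apply/implyP => _; rewrite gt_eqF.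
  by rewrite subrr powRr0 mul1r.
have c0 : 0 <= A `^ (1 - s) * (x + pole i N)^-1.
  by rewrite mulr_ge0 ?powR_ge0 // invr_ge0 ltW.
rewrite /negpow_approx -/A -/N -/P LE !mulrA.
apply/andP; split; first exact: ler_wpM2l.
by rewrite -[leRHS]mulrA ler_wpM2l.
Qed.

Lemma cvg_negpow_approx s x : 0 < s < 1 -> 1 <= x ->
  negpow_approx s i x @[i --> \oo] --> x `^ (- s).
Proof.
move=> s01 x1; have x0 : 0 < x by apply: lt_le_trans x1.
pose h (i : nat) : R := i.+1%:R^-1.
have hh : h i @[i --> \oo] --> (0 : R) by exact: cvg_harmonic.
have meshE i : mesh i = h i * h i by rewrite /mesh expr2 invfM.
have cy : x + mesh i @[i --> \oo] --> x.
  rewrite -[X in _ --> X]addr0; apply: cvgD; first exact: cvg_cst.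
  rewrite (_ : mesh = fun i => h i * h i); last exact/funext.
  by rewrite -(mulr0 0); apply: cvgM.
have cL : negpow_low s i x @[i --> \oo] --> x `^ (- s).
  rewrite (_ : x `^ (- s) = 1 `^ (- (1 - s)) * x `^ (- s)); last first.
    by rewrite powR1 mul1r.
  apply: cvgM; apply: powR_cvg => //.
  rewrite -[X in _ --> X]addr0; apply: cvgD; first exact: cvg_cst.
  by rewrite -(mulr0 x); apply: cvgM.
apply: (squeeze_cvgr _ cL (_ : negpow_low s i x * expR (h i) @[i --> \oo] -->
    _)).
  by apply: nearW => i; apply: negpow_approx_bounds.
rewrite -[X in _ --> X]mulr1 -expR0; apply: cvgM => //.
by apply: continuous_cvg => //; apply: continuous_expR.
Qed.

End NegativePower.

(** * Complete monotonicity of the top difference *)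

Section TopDifference.
Variable R : realType.

(** The ground state on the naturals, for s = 1/p: one factor n is moved from the power into the
    product, which becomes a falling factorial. *)
Definition gseq (l : nat) (s : R) (n : nat) : R := (n ^_ l)%:R * n%:R `^ (- s).

Definition gdiff l s i : nat -> R := iter i (@bdif R) (gseq l s).

(** Writing n = l + m turns n + y - j into m + (y + (l - j)) with a positive shift, so that each
    factor of the denominator is of the form treated by [explim_inv]. *)
Lemma iter_bdif_approx l (s : R) i : 0 < s < 1 -> exists r : seq (R * R),
  [/\ r != [::], forall q, q \in r -> 0 < q.1 /\ 0 < q.2 &
  forall m, iter l (@bdif R) (fun n => (n ^_ l)%:R * negpow_approx s i n%:R)
      (l + m) = \sum_(q <- r) q.1 * (l`!%:R * (\prod_(j < l) (q.2 + j%:R)) *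
                  \prod_(j < l.+1) (m%:R + (q.2 + (l - j)%:R))^-1)].
Proof.
move=> s01; have [r [r0 hr rE]] := negpow_approx_sum i s01.
exists r; split=> // m.
rewrite (eq_iter_bdif (v := fun n => \sum_(q <- r) q.1 * fallfrac l q.2 n));
    last first.
  move=> n; rewrite rE // mulr_sumr; apply: eq_bigr => q _.
  by rewrite /fallfrac; ring.
rewrite iter_bdif_sum big_seq [RHS]big_seq; apply: eq_bigr => q /hr[q1 q2].
rewrite iter_bdifZ iter_bdif_fallfrac ?leq_addr // prodfV; congr (_ * (_ *
    _^-1)).
apply: eq_bigr => j _.
by rewrite natrD natrB ?leq_ord //; ring.
Qed.

Lemma cvg_gdiff_approx l (s : R) n : 0 < s < 1 -> (0 < l)%N ->
  iter l (@bdif R) (fun n => (n ^_ l)%:R * negpow_approx s i n%:R) n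
    @[i --> \oo] --> gdiff l s l n.
Proof.
move=> s01 l0; apply: (@cvg_iter_bdif R
  (fun i n => (n ^_ l)%:R * negpow_approx s i n%:R)) => {n} [[|n]].
  rewrite /gseq ffact0n; case: l l0 => // l _ /=.
  rewrite mul0r (_ : (fun _ => _) = cst 0); first exact: cvg_cst.
  by apply/funext => i; rewrite mul0r.
apply: cvgM; first exact: cvg_cst.
by apply: cvg_negpow_approx => //; rewrite ler1n.
Qed.

(** No diagonal sequence is extracted: [cmon] passes through the two limits one after the other.
    Strict positivity of the approximants is kept for their fractional powers. *)
Lemma explim_gdiff l (s : R) : 0 < s < 1 -> (0 < l)%N ->
  exists F : nat -> nat -> R, [/\ forall i, explim (F i),
    forall i m, 0 < F i m &
    forall m, F i m @[i --> \oo] --> gdiff l s l (l + m)].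
Proof.
move=> s01 l0; exists (fun i m => iter l (@bdif R)
  (fun n => (n ^_ l)%:R * negpow_approx s i n%:R) (l + m)); split.
- move=> i; have [r [r0 hr rE]] := iter_bdif_approx l i s01.
  suff : explim (fun m => \sum_(q <- r) q.1 * (l`!%:R *
      (\prod_(j < l) (q.2 + j%:R)) *
      \prod_(j < l.+1) (m%:R + (q.2 + (l - j)%:R))^-1)).
    by congr explim; apply/funext => m; rewrite rE.
  apply: explim_sum => // q /hr[q1 q2]; apply: explimZ => //; apply: explimZ.
    rewrite mulr_gt0 ?ltr0n ?fact_gt0 // prodr_gt0 // => j _.
    by rewrite ltr_wpDr.
  apply: (@explim_prod _ _ (fun j m => (m%:R + (q.2 + (l - j)%:R))^-1)) => j.
  by apply: explim_inv; rewrite ltr_wpDr.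
- move=> i m; have [r [r0 hr ->]] := iter_bdif_approx l i s01.
  have pos q : q \in r -> 0 < q.1 * (l`!%:R * (\prod_(j < l) (q.2 + j%:R)) *
                  \prod_(j < l.+1) (m%:R + (q.2 + (l - j)%:R))^-1).
    move=> /hr[q1 q2]; rewrite mulr_gt0 // mulr_gt0 //.
      rewrite mulr_gt0 ?ltr0n ?fact_gt0 // prodr_gt0 // => j _.
      by rewrite ltr_wpDr.
    by rewrite prodr_gt0 // => j _; rewrite invr_gt0 ltr_wpDl // ltr_wpDr.
  case: r r0 hr pos => // q r _ hr pos; rewrite big_cons ltr_wpDr //.
    by rewrite big_seq sumr_ge0 // => q' qr; rewrite ltW // pos // inE qr orbT.
  by rewrite pos // mem_head.
move=> m; exact: cvg_gdiff_approx.
Qed.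

Lemma cmon_gdiff l (s : R) k : 0 < s < 1 -> (0 < l)%N ->
  cmon k (fun m => gdiff l s l (l + m)).
Proof.
move=> s01 l0; have [F [Fe _ Fl]] := explim_gdiff s01 l0.
by apply: cmon_lim Fl => i; apply: cmon_explim.
Qed.

Lemma cmon_gdiff_powR l (s a : R) : 0 < s < 1 -> (0 < l)%N ->
  (forall m, 0 < gdiff l s l (l + m)) ->
  [\/ (exists N : nat, a = N%:R), (l <= 7)%N /\ 1 <= a | (l <= 2)%N /\ 0 <= a] ->
  cmon l (fun m => gdiff l s l (l + m) `^ a).
Proof.
move=> s01 l0 hp [[N ->]|h|h].
- apply: (@eq_cmon _ _ (fun m => gdiff l s l (l + m) ^+ N)) => [m|].
    by rewrite powR_mulrn // ltW.
  exact/cmonX/cmon_gdiff.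
- have [F [Fe Fp Fl]] := explim_gdiff s01 l0.
  apply: (@cmon_lim _ _ (fun i m => F i m `^ a)) => [i|m].
    by apply: cmon_explim_powR => //; left.
  exact: powR_cvg.
have [F [Fe Fp Fl]] := explim_gdiff s01 l0.
apply: (@cmon_lim _ _ (fun i m => F i m `^ a)) => [i|m].
  by apply: cmon_explim_powR => //; right.
exact: powR_cvg.
Qed.

End TopDifference.

(** * Growth of the differences of the ground state *)

Section DifferenceBounds.
Variables (R : realType) (l : nat) (s : R).
Hypotheses (s01 : 0 < s < 1) (l0 : (0 < l)%N).
Local Notation g := (gdiff l s).

Lemma gdiffS i n : g i.+1 n = g i n - g i n.-1. Proof. by []. Qed.

Lemma gdiff_topE n : g l n = g l.-1 n - g l.-1 n.-1.
Proof. by have := gdiffS l.-1 n; rewrite prednK. Qed.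

Lemma gdiff_small i n : (n < l)%N -> g i n = 0.
Proof.
by apply: iter_bdif0 => k kl; rewrite /gseq ffact_small ?mul0r.
Qed.

Lemma gdiff_top_ge0 n : 0 <= g l n.
Proof.
have [nl|ln] := ltnP n l; first by rewrite gdiff_small.
by rewrite -(subnKC ln) (cmon_ge0 (n - l)%N (cmon_gdiff 0 s01 l0)).
Qed.

Lemma gdiff_top_decr n m : (l <= n)%N -> (n <= m)%N -> g l m <= g l n.
Proof.
move=> ln; have [_ h] := cmon_gdiff 1 s01 l0.
elim: m => [|m IH]; first by rewrite leqn0 => /eqP ->.
rewrite leq_eqVlt => /orP[/eqP -> //|]; rewrite ltnS => nm.
apply: le_trans (IH nm); have := h (m - l)%N.
by rewrite /fdif subr_ge0 addnS subnKC // (leq_trans ln).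
Qed.

Lemma gdiff_ge0 i n : (i <= l)%N -> 0 <= g i n.
Proof.
move=> il; rewrite -(subKn il); elim: (l - i)%N n => [|j IH] n.
  by rewrite subn0 gdiff_top_ge0.
have [lj|jl] := leqP l j.
  have -> : (l - j.+1 = l - j)%N by lia.
  exact: IH.
have e : (l - j = (l - j.+1).+1)%N by lia.
elim: n => [|n IHn]; first by rewrite gdiff_small.
have := IH n.+1; rewrite e gdiffS subr_ge0; exact: le_trans.
Qed.

Lemma gdiff_incr i n m : (i < l)%N -> (n <= m)%N -> g i n <= g i m.
Proof.
move=> il; elim: m => [|m IH]; first by rewrite leqn0 => /eqP ->.
rewrite leq_eqVlt => /orP[/eqP -> //|]; rewrite ltnS => /IH h.
by apply: le_trans h _; have := gdiff_ge0 m.+1 il; rewrite gdiffS subr_ge0.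
Qed.

(** g_i is the sum of g_(i+1) over the indices up to n, and g_(i+1) increases as long as i + 1 <
    l. *)
Lemma gdiff_le_mul i n : (i.+1 < l)%N -> g i n <= n%:R * g i.+1 n.
Proof.
move=> il; elim: n => [|n IH]; first by rewrite mul0r gdiff_small.
have e : g i n.+1 = g i n + g i.+1 n.+1 by rewrite gdiffS; ring.
rewrite e -natr1 mulrDl mul1r lerD2r; apply: le_trans IH _.
by rewrite ler_wpM2l // gdiff_incr.
Qed.

Lemma gdiff_ge_mul i n t : (i.+1 < l)%N -> t%:R * g i.+1 n <= g i (n + t).
Proof.
move=> il; elim: t => [|t IH]; first by rewrite mul0r gdiff_ge0 // ltnW // ltnW.
have -> : g i (n + t.+1) = g i (n + t) + g i.+1 (n + t.+1).
  by rewrite gdiffS addnS; ring.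
rewrite -natr1 mulrDl mul1r lerD // gdiff_incr //; lia.
Qed.

(** The top difference decreases from l on, so its last value is at most the mean over l, ..., n. *)
Lemma gdiff_top_le_mul n : (l <= n)%N ->
  (n - l).+1%:R * g l n <= g l.-1 n.
Proof.
move=> ln; rewrite -(subnKC ln) addKn; elim: (n - l)%N => [|t IH].
  by rewrite mul1r addn0 gdiff_topE (@gdiff_small _ l.-1) ?prednK ?subr0.
have -> : g l.-1 (l + t.+1) = g l.-1 (l + t) + g l (l + t.+1).
  by rewrite gdiff_topE addnS; ring.
rewrite -natr1 mulrDl mul1r lerD2r; apply: le_trans IH.
by rewrite ler_wpM2l // gdiff_top_decr ?leq_addr // leq_add2l.
Qed.

Lemma gdiff_top_ge_mul n t : (l <= n)%N ->
  g l.-1 (n + t) - g l.-1 n <= t%:R * g l n.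
Proof.
move=> ln; elim: t => [|t IH]; first by rewrite addn0 subrr mul0r.
have -> : g l.-1 (n + t.+1) = g l.-1 (n + t) + g l (n + t.+1).
  by rewrite gdiff_topE addnS; ring.
rewrite -natr1 mulrDl mul1r addrAC lerD // gdiff_top_decr //; lia.
Qed.

Lemma powR_add (x a b : R) : 0 < x -> x `^ a * x `^ b = x `^ (a + b).
Proof. by move=> x0; rewrite powRD //; apply/implyP => _; rewrite gt_eqF. Qed.

Lemma powR_1D (x a : R) : 0 < x -> x * x `^ a = x `^ (1 + a).
Proof. by move=> x0; rewrite -powR_add // powRr1 // ltW. Qed.

Let natpos n : (l <= n)%N -> 0 < n%:R :> R.
Proof. by move=> ln; rewrite ltr0n (leq_trans l0). Qed.

Lemma gdiff0_le n : (l <= n)%N -> g 0 n <= n%:R `^ (l%:R - s).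
Proof.
move=> ln; have n0 := natpos ln.
rewrite -powR_add // powR_mulrn ?(ltW n0) // /gdiff /= /gseq.
rewrite ler_wpM2r ?powR_ge0 //.
by rewrite -natrX ler_nat ffact_le_exp.
Qed.

Lemma gdiff0_ge n : (l <= n)%N -> l%:R ^- l * n%:R `^ (l%:R - s) <= g 0 n.
Proof.
move=> ln; have n0 := natpos ln.
rewrite -powR_add // powR_mulrn ?(ltW n0) // mulrA /gdiff /= /gseq.
rewrite ler_wpM2r ?powR_ge0 // mulrC ler_pdivrMr ?exprn_gt0 ?natpos //.
rewrite -!natrX -natrM ler_nat.
suff : forall k, (k <= l)%N -> (n ^ k <= n ^_ k * l ^ k)%N by apply.
elim=> [|k IH] kl //; rewrite ffactnSr !expnSr mulnACA leq_mul ?IH //.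
  exact: ltnW.
nia.
Qed.

(** The orders of growth are those of the derivatives of x^(l-s). Below the top, monotonicity gives
    n g_(i+1)(n) <= g_i(2n); at the top the mean value bound is used, with n <= l (n - l + 1). *)
Lemma gdiff_upper : exists2 C : R, 0 < C & forall i n, (i <= l)%N -> (l <= n)%N ->
  g i n <= C * n%:R `^ (l%:R - i%:R - s).
Proof.
have step i : (i <= l)%N -> exists2 C : R, 0 < C &
    forall n, (l <= n)%N -> g i n <= C * n%:R `^ (l%:R - i%:R - s).
  elim: i => [|i IH] il.
    by exists 1 => // n ln; rewrite mul1r subr0 gdiff0_le.
  have [C C0 hC] := IH (ltnW il).
  have [li|il'] := ltnP i.+1 l; last first.
    have e : i.+1 = l by lia.
    exists (C * l%:R); first by rewrite mulr_gt0 ?ltr0n.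
    move=> n ln; have n0 := natpos ln.
    have h1 : (n - l).+1%:R * g i.+1 n <= g i n.
      rewrite e (_ : i = l.-1); first exact: gdiff_top_le_mul.
      by lia.
    have h2 := hC n ln.
    have h3 : n%:R * g i.+1 n <= l%:R * (C * n%:R `^ (l%:R - i%:R - s)).
      apply: le_trans (_ : l%:R * ((n - l).+1%:R * g i.+1 n) <= _); last first.
        by rewrite ler_pM2l ?ltr0n // (le_trans h1).
      rewrite mulrA ler_wpM2r ?gdiff_ge0 ?e // -natrM ler_nat; nia.
    rewrite -(ler_pM2l n0); apply: le_trans h3 _.
    rewrite -[i.+1%:R]natr1.
    rewrite (_ : l%:R - i%:R - s = 1 + (l%:R - (i%:R + 1) - s)); last by ring.
    by rewrite -powR_1D // le_eqVlt; apply/orP; left; apply/eqP; ring.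
  exists (C * 2 `^ (l%:R - i%:R - s)); first by rewrite mulr_gt0 ?powR_gt0.
  move=> n ln; have n0 := natpos ln.
  have h1 := gdiff_ge_mul n n li.
  have h2 := hC (n + n)%N (leq_trans ln (leq_addr _ _)).
  rewrite -(ler_pM2l n0); apply: le_trans h1 _; apply: le_trans h2 _.
  rewrite -[i.+1%:R]natr1.
  rewrite (_ : (n + n)%:R = 2 * n%:R :> R); last by rewrite natrD; ring.
  rewrite powRM ?(ltW n0) //.
  rewrite (_ : l%:R - i%:R - s = 1 + (l%:R - (i%:R + 1) - s)); last by ring.
  by rewrite -[n%:R `^ (1 + _)]powR_1D // le_eqVlt; apply/orP; left; apply/eqP;
      ring.
suff : forall k, (k <= l)%N -> exists2 C : R, 0 < C & forall i n, (i <= k)%N ->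
    (l <= n)%N -> g i n <= C * n%:R `^ (l%:R - i%:R - s).
  by move=> /(_ l (leqnn l)).
elim=> [|k IH] kl.
  have [C C0 hC] := step 0%N kl; exists C => // i n.
  by rewrite leqn0 => /eqP -> /hC.
have [C C0 hC] := step _ kl; have [D D0 hD] := IH (ltnW kl).
exists (C + D); first by rewrite addr_gt0.
move=> i n; rewrite leq_eqVlt => /orP[/eqP ->|] ln.
  apply: le_trans (hC n ln) _.
  by rewrite ler_wpM2r ?powR_ge0 // lerDl ltW.
move=> ln'; apply: le_trans (hD _ _ ln ln') _.
by rewrite ler_wpM2r ?powR_ge0 // lerDr ltW.
Qed.

Lemma gdiff_pred_lower n : (l <= n)%N ->
  l%:R ^- l * n%:R `^ (1 - s) <= g l.-1 n.
Proof.
move=> ln; have n0 := natpos ln.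
have h i : (i < l)%N -> g 0 n <= n%:R ^+ i * g i n.
  elim: i => [|i IH] il; first by rewrite mul1r.
  apply: le_trans (IH (ltnW il)) _; rewrite exprSr -mulrA.
  by rewrite ler_wpM2l ?exprn_ge0 // gdiff_le_mul.
have h1 : (l.-1 < l)%N by rewrite prednK.
have h2 := le_trans (gdiff0_ge ln) (h _ h1).
rewrite -(@ler_pM2l _ (n%:R ^+ l.-1)) ?exprn_gt0 //; apply: le_trans _ h2.
rewrite mulrCA -[n%:R ^+ _]powR_mulrn ?(ltW n0) // powR_add //.
rewrite (_ : l.-1%:R + (1 - s) = l%:R - s) //.
by rewrite -{2}(prednK l0) -natr1; ring.
Qed.

Lemma powR_unbounded (e B : R) : 0 < e -> exists2 K : nat, (0 < K)%N & B <= K%:R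
    `^ e.
Proof.
move=> e0; pose x := Num.max B 1 `^ e^-1.
have x0 : 0 <= x by exact: powR_ge0.
exists (Num.truncn x).+1 => //.
have h : x <= (Num.truncn x).+1%:R by apply/ltW; have /andP[] := truncn_itv x0.
have m0 : 0 <= Num.max B 1 by rewrite le_max ler01 orbT.
apply: le_trans (_ : x `^ e <= _).
  by rewrite -powRrM mulVf ?gt_eqF // powRr1 // le_max lexx.
by rewrite ge0_ler_powR ?nnegrE // ltW.
Qed.

(** The growth of g_(l-1) forces it: K is so large that g_(l-1)(K n) >= (C + 1) n^(1-s), while
    g_(l-1)(n) <= C n^(1-s), and the K n - n values of g_l in between are at most g_l(n). This also
    yields g_l > 0, which a limit of positive sequences leaves open. *)
Lemma gdiff_top_lower : exists2 c : R, 0 < c &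
  forall n, (l <= n)%N -> c * n%:R `^ (- s) <= g l n.
Proof.
have [C C0 hC] := gdiff_upper.
have c0 : 0 < l%:R ^- l :> R by rewrite invr_gt0 exprn_gt0 ?ltr0n.
have s1 : 0 < 1 - s by rewrite subr_gt0; case/andP: s01.
have [K K0 hK] := powR_unbounded ((C + 1) / l%:R ^- l) s1.
exists K%:R^-1; first by rewrite invr_gt0 ltr0n.
move=> n ln; have n0 := natpos ln.
have nK : (n <= n * K)%N by rewrite leq_pmulr.
have h1 := gdiff_top_ge_mul (n * K - n) ln; rewrite subnKC // in h1.
have h2 := gdiff_pred_lower (leq_trans ln nK).
have h3 := hC _ _ (leq_pred l) ln.
have h4 : (n * K - n)%:R * g l n <= n%:R * K%:R * g l n.
  by rewrite ler_wpM2r ?gdiff_top_ge0 // -natrM ler_nat leq_subr.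
have e1 : l%:R - l.-1%:R - s = 1 - s.
  by rewrite -{1}(prednK l0) -natr1; ring.
rewrite e1 in h3; rewrite natrM powRM // in h2.
have h5 : (C + 1) * n%:R `^ (1 - s) <=
    l%:R ^- l * (n%:R `^ (1 - s) * K%:R `^ (1 - s)).
  rewrite mulrCA [X in X <= _]mulrC ler_wpM2l ?powR_ge0 //.
  by rewrite mulrC -ler_pdivrMr.
have h6 : n%:R `^ (1 - s) <= n%:R * K%:R * g l n by lra.
rewrite ler_pdivrMl ?ltr0n // -(ler_pM2l n0) powR_1D // mulrA.
by [].
Qed.

Lemma gdiff_top_gt0 n : (l <= n)%N -> 0 < g l n.
Proof.
move=> ln; have [c c0 hc] := gdiff_top_lower.
apply: lt_le_trans (hc n ln).
by rewrite mulr_gt0 // powR_gt0 // natpos.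
Qed.

Lemma gdiff_gt0 i n : (i <= l)%N -> (l <= n)%N -> 0 < g i n.
Proof.
rewrite leq_eqVlt => /orP[/eqP -> /gdiff_top_gt0 //|il] ln.
have h : forall j, (j < l)%N -> 0 < g j l.
  elim=> [|j IH] jl.
    by rewrite /gdiff /= /gseq mulr_gt0 ?powR_gt0 ?ltr0n // ffact_gt0.
  by rewrite gdiffS (gdiff_small j (n := l.-1)) ?prednK // subr0 IH // ltnW.
exact: lt_le_trans (h i il) (gdiff_incr il ln).
Qed.

(** In Leibniz's rule the factor n^j will be compensated by the size n^(-j) of the j-th difference
    of the cut-off. Only the step that reaches order l needs the lower bound on g_l. *)
Lemma gdiff_ratio : exists2 C : R, 0 < C & forall j e n, (e + j <= l)%N ->
  (l <= n)%N -> g e n <= C * n%:R ^+ j * g (e + j) n.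
Proof.
have [C C0 hC] := gdiff_upper; have [c c0 hc] := gdiff_top_lower.
have s1 : exists2 D : R, 1 <= D & forall i n, (i < l)%N -> (l <= n)%N ->
    g i n <= D * n%:R * g i.+1 n.
  exists (Num.max 1 (C / c)); first by rewrite le_max lexx.
  move=> i n il ln; have n0 := natpos ln.
  have [li|li] := ltnP i.+1 l.
    apply: le_trans (gdiff_le_mul n li) _.
    rewrite -[X in X <= _]mul1r -mulrA ler_wpM2r ?le_max ?lexx //.
    by rewrite mulr_ge0 // gdiff_ge0.
  have e : i.+1 = l by lia.
  apply: le_trans (hC _ _ (ltnW il) ln) _.
  apply: le_trans (_ : C / c * n%:R * g i.+1 n <= _); last first.
    rewrite -!mulrA [X in X <= _]mulrA ler_wpM2r //.
      by rewrite mulr_ge0 // gdiff_ge0 // e.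
    by rewrite le_max lexx orbT.
  rewrite -!mulrA ler_pM2l // ler_pdivlMl //.
  have := hc n ln; rewrite e -(ler_pM2l n0); apply: le_trans.
  rewrite mulrCA powR_1D //.
  rewrite (_ : l%:R - i%:R - s = 1 - s) //.
  by rewrite -e -natr1; ring.
have [D D1 hD] := s1; have D0 : 0 < D by apply: lt_le_trans D1.
exists (D ^+ l); first by rewrite exprn_gt0.
move=> j e n ejl ln.
have h : g e n <= D ^+ j * n%:R ^+ j * g (e + j) n.
  elim: j ejl => [|j IH] ejl; first by rewrite addn0 !mul1r.
  have ejl' : (e + j < l)%N by rewrite -addnS.
  apply: le_trans (IH (ltnW ejl')) _.
  have -> : D ^+ j.+1 * n%:R ^+ j.+1 * g (e + j.+1) n =
    D ^+ j * n%:R ^+ j * (D * n%:R * g (e + j).+1 n).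
    by rewrite addnS !exprS; ring.
  by rewrite ler_wpM2l ?hD // mulr_ge0 // exprn_ge0 // ltW.
apply: le_trans h _; rewrite -!mulrA ler_wpM2r //.
  by rewrite mulr_ge0 ?exprn_ge0 ?gdiff_ge0.
by rewrite ler_weXn2l //; lia.
Qed.

End DifferenceBounds.

Lemma cmon_iter (R : realType) k j (f : nat -> R) n :
  (j <= k)%N -> cmon k f -> 0 <= iter j (@fdif R) f n.
Proof.
elim: j k f n => [|j IH] k f n jk hf; first exact: cmon_ge0 hf.
case: k jk hf => // k jk [_ h]; rewrite iterSr; exact: IH jk h.
Qed.

(** * Decay of the differences of h^(p-1) *)

Section WeightBounds.
Variables (R : realType) (l : nat) (p : R).
Hypotheses (p1 : 1 < p) (l0 : (0 < l)%N).
Local Notation s := (p^-1).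
Local Notation g := (gdiff l s).

Definition wdiff k : nat -> R :=
  iter k (@fdif R) (fun m => g l (l + m) `^ (p - 1)).

Hypothesis cmA : cmon l (wdiff 0).
Local Notation a := wdiff.

Lemma invp01 : 0 < s < 1.
Proof. by rewrite invr_gt0 invf_lt1 ?p1 ?andbT (lt_trans ltr01). Qed.

Lemma wdiffS k m : a k.+1 m = a k m - a k m.+1. Proof. by []. Qed.

Lemma wdiff_ge0 k m : (k <= l)%N -> 0 <= a k m.
Proof. by move=> kl; apply: cmon_iter kl cmA. Qed.

Lemma wdiff_decr k m : (k < l)%N -> a k m.+1 <= a k m.
Proof. by move=> kl; have := wdiff_ge0 m kl; rewrite wdiffS subr_ge0. Qed.

Lemma wdiff_le_mul k n t : (k.+1 < l)%N -> t.+1%:R * a k.+1 (n + t) <= a k n.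
Proof.
move=> kl; apply: le_trans (_ : a k n - a k (n + t).+1 <= _); last first.
  by rewrite gerBl wdiff_ge0 // ltnW // ltnW.
elim: t => [|t IH]; first by rewrite addn0 mul1r wdiffS.
have -> : a k n - a k (n + t.+1).+1 = (a k n - a k (n + t).+1) + a k.+1 (n +
    t.+1).
  by rewrite wdiffS addnS; ring.
rewrite -natr1 mulrDl mul1r lerD2r; apply: le_trans IH.
by rewrite ler_wpM2l // addnS wdiff_decr.
Qed.

(** h^(p-1) has order n^(-s(p-1)) = n^(-(1-s)). Each further difference gains 1/n: as a_(k+1)
    decreases, its value at m is at most its mean over m/2, ..., m, and those values add up to at
    most a_k(m/2). *)
Lemma wdiff_upper k : (k < l)%N -> exists2 C : R, 0 < C &
  forall m, a k m <= C * (l + m)%:R `^ (- (k%:R + 1 - s)).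
Proof.
have /andP[s0 s1] := invp01; have p0 : 0 < p by apply: lt_trans p1.
have pos m : 0 < (l + m)%:R :> R by rewrite ltr0n addn_gt0 l0.
elim: k => [|k IH] kl.
  have [C C0 hC] := gdiff_upper invp01 l0.
  exists (C `^ (p - 1)); first by rewrite powR_gt0.
  move=> m; have h := hC l (l + m)%N (leqnn _) (leq_addr _ _).
  rewrite /wdiff /= add0r.
  apply: le_trans (_ : (C * (l + m)%:R `^ (l%:R - l%:R - s)) `^ (p - 1) <= _).
    rewrite ge0_ler_powR ?nnegrE //; first by rewrite subr_ge0 ltW.
      exact: gdiff_ge0 (invp01) _ _ _ _.
    by rewrite mulr_ge0 ?powR_ge0 // ltW.
  rewrite powRM ?powR_ge0 ?(ltW C0) // -powRrM.
  rewrite (_ : (l%:R - l%:R - s) * (p - 1) = - (1 - s)) //.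
  by field; rewrite gt_eqF.
have [C C0 hC] := IH (ltnW kl).
set e := k%:R + 1 - s in hC.
have e0 : 0 <= e by rewrite /e; have : 0 <= k%:R :> R by []; lra.
exists (C * 2 `^ e * (2 * l%:R)); first by rewrite !mulr_gt0 ?powR_gt0 ?ltr0n.
move=> m; have h := wdiff_le_mul m./2 (m - m./2) kl.
have hm : (m./2 <= m)%N by have := odd_double_half m; rewrite -muln2; lia.
rewrite subnKC // in h.
set x : R := (l + m)%:R; have x0 : 0 < x := pos m.
have h1 : x <= 2 * l%:R * (m - m./2).+1%:R.
  rewrite /x -[2]/(2%:R) -!natrM ler_nat.
  have := odd_double_half m; rewrite -muln2; nia.
have h2 : (l + m./2)%:R `^ (- e) <= 2 `^ e * x `^ (- e).
  have y0 := pos m./2.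
  have xy : x <= 2 * (l + m./2)%:R.
    rewrite /x -[2]/(2%:R) -natrM ler_nat.
    have := odd_double_half m; rewrite -muln2; lia.
  rewrite !powRN -[X in X <= _]mul1r ler_pdivrMr ?powR_gt0 // mulrAC ler_pdivlMr
      ?powR_gt0 //.
  by rewrite mul1r -powRM ?(ltW y0) // ge0_ler_powR ?nnegrE ?mulr_ge0 // ltW.
have h3 := hC m./2.
rewrite -(ler_pM2l x0).
apply: le_trans (_ : 2 * l%:R * (m - m./2).+1%:R * a k.+1 m <= _).
  by rewrite ler_wpM2r // wdiff_ge0 // ltnW.
rewrite -mulrA; apply: le_trans (_ : 2 * l%:R * (C * (2 `^ e * x `^ (- e))) <=
    _).
  rewrite ler_pM2l ?mulr_gt0 ?ltr0n //; apply: le_trans h _; apply: le_trans h3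
      _.
  by rewrite ler_pM2l.
rewrite -[k.+1%:R]natr1.
have -> : x * (C * 2 `^ e * (2 * l%:R) * x `^ (- (k%:R + 1 + 1 - s))) =
  C * 2 `^ e * (2 * l%:R) * (x * x `^ (- (k%:R + 1 + 1 - s))) by ring.
rewrite powR_1D //.
have -> : 1 - (k%:R + 1 + 1 - s) = - e by rewrite /e; ring.
by rewrite le_eqVlt; apply/orP; left; apply/eqP; ring.
Qed.

(* The scale-invariant size of the weights: this is what makes the logarithmic
   cut-off work. *)
Lemma wdiff_gdiff : exists2 C : R, 0 < C & forall k m, (k < l)%N ->
  a k m * g (l - k) (l + m) <= C * (l + m)%:R^-1.
Proof.
have pos m : 0 < (l + m)%:R :> R by rewrite ltr0n addn_gt0 l0.
have p0 : 0 < p by apply: lt_trans p1.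
have [D D0 hD] := gdiff_upper invp01 l0.
suff : forall j, (j <= l)%N -> exists2 C : R, 0 < C & forall k m, (k < j)%N ->
    a k m * g (l - k) (l + m) <= C * (l + m)%:R^-1.
  by move=> /(_ l (leqnn l)).
elim=> [|j IH] jl; first by exists 1.
have [C C0 hC] := IH (ltnW jl); have [B B0 hB] := wdiff_upper jl.
exists (C + B * D); first by rewrite addr_gt0 // mulr_gt0.
have xi m : 0 <= (l + m)%:R^-1 :> R by rewrite invr_ge0.
move=> k m; rewrite ltnS leq_eqVlt => /orP[/eqP ->|/hC h]; last first.
  by apply: le_trans (h m) _; rewrite ler_wpM2r // lerDl ltW // mulr_gt0.
apply: le_trans (_ : B * D * (l + m)%:R^-1 <= _); last first.
  by rewrite ler_wpM2r // lerDr ltW.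
have h1 := hB m; have h2 := hD (l - j)%N (l + m)%N (leq_subr _ _) (leq_addr _
    _).
have g0 := gdiff_ge0 invp01 l0 (l + m) (leq_subr j l).
apply: le_trans (ler_pM (wdiff_ge0 _ (ltnW jl)) g0 h1 h2) _.
rewrite mulrACA powR_add // natrB; last exact: ltnW.
rewrite (_ : - (j%:R + 1 - s) + (l%:R - (l%:R - j%:R) - s) = - 1); last by ring.
by rewrite powR_inv1 // ltW.
Qed.

End WeightBounds.

(** * The Picone chain *)

Section Cmod.
Variable R : realType.
Implicit Types z w : R[i].

Lemma cmod_ge0 z : 0 <= cmod z.
Proof. by case: z => a b; rewrite /cmod /= sqrtr_ge0. Qed.

Lemma cmod0 : cmod (0 : R[i]) = 0.
Proof. exact: ComplexField.Normc.normc0. Qed.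

Lemma cmod_eq0 z : cmod z = 0 -> z = 0.
Proof. exact: ComplexField.Normc.eq0_normc. Qed.

Lemma cmodD z w : cmod (z + w) <= cmod z + cmod w.
Proof. exact: (@le_normcD R z w). Qed.

Lemma cmod_real (x : R) : cmod (x%:C)%C = `|x|.
Proof. by rewrite /cmod /= expr0n addr0 sqrtr_sqr. Qed.

End Cmod.

(** * Convexity of the p-th power *)

Section Convexity.
Variable R : realType.
Implicit Types (p x z : R).

Definition sgpow p x : R := Num.sg x * `|x| `^ p.

(** The derivative of |x|^p is [p * sgpow (p - 1) x]. The bound is Young's inequality for |x|^(p-1)
    |z| with exponents p/(p-1) and p. *)
Lemma powR_tangent p x z : 1 < p ->
  `|x| `^ p + p * sgpow (p - 1) x * (z - x) <= `|z| `^ p.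
Proof.
move=> p1; have p0 : 0 < p by apply: lt_trans p1.
have q0 : 0 < p - 1 by rewrite subr_gt0.
have xx : sgpow (p - 1) x * x = `|x| `^ p.
  by rewrite /sgpow mulrAC -normrEsg mulr_powRB1.
have yg : `|x| `^ (p - 1) * `|z| <= `|x| `^ p * (1 - p^-1) + `|z| `^ p / p.
  have := @conjugate_powR R (`|x| `^ (p - 1)) `|z| (p / (p - 1)) p.
  rewrite powR_ge0 normr_ge0 divr_gt0 // => /(_ isT isT isT p0).
  have -> : (p / (p - 1))^-1 + p^-1 = 1 by field; rewrite !gt_eqF.
  move=> /(_ erefl); rewrite -powRrM.
  have -> : (p - 1) * (p / (p - 1)) = p by field; rewrite gt_eqF.
  have -> : (p / (p - 1))^-1 = 1 - p^-1 by field; rewrite !gt_eqF.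
  by [].
have zz : sgpow (p - 1) x * z <= `|x| `^ (p - 1) * `|z|.
  apply: le_trans (ler_norm _) _; rewrite normrM ler_wpM2r //.
  rewrite /sgpow normrM normr_sg ger0_norm ?powR_ge0 //.
  by case: (x != 0); rewrite ?mul1r ?mul0r ?powR_ge0.
have h : p * (sgpow (p - 1) x * z) <= p * (`|x| `^ p * (1 - p^-1) + `|z| `^ p /
    p).
  by rewrite ler_pM2l //; apply: le_trans yg.
have e : p * (`|x| `^ p * (1 - p^-1) + `|z| `^ p / p) =
    p * `|x| `^ p - `|x| `^ p + `|z| `^ p by field; rewrite gt_eqF.
rewrite e in h.
have -> : p * sgpow (p - 1) x * (z - x) =
  p * (sgpow (p - 1) x * z) - p * (sgpow (p - 1) x * x) by ring.
by rewrite xx; lra.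
Qed.

(* Subadditivity of the perspective of [x |-> x^p]: the discrete Picone
   inequality. *)
Lemma perspective_subadd p (al be x y z : R) : 1 < p -> 0 < al -> 0 < be ->
  0 <= x -> 0 <= y -> 0 <= z -> z <= x + y ->
  z `^ p / (al + be) `^ (p - 1) <=
  x `^ p / al `^ (p - 1) + y `^ p / be `^ (p - 1).
Proof.
move=> p1 a0 b0 x0 y0 z0 zxy; have p0 : 0 < p by apply: lt_trans p1.
have persp c w : 0 < c -> 0 <= w -> w `^ p / c `^ (p - 1) = c * (w / c) `^ p.
  move=> c0 w0; rewrite powRM ?invr_ge0 ?(ltW c0) //.
  rewrite -[c^-1]powR_inv1 ?(ltW c0) // -powRrM mulN1r.
  rewrite -[(c `^ (p - 1))^-1]powRN opprB mulrCA powR_1D //.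
have ab : 0 < al + be by rewrite addr_gt0.
rewrite !persp //; set t := z / (al + be).
have t0 : 0 <= t by rewrite divr_ge0 // ltW.
have X0 : 0 <= x / al by rewrite divr_ge0 // ltW.
have Y0 : 0 <= y / be by rewrite divr_ge0 // ltW.
have h1 := powR_tangent t (x / al) p1; have h2 := powR_tangent t (y / be) p1.
rewrite !ger0_norm // in h1 h2.
set f := p * sgpow (p - 1) t in h1 h2.
have f0 : 0 <= f.
  by rewrite /f /sgpow mulr_ge0 ?mulr_ge0 ?powR_ge0 ?sgr_ge0 // ltW.
have e : al * (x / al - t) + be * (y / be - t) = x + y - z.
  by rewrite /t; field; rewrite !gt_eqF.
have h3 := ler_wpM2l (ltW a0) h1; have h4 := ler_wpM2l (ltW b0) h2.
have h5 : 0 <= f * (al * (x / al - t) + be * (y / be - t)).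
  by rewrite e mulr_ge0 // subr_ge0.
nra.
Qed.

End Convexity.

(** * Picone steps and summation by parts *)

Section Chain.
Variables (R : realType) (l : nat) (p : R).
Hypotheses (p1 : 1 < p) (l0 : (0 < l)%N).
Local Notation s := (p^-1).
Local Notation g := (gdiff l s).
Local Notation a := (wdiff l p).
Hypothesis cmA : cmon l (a 0).
Implicit Type u : nat -> R[i].

Definition ratio u i n : R := cmod (iter i (@bdif _) u n) `^ p / g i n `^ (p -
    1).

(** What a single Picone step loses at n. The losses are kept, since the later arguments need their
    exact sum. *)
Definition picone u i n : R :=
  ratio u i.+1 n + ratio u i n.-1 - ratio u i n.

Definition vanish_below u := forall n, (n < l)%N -> u n = 0.

Let p0 : 0 < p. Proof. exact: lt_trans p1. Qed.

Lemma ratio_eq0 u i n : iter i (@bdif _) u n = 0 -> ratio u i n = 0.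
Proof. by move=> e; rewrite /ratio e cmod0 powR0 ?mul0r // gt_eqF. Qed.

Lemma ratio_small u i n : vanish_below u -> (n < l)%N -> ratio u i n = 0.
Proof. by move=> ul nl; apply/ratio_eq0/(iter_bdif0 i ul nl). Qed.

Lemma ratio_ge0 u i n : 0 <= ratio u i n.
Proof. by rewrite divr_ge0 ?powR_ge0. Qed.

(** Since [g i] vanishes at l - 1, the perspective inequality does not apply at l; u vanishes there
    too, and the step is an equality. *)
Lemma picone_at_l u i : vanish_below u -> picone u i l = 0.
Proof.
move=> ul; have pl : (l.-1 < l)%N by rewrite prednK.
rewrite /picone (ratio_small _ ul pl) addr0 /ratio /= /bdif.
by rewrite (iter_bdif0 i ul pl) subr0 (gdiff_small _ _ pl) subr0 subrr.
Qed.

Lemma picone_ge0 u i n : vanish_below u -> (i < l)%N -> (l <= n)%N ->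
  0 <= picone u i n.
Proof.
move=> ul il; rewrite leq_eqVlt => /orP[/eqP <-|ln]; first by rewrite
    picone_at_l.
have s01 := invp01 p1.
have ln1 : (l <= n.-1)%N by lia.
rewrite /picone subr_ge0 /ratio.
have -> : g i n = g i.+1 n + g i n.-1 by rewrite gdiffS; ring.
apply: perspective_subadd => //.
- by rewrite gdiff_gt0 // ltnW.
- by rewrite gdiff_gt0 // ltnW.
- exact: cmod_ge0.
- exact: cmod_ge0.
- exact: cmod_ge0.
have -> : iter i (@bdif _) u n = iter i.+1 (@bdif _) u n + iter i (@bdif _) u
    n.-1.
  by rewrite /= /bdif subrK.
exact: cmodD.
Qed.

Lemma sum_by_parts (c B : nat -> R) M : B l.-1 = 0 ->
  \sum_(m < M) c m * (B (l + m)%N - B (l + m).-1) =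
  \sum_(m < M) fdif c m * B (l + m)%N + c M * B (l + M).-1.
Proof.
move=> B0; elim: M => [|M IH]; first by rewrite !big_ord0 addn0 B0 mulr0 addr0.
by rewrite !big_ord_recr /= IH /fdif addnS /=; ring.
Qed.

(** Interpolates between the energy at k = 0, where the denominator cancels [a 0], and the weighted
    norm at k = l, where it is g^(p-1). *)
Definition level u k M : R :=
  \sum_(m < M) a k m * ratio u (l - k) (l + m).

Lemma level_step u k M T : vanish_below u -> (forall n, (T <= n)%N -> u n = 0) ->
  (T < M)%N -> (k < l)%N ->
  level u k M = level u k.+1 M + \sum_(m < M) a k m * picone u (l - k.+1) (l +
      m).
Proof.
move=> ul uT TM kl; set i := (l - k.+1)%N.
have e : (l - k = i.+1)%N by rewrite /i; lia.
have pl : (l.-1 < l)%N by rewrite prednK.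
have h := @sum_by_parts (a k) (ratio u i) M (ratio_small _ ul pl).
(* The boundary term vanishes: [T < M] and i < l put the index (l + M) - 1 beyond the support of the
   i-th difference. *)
rewrite (@ratio_eq0 u i (l + M).-1) ?mulr0 ?addr0 in h; last first.
  by apply: (iter_bdif_large (T := T)) => //; rewrite /i; lia.
rewrite /level -h -big_split /= e; apply: eq_bigr => m _.
by rewrite /picone; ring.
Qed.

Lemma level_chain u M T : vanish_below u -> (forall n, (T <= n)%N -> u n = 0) ->
  (T < M)%N -> level u 0 M = level u l M +
    \sum_(k < l) \sum_(m < M) a k m * picone u (l - k.+1) (l + m).
Proof.
move=> ul uT TM.
suff h : forall j, (j <= l)%N -> level u 0 M = level u j M +
    \sum_(k < j) \sum_(m < M) a k m * picone u (l - k.+1) (l + m) by exact: h.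
elim=> [|j IH] jl; first by rewrite big_ord0 addr0.
rewrite big_ord_recr /= IH; last exact: ltnW.
by rewrite (level_step ul uT TM jl); ring.
Qed.

Lemma level0E u M :
  level u 0 M = \sum_(m < M) cmod (iter l (@bdif _) u (l + m)%N) `^ p.
Proof.
apply: eq_bigr => m _; rewrite /ratio subn0 /wdiff /= mulrC divfK //.
rewrite gt_eqF // powR_gt0 // gdiff_top_gt0 ?leq_addr //; exact: invp01.
Qed.

Definition weight n : R := a l (n - l) / g 0 n `^ (p - 1).

Lemma levellE u M :
  level u l M = \sum_(m < M) weight (l + m) * cmod (u (l + m)%N) `^ p.
Proof.
apply: eq_bigr => m _; rewrite /ratio subnn /weight addKn /=.
by rewrite -mulrA [_^-1 * _]mulrC.
Qed.


Lemma weight_ge0 n : 0 <= weight n.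
Proof. by rewrite divr_ge0 ?powR_ge0 // wdiff_ge0. Qed.

Lemma weight_ineq u M T : vanish_below u -> (forall n, (T <= n)%N -> u n = 0) ->
  (T < M)%N -> level u l M <= level u 0 M.
Proof.
move=> ul uT TM; rewrite (level_chain ul uT TM) lerDl.
apply: sumr_ge0 => k _; apply: sumr_ge0 => m _; apply: mulr_ge0.
  by rewrite wdiff_ge0 // ltnW.
by apply: picone_ge0 => //; [have := ltn_ord k; lia|rewrite leq_addr].
Qed.

(* At the first index after the support of the (l-1)-st difference the Picone
   term is a sum of two positive quantities. *)
Lemma weight_strict u M T : vanish_below u -> (forall n, (T <= n)%N -> u n = 0) ->
  (T < M)%N -> level u l M = level u 0 M -> forall n, u n = 0.
Proof.
move=> ul uT TM e.
have s01 := invp01 p1.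
have pos (k : 'I_l) : 0 <= \sum_(m < M) a k m * picone u (l - k.+1) (l + m).
  apply: sumr_ge0 => m _; apply: mulr_ge0; first by rewrite wdiff_ge0 // ltnW.
  by apply: picone_ge0 => //; [have := ltn_ord k; lia|rewrite leq_addr].
have z : \sum_(m < M) a 0 m * picone u (l - 1) (l + m) = 0.
  move: e; rewrite (level_chain ul uT TM) => /eqP.
  rewrite -subr_eq0 opprD addrA subrr add0r oppr_eq0 psumr_eq0 //.
  by move=> /allP/(_ (Ordinal l0)); rewrite mem_index_enum => /(_ isT)/eqP.
have pz m : (m < M)%N -> picone u (l - 1) (l + m) = 0.
  move=> mM; move: z => /eqP; rewrite psumr_eq0; last first.
    move=> i _; apply: mulr_ge0; first exact: wdiff_ge0.
    by apply: picone_ge0 => //; [lia|rewrite leq_addr].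
  move=> /allP/(_ (Ordinal mM)); rewrite mem_index_enum => /(_ isT).
  rewrite mulf_eq0 => /orP[|/eqP //]; rewrite gt_eqF //=.
  by rewrite /wdiff /= powR_gt0 // gdiff_top_gt0 ?leq_addr.
pose v := iter (l - 1) (@bdif _) u.
have vl n : (n < l)%N -> v n = 0 by apply: iter_bdif0.
have vz n : v n = 0.
  have [nl|] := ltnP n l; first exact: vl.
  have [k hk] : exists k, (T + l <= n + k)%N by exists (T + l)%N; lia.
  elim: k n hk => [|k IH] n hk ln.
    by apply: (iter_bdif_large (T := T)) => //; lia.
  have vn1 : v n.+1 = 0 by apply: IH; lia.
  have [Mn|nM] := leqP M (n.+1 - l).
    by apply: (iter_bdif_large (T := T)) => //; lia.
  have := pz _ nM; rewrite subnKC; last exact: leqW.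
  rewrite /picone (ratio_eq0 vn1) subr0 => /eqP.
  rewrite paddr_eq0 ?ratio_ge0 // => /andP[_].
  rewrite /ratio mulf_eq0 invr_eq0 !powR_eq0.
  have -> : (g (l - 1) n == 0) = false by rewrite gt_eqF // gdiff_gt0 //; lia.
  by rewrite orbF => /andP[/eqP/cmod_eq0].
(* The differences are undone one by one: a sequence that vanishes below l and has zero difference
   is zero. *)
have uz j : (j <= l - 1)%N -> forall n, iter (l - 1 - j) (@bdif _) u n = 0.
  elim: j => [|j IH] jl n; first by rewrite subn0; apply: vz.
  elim: n => [|n IHn]; first by rewrite (iter_bdif0 _ ul).
  have := IH (ltnW jl) n.+1.
  have -> : (l - 1 - j = (l - 1 - j.+1).+1)%N by lia.
  by rewrite /= {1}/bdif /= IHn subr0.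
by move=> n; have := uz _ (leqnn _) n; rewrite subnn.
Qed.

End Chain.

(** * Logarithmic cut-offs *)

Section Modulus.
Variable R : realType.
Implicit Types (p x y : R).

(** For c <= 1 subadditivity gives e = c; for c > 1 the tangent line gives a Lipschitz bound on
    [0, B]. With c = p - 1 the exponent e becomes the gain L^(-e) of the cut-off. *)
Lemma powR_modulus (c B : R) : 0 < c -> exists C e : R, [/\ 0 < C, 0 < e &
  forall x y, 0 <= y -> y <= x -> x <= B -> x `^ c - y `^ c <= C * (x - y) `^
      e].
Proof.
move=> c0; have [c1|c1] := leP c 1.
  exists 1, c; split=> // x y y0 yx _; rewrite mul1r lerBlDl.
  have [x0|x0] := leP x 0.
    have xe : x = 0 by apply/eqP; rewrite eq_le x0 (le_trans y0).
    have ye : y = 0 by apply/eqP; rewrite eq_le y0 -xe yx.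
    by rewrite xe ye powR0 ?gt_eqF // add0r powR_ge0.
  have h t : 0 <= t -> t <= x -> x `^ c * (t / x) <= t `^ c.
    move=> t0 tx; have [->|tn0] := eqVneq t 0.
      by rewrite mul0r mulr0 powR_ge0.
    have tp : 0 < t by rewrite lt_neqAle eq_sym tn0.
    rewrite -{2}[t](divfK (x := x)) ?gt_eqF // [_ / x * x]mulrC.
    rewrite powRM ?(ltW x0) ?divr_ge0 ?(ltW x0) // ler_wpM2l ?powR_ge0 //.
    by apply: ger1_powR => //; rewrite divr_gt0 //= ler_pdivrMr // mul1r.
  have h1 := h y y0 yx; have h2 : x `^ c * ((x - y) / x) <= (x - y) `^ c.
    by apply: h; rewrite ?subr_ge0 // gerBl.
  apply: le_trans (lerD h1 h2); rewrite -mulrDr -mulrDl addrC subrK divff ?mulr1 //.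
  by rewrite gt_eqF.
exists (c * (1 + Num.max B 0 `^ (c - 1))), 1; split=> //.
  by rewrite mulr_gt0 // ltr_wpDr ?powR_ge0.
move=> x y y0 yx xB; have x0 := le_trans y0 yx.
have := powR_tangent x y c1; rewrite !ger0_norm // => h.
rewrite powRr1 ?subr_ge0 //.
have h1 : sgpow (c - 1) x <= 1 + Num.max B 0 `^ (c - 1).
  rewrite /sgpow ger0_norm //; apply: le_trans (_ : x `^ (c - 1) <= _).
    rewrite -[leRHS]mul1r ler_wpM2r ?powR_ge0 //.
    by case: sgrP => // _; rewrite lerN10.
  apply: le_trans (_ : Num.max B 0 `^ (c - 1) <= _); last by rewrite lerDr.
  by rewrite ge0_ler_powR ?nnegrE ?subr_ge0 ?(ltW c1) // le_max ?xB ?lexx ?orbT.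
have h2 : c * sgpow (c - 1) x * (x - y) <= c * (1 + Num.max B 0 `^ (c - 1)) * (x
    - y).
  by rewrite ler_wpM2r ?subr_ge0 // ler_pM2l.
move: h; rewrite -[y - x]opprB mulrN; lra.
Qed.

Lemma sgpow_ge0 (c x : R) : 0 <= x -> 0 < c -> sgpow c x = x `^ c.
Proof.
rewrite le_eqVlt => /orP[/eqP <-|x0] c0.
  by rewrite /sgpow sgr0 mul0r powR0 // gt_eqF.
by rewrite /sgpow gtr0_sg // mul1r gtr0_norm.
Qed.

Lemma sgpowN (c x : R) : sgpow c (- x) = - sgpow c x.
Proof. by rewrite /sgpow sgrN normrN mulNr. Qed.

Lemma sgpow_modulus (c B : R) : 0 < c -> exists C e : R, [/\ 0 < C, 0 < e &
  forall x y, `|x| <= B -> `|y| <= B ->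
    `|sgpow c x - sgpow c y| <= C * `|x - y| `^ e].
Proof.
move=> c0; have [C [e [C0 e0 hC]]] := powR_modulus B c0.
exists (C * 2), e; split; rewrite ?mulr_gt0 //.
have W (a b : R) : a <= C * b -> 0 <= b -> a <= C * 2 * b by nra.
have pos x y : 0 <= y -> y <= x -> x <= B ->
    `|sgpow c x - sgpow c y| <= C * 2 * `|x - y| `^ e.
  move=> y0 yx xB; have x0 := le_trans y0 yx; rewrite !sgpow_ge0 //.
  have h : y `^ c <= x `^ c by rewrite ge0_ler_powR ?nnegrE // ltW.
  rewrite !ger0_norm ?subr_ge0 //; apply: W (powR_ge0 _ _); exact: hC.
have opp x y : 0 <= x -> x <= B -> 0 <= y -> y <= B ->
    `|sgpow c x - sgpow c (- y)| <= C * 2 * `|x - - y| `^ e.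
  move=> x0 xB y0 yB; rewrite sgpowN !opprK !sgpow_ge0 //.
  rewrite !ger0_norm ?addr_ge0 ?powR_ge0 //.
  have h t : 0 <= t -> t <= B -> t <= x + y -> t `^ c <= C * (x + y) `^ e.
    move=> t0 tB txy; have := hC t 0 (lexx _) t0 tB.
    rewrite powR0 ?gt_eqF // !subr0 => h; apply: le_trans h _.
    rewrite ler_pM2l // ge0_ler_powR ?nnegrE ?addr_ge0 //; exact: ltW.
  have h1 : x `^ c <= C * (x + y) `^ e by apply: h; rewrite ?lerDl.
  have h2 : y `^ c <= C * (x + y) `^ e by apply: h; rewrite ?lerDr.
  lra.
move=> x y hx hy.
have [x0|x0] := leP 0 x; have [y0|y0] := leP 0 y.
- rewrite !ger0_norm // in hx hy; have [xy|xy] := leP x y.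
    by rewrite distrC [`|x - y|]distrC; apply: pos.
  by apply: pos => //; apply: ltW.
- rewrite ger0_norm // in hx; rewrite ltr0_norm // in hy.
  by rewrite -[y]opprK; apply: opp => //; rewrite oppr_ge0 ltW.
- rewrite ltr0_norm // in hx; rewrite ger0_norm // in hy.
  rewrite distrC [`|x - y|]distrC -[x]opprK; apply: opp => //.
  by rewrite oppr_ge0 ltW.
rewrite !ltr0_norm // in hx hy.
have -> : `|x - y| = `|- x - - y| by rewrite -opprD normrN.
have -> : `|sgpow c x - sgpow c y| = `|sgpow c (- x) - sgpow c (- y)|.
  by rewrite !sgpowN -opprD normrN.
have x1 : 0 <= - x by rewrite oppr_ge0 ltW.
have y1 : 0 <= - y by rewrite oppr_ge0 ltW.
have [xy|xy] := leP (- x) (- y).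
  by rewrite distrC [`|- x - _|]distrC; apply: pos.
by apply: pos => //; apply: ltW.
Qed.

(** Tangents at the two end points bound the Jensen gap by p al be/(al + be) times (f(x) - f(y))(x -
    y), f being [sgpow (p - 1)], and al be/(al + be) <= al. In the application al is [g i.+1 n],
    exactly the factor that [wdiff_gdiff] absorbs. *)
Lemma convexity_gap p (al be x y : R) : 1 < p -> 0 < al -> 0 < be ->
  al * `|x| `^ p + be * `|y| `^ p -
    (al + be) * `|(al * x + be * y) / (al + be)| `^ p <=
  p * al * (`|sgpow (p - 1) x - sgpow (p - 1) y| * `|x - y|).
Proof.
move=> p1 a0 b0; set z := _ / _; have ab : 0 < al + be by rewrite addr_gt0.
have p0 : 0 < p by apply: lt_trans p1.
have h1 := powR_tangent x z p1; have h2 := powR_tangent y z p1.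
set f := sgpow (p - 1) x in h1 *; set h := sgpow (p - 1) y in h2 *.
have h3 := ler_wpM2l (ltW a0) h1; have h4 := ler_wpM2l (ltW b0) h2.
have zx : al * (z - x) = - (al * be / (al + be) * (x - y)).
  by rewrite /z; field; rewrite gt_eqF.
have zy : be * (z - y) = al * be / (al + be) * (x - y).
  by rewrite /z; field; rewrite gt_eqF.
set q := al * be / (al + be) in zx zy.
have q0 : 0 <= q by rewrite divr_ge0 ?mulr_ge0 ?(ltW a0) ?(ltW b0) ?(ltW ab).
have qa : q <= al.
  by rewrite /q -mulrA ler_piMr ?(ltW a0) // ler_pdivrMr // mul1r lerDr ltW.
apply: le_trans (_ : p * q * ((f - h) * (x - y)) <= _).
  have e1 : al * (p * f * (z - x)) = p * f * (al * (z - x)) by ring.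
  have e2 : be * (p * h * (z - y)) = p * h * (be * (z - y)) by ring.
  rewrite mulrDr e1 zx in h3; rewrite mulrDr e2 zy in h4.
  have -> : p * q * ((f - h) * (x - y)) =
    - (p * f * - (q * (x - y))) - p * h * (q * (x - y)) by ring.
  lra.
apply: le_trans (_ : p * q * (`|f - h| * `|x - y|) <= _).
  apply: ler_wpM2l; first by rewrite mulr_ge0 // ltW.
  by rewrite -normrM ler_norm.
by rewrite ler_wpM2r ?mulr_ge0 // ler_pM2l.
Qed.

End Modulus.

(** * The cut-off and its differences *)

Section CutOff.
Variables (R : realType) (l : nat).

(** The falling-factorial form of (1 - n/M)^(l+1), cut off at n = M by truncated subtraction. Its
    differences are again falling factorials, and order l + 1 leaves at least one factor after l
    differences, so that they still vanish for n >= M. *)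
Definition cut (M n : nat) : R := ((M - n) ^_ l.+1)%:R / M%:R ^+ l.+1.

(* A discrete logarithmic cut-off: an average of cut-offs at dyadic scales, so
   that the j-th difference at n has size n^(-j) / L. *)
Definition eta (L n : nat) : R := L.+1%:R^-1 * \sum_(i < L.+1) cut (2 ^ i) n.

(** The hypothesis [1 < t] guards against truncation: for t = 1 and n > M the left side is 0 and the
    right side is -1. *)
Lemma ffact_diff (t M n : nat) : (1 < t)%N -> (0 < n)%N ->
  ((M - n) ^_ t)%:R - ((M - n.-1) ^_ t)%:R =
  - (t%:R * ((M - n) ^_ t.-1)%:R) :> R.
Proof.
case: t => [//|[//|t]] _; case: n => // n _ /=.
have [nM|Mn] := ltnP n M; last first.
  have -> : (M - n.+1 = 0)%N by lia.
  have -> : (M - n = 0)%N by lia.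
  by rewrite !ffact0n mulr0 subrr oppr0.
have -> : (M - n = (M - n.+1).+1)%N by lia.
set k := (M - n.+1)%N.
rewrite ffactSS ffactnSr -!natrM -[LHS]opprB; congr (- _).
have [tk|kt] := leqP t.+1 k; last first.
  by rewrite ffact_small // !(mul0n, muln0) subrr.
rewrite -natrB; last first.
  by rewrite mulnC leq_mul2r leq_subLR; apply/orP; right; lia.
by congr _%:R; rewrite -[(k ^_ t.+1 * _)%N]mulnC -mulnBl; congr (_ * _)%N; lia.
Qed.

Lemma iter_bdif_cut M j n : (j <= l)%N -> (j <= n)%N ->
  iter j (@bdif R) (cut M) n = (-1) ^+ j * (l.+1 ^_ j)%:R *
    ((M - n) ^_ (l.+1 - j))%:R / M%:R ^+ l.+1.
Proof.
elim: j n => [|j IH] n jl jn; first by rewrite /= expr0 ffactn0 subn0 !mul1r.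
rewrite iterS {1}/bdif !IH ?(ltnW jl) //; [|lia|lia].
rewrite -mulrBl -mulrBr ffact_diff; [|lia|lia].
by rewrite subnS [(-1) ^+ j.+1]exprS ffactnSr natrM; ring.
Qed.

Lemma cut_ge0 M n : 0 <= cut M n.
Proof. by rewrite divr_ge0 // exprn_ge0. Qed.

Lemma cut_le1 M n : (0 < M)%N -> cut M n <= 1.
Proof.
move=> M0; rewrite ler_pdivrMr ?exprn_gt0 ?ltr0n // mul1r -natrX ler_nat.
by apply: leq_trans (ffact_le_exp _ _) _; rewrite leq_exp2r // leq_subr.
Qed.

Lemma cut_large M n : (M <= n)%N -> cut M n = 0.
Proof. by move=> Mn; rewrite /cut (eqP Mn) ffact0n mul0r. Qed.

Lemma eta_ge0 L n : 0 <= eta L n.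
Proof. by rewrite mulr_ge0 ?invr_ge0 // sumr_ge0 // => i _; apply: cut_ge0. Qed.

Lemma eta_le1 L n : eta L n <= 1.
Proof.
rewrite ler_pdivrMl // mulr1.
apply: le_trans (_ : \sum_(i < L.+1) 1 <= _).
  by apply: ler_sum => i _; rewrite cut_le1 // expn_gt0.
by rewrite sumr_const card_ord.
Qed.

Lemma eta_large L n : (2 ^ L <= n)%N -> eta L n = 0.
Proof.
move=> Ln; rewrite /eta big1 ?mulr0 // => i _; apply: cut_large.
by apply: leq_trans Ln; rewrite leq_exp2l // -ltnS.
Qed.

(** An invariant for the induction: the geometric sum starts with a term at most 1. The alternative
    T = 0 is for the K at which no power of 2 has passed n yet, where the other bound may be
    negative. *)
Lemma dyadic_sum (n : nat) K :
  let T := \sum_(i < K | (n < 2 ^ i)%N) n%:R / 2 ^+ i : R in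
  T = 0 \/ T <= 2 - 2 * (n%:R / 2 ^+ K).
Proof.
elim: K => [|K IH] /=; first by left; rewrite big_ord0.
rewrite big_mkcond big_ord_recr /= -big_mkcond /=.
set T := \sum_(i < K | _) _ in IH *.
set q : R := n%:R / 2 ^+ K; have q0 : 0 <= q by rewrite divr_ge0 ?exprn_ge0.
have e : 2 * (n%:R / 2 ^+ K.+1) = q :> R.
  by rewrite /q exprS; field; rewrite expf_neq0.
rewrite e; case: ifP => nK.
  have q1 : q <= 1.
    by rewrite ler_pdivrMr ?exprn_gt0 // mul1r -natrX ler_nat ltnW.
  by right; case: IH => [->|]; rewrite /= -/q; lra.
have q1 : 1 <= q.
  by rewrite ler_pdivlMr ?exprn_gt0 // mul1r -natrX ler_nat leqNgt nK.
have T0 : 0 <= T by rewrite sumr_ge0 // => i _; rewrite divr_ge0 ?exprn_ge0.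
rewrite addr0; left; case: IH => // h.
by apply/eqP; rewrite eq_le T0 andbT; rewrite -/q in h; lra.
Qed.

Lemma dyadic_sum_le (n K : nat) :
  \sum_(i < K | (n < 2 ^ i)%N) n%:R / 2 ^+ i <= 2 :> R.
Proof.
have q0 : 0 <= n%:R / 2 ^+ K :> R by rewrite divr_ge0 ?exprn_ge0.
by case: (dyadic_sum n K) => /= [->|h] //; lra.
Qed.

Lemma iter_bdif_cut_le M j n : (0 < j)%N -> (j <= l)%N -> (j <= n)%N ->
  (0 < M)%N -> n%:R ^+ j * `|iter j (@bdif R) (cut M) n| <=
    if (n < M)%N then (l.+1)`!%:R * (n%:R / M%:R) else 0.
Proof.
move=> j0 jl jn M0; rewrite iter_bdif_cut //.
case: ltnP => nM; last first.
  rewrite (eqP nM) (_ : (l.+1 - j = (l - j).+1)%N); last by lia.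
  by rewrite ffact0n mulr0 mul0r normr0 mulr0.
have MR : 0 < M%:R :> R by rewrite ltr0n.
have nR : n%:R / M%:R <= 1 :> R by rewrite ler_pdivrMr // mul1r ler_nat ltnW.
have nR0 : 0 <= n%:R / M%:R :> R by rewrite divr_ge0.
rewrite normrM normrM normrM normrX normrN normr1 expr1n mul1r normfV.
rewrite !normr_nat ger0_norm ?exprn_ge0 //.
have e : M%:R ^+ l.+1 = M%:R ^+ j * M%:R ^+ (l.+1 - j) :> R.
  by rewrite -exprD; congr (_ ^+ _); lia.
have h1 : (l.+1 ^_ j)%:R <= (l.+1)`!%:R :> R.
  rewrite ler_nat -(@ffact_fact l.+1 j); last by lia.
  by rewrite leq_pmulr // fact_gt0.
have h2 : ((M - n) ^_ (l.+1 - j))%:R <= M%:R ^+ (l.+1 - j) :> R.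
  rewrite -natrX ler_nat; apply: leq_trans (ffact_le_exp _ _) _.
  by rewrite leq_exp2r ?leq_subr //; lia.
have -> : n%:R ^+ j * ((l.+1 ^_ j)%:R * ((M - n) ^_ (l.+1 - j))%:R / M%:R ^+
    l.+1) =
  (n%:R / M%:R) ^+ j * ((l.+1 ^_ j)%:R *
    (((M - n) ^_ (l.+1 - j))%:R / M%:R ^+ (l.+1 - j))) :> R.
  by rewrite e exprMn exprVn; field; rewrite !expf_neq0 // gt_eqF.
rewrite mulrC; apply: ler_pM.
- by rewrite mulr_ge0 // divr_ge0 // exprn_ge0.
- by rewrite exprn_ge0.
- rewrite -[leRHS]mulr1; apply: ler_pM => //; rewrite ?divr_ge0 ?exprn_ge0 //.
  by rewrite ler_pdivrMr ?exprn_gt0 // mul1r.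
by rewrite -{2}[n%:R / M%:R]expr1 ler_wiXn2l.
Qed.

Lemma iter_bdif_eta_le L j n : (0 < j)%N -> (j <= l)%N -> (j <= n)%N ->
  n%:R ^+ j * `|iter j (@bdif R) (eta L) n| <= 2 * (l.+1)`!%:R / L.+1%:R.
Proof.
move=> j0 jl jn.
have -> : iter j (@bdif R) (eta L) n =
    L.+1%:R^-1 * \sum_(i < L.+1) iter j (@bdif R) (cut (2 ^ i)) n.
  rewrite /eta iter_bdifZ; congr (_ * _).
  exact: (iter_bdif_sum _ (fun (i : 'I_L.+1) => cut (2 ^ i))).
rewrite normrM ger0_norm ?invr_ge0 // mulrCA [leRHS]mulrC.
rewrite ler_pM2l ?invr_gt0 //.
apply: le_trans (_ : \sum_(i < L.+1) (if (n < 2 ^ i)%N then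
    (l.+1)`!%:R * (n%:R / 2 ^+ i) else 0) <= _).
  rewrite -[leLHS]mulrC; apply: le_trans (ler_wpM2r _ (ler_norm_sum _ _ _)) _.
    by rewrite exprn_ge0.
  rewrite mulr_suml; apply: ler_sum => i _; rewrite mulrC.
  have := @iter_bdif_cut_le (2 ^ i) j n j0 jl jn; rewrite natrX; apply.
  by rewrite expn_gt0.
rewrite -big_mkcond -mulr_sumr mulrC ler_wpM2r //.
exact: dyadic_sum_le.
Qed.

Lemma cvg_cut n : cut (2 ^ i) n @[i --> \oo] --> (1 : R).
Proof.
set c := (n + l.+1)%N.
have half (i : nat) : (2 ^ i)%:R^-1 = 2^-1 ^+ i :> R by rewrite natrX exprVn.
have c0 : c%:R * 2^-1 ^+ i @[i --> \oo] --> (0 : R).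
  rewrite -(mulr0 c%:R); apply: cvgM; first exact: cvg_cst.
  by apply: cvg_expr; rewrite ger0_norm ?invr_ge0 // invf_lt1 // ltr1n.
have c1 : (2 ^ i - c)%:R * 2^-1 ^+ i @[i --> \oo] --> (1 : R).
  apply: (@squeeze_cvgr _ _ _ _ (fun i => 1 - c%:R * 2^-1 ^+ i) (fun=> 1)).
  - apply: nearW => i; rewrite -half.
    have p2 : 0 < (2 ^ i)%:R :> R by rewrite ltr0n expn_gt0.
    apply/andP; split; last by rewrite ler_pdivrMr // mul1r ler_nat leq_subr.
    rewrite ler_pdivlMr // mulrBl mul1r divfK ?gt_eqF // lerBlDr -natrD ler_nat.
    by lia.
  - rewrite -[X in _ --> X]subr0; apply: cvgB => //; exact: cvg_cst.
  - exact: cvg_cst.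
apply: (@squeeze_cvgr _ _ _ _ (fun i => ((2 ^ i - c)%:R * 2^-1 ^+ i) ^+ l.+1)
  (fun=> 1)).
- apply: nearW => i; rewrite cut_le1 ?expn_gt0 // andbT -half expr_div_n.
  rewrite ler_pM2r ?invr_gt0 ?exprn_gt0 ?ltr0n ?expn_gt0 // -natrX ler_nat.
  suff h : forall t, (t <= l.+1)%N -> ((2 ^ i - c) ^ t <= (2 ^ i - n) ^_ t)%N.
    exact: h.
  elim=> [|t IH] tl; first by rewrite ffactn0.
  by rewrite ffactnSr expnSr leq_mul ?IH ?(ltnW tl) // /c; lia.
- elim: l.+1 => [|t IH].
    rewrite (_ : (fun _ => _) = cst 1); first exact: cvg_cst.
    by apply/funext => i; rewrite expr0.
  rewrite (_ : (fun _ => _) = (fun i => (2 ^ i - c)%:R * 2^-1 ^+ i *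
      ((2 ^ i - c)%:R * 2^-1 ^+ i) ^+ t)).
    by rewrite -[X in _ --> X]mulr1; apply: cvgM.
  by apply/funext => i; rewrite exprS.
- exact: cvg_cst.
Qed.

Lemma cvg_eta n : eta L n @[L --> \oo] --> (1 : R).
Proof.
have e : arithmetic_mean (fun i => cut (2 ^ i) n) = eta ^~ n.
  by apply/funext => L; rewrite /arithmetic_mean /eta /series /= big_mkord.
by have := cesaro (cvg_cut n); rewrite e.
Qed.

Lemma harmonic_sum_le K : \sum_(m < 2 ^ K) m.+1%:R^-1 <= K.+1%:R :> R.
Proof.
elim: K => [|K IH]; first by rewrite big_ord1 invr1.
rewrite -(big_mkord xpredT (fun m => m.+1%:R^-1)) /=.
rewrite (big_cat_nat (n := (2 ^ K)%N)) //=; last by rewrite leq_exp2l.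
rewrite big_mkord -[K.+2%:R]natr1; apply: lerD => //.
apply: le_trans (_ : \sum_(2 ^ K <= m < 2 ^ K.+1) (2 ^ K)%:R^-1 <= _).
  rewrite big_nat [leRHS]big_nat; apply: ler_sum => m /andP[m1 m2].
  by rewrite lef_pV2 ?posrE ?ltr0n ?expn_gt0 // ler_nat ltnW // ltnS.
rewrite sumr_const_nat expnS mul2n -addnn addnK -[leLHS]mulr_natl divff //.
Qed.

End CutOff.

(** * The ground state with a cut-off *)

Section TestSequence.
Variables (R : realType) (l : nat) (p : R).
Hypotheses (p1 : 1 < p) (l0 : (0 < l)%N).
Local Notation s := (p^-1).
Local Notation g := (gdiff l s).
Local Notation a := (wdiff l p).
Hypothesis cmA : cmon l (a 0).
Local Notation bd i := (iter i (@bdif R)).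

Let s01 : 0 < s < 1 := invp01 p1.

(** The general term of Leibniz's rule for the product of [eta] and [g]; the shift n - j in the
    second factor makes the rule for one difference exact. *)
Definition etag L j e n : R := bd j (eta R l L) n * g e (n - j).

Definition trial L n : R := g 0 n * eta R l L n.

Lemma bdif_etag L j e n :
  bdif (etag L j e) n = etag L j e.+1 n + etag L j.+1 e n.
Proof.
have e1 : bd j.+1 (eta R l L) n = bd j (eta R l L) n - bd j (eta R l L) n.-1.
  by [].
rewrite {1}/bdif /etag gdiffS e1.
have -> : (n.-1 - j = (n - j).-1)%N by lia.
have -> : (n - j.+1 = (n - j).-1)%N by lia.
by ring.
Qed.

Lemma iter_bdif_etagS L j e i n : bd i.+1 (etag L j e) n =
  bd i (etag L j e.+1) n + bd i (etag L j.+1 e) n.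
Proof.
rewrite iterSr -iter_bdifD; apply: eq_iter_bdif => k; exact: bdif_etag.
Qed.

(** The j-th difference of the cut-off has size n^(-j)/L, and g_e exceeds g_(e+j) by a factor of at
    most C n^j. The shift to n - j only decreases g_e. *)
Lemma etag_le : exists2 C : R, 0 < C & forall L j e n, (0 < j)%N ->
  (e + j <= l)%N -> (l <= n)%N ->
  `|etag L j e n| <= C / L.+1%:R * g (e + j) n.
Proof.
have [C C0 hC] := gdiff_ratio s01 l0.
exists (2 * (l.+1)`!%:R * C); first by rewrite !mulr_gt0 ?ltr0n ?fact_gt0.
move=> L j e n j0 ejl ln.
have n0 : 0 < n%:R :> R by rewrite ltr0n; lia.
have h1 : n%:R ^+ j * `|bd j (eta R l L) n| <= 2 * (l.+1)`!%:R / L.+1%:R.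
  by apply: iter_bdif_eta_le => //; lia.
have h2 : g e (n - j) <= C * n%:R ^+ j * g (e + j) n.
  apply: le_trans (hC _ _ _ ejl ln).
  by apply: gdiff_incr => //; lia.
have g1 : 0 <= g e (n - j) by apply: gdiff_ge0 => //; lia.
have g2 : 0 <= g (e + j) n by apply: gdiff_ge0.
rewrite /etag normrM (ger0_norm g1).
apply: le_trans (ler_wpM2l (normr_ge0 _) h2) _.
have -> : `|bd j (eta R l L) n| * (C * n%:R ^+ j * g (e + j) n) =
  (n%:R ^+ j * `|bd j (eta R l L) n|) * (C * g (e + j) n) by ring.
have cg : 0 <= C * g (e + j) n by rewrite mulr_ge0 // ltW.
apply: le_trans (ler_wpM2r cg h1) _.
by rewrite le_eqVlt; apply/orP; left; apply/eqP; ring.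
Qed.

(** Each Leibniz term with j >= 1 is O(1/L) relative to g_i, and at most 2^i of them occur ([B]);
    the one term in which [eta] is not differenced remains ([D]). *)
Lemma trial_close : exists2 K : R, 0 < K & forall L i n, (i <= l)%N ->
  (l <= n)%N -> `|bd i (trial L) n - eta R l L n * g i n| <=
    K / L.+1%:R * g i n.
Proof.
have [C C0 hC] := etag_le.
have B L i : forall j e n, (0 < j)%N -> (e + j + i <= l)%N -> (l <= n)%N ->
    `|bd i (etag L j e) n| <= 2 ^+ i * (C / L.+1%:R) * g (e + j + i) n.
  elim: i => [|i IH] j e n j0 h ln.
    by rewrite mul1r !addn0 in h *; apply: hC.
  rewrite iter_bdif_etagS; apply: le_trans (ler_normD _ _) _.
  have h1 := IH j e.+1 n j0; have h2 := IH j.+1 e n isT.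
  have e1 : (e.+1 + j + i = e + j + i.+1)%N by lia.
  have e2 : (e + j.+1 + i = e + j + i.+1)%N by lia.
  rewrite e1 in h1; rewrite e2 in h2.
  have := lerD (h1 h ln) (h2 h ln); rewrite exprS; congr (_ <= _); ring.
have D L i : forall e n, (e + i <= l)%N -> (l <= n)%N ->
    `|bd i (etag L 0 e) n - eta R l L n * g (e + i) n| <=
    2 ^+ i * (C / L.+1%:R) * g (e + i) n.
  elim: i => [|i IH] e n h ln.
    rewrite addn0 in h *; rewrite /etag /= subn0 subrr normr0.
    by rewrite mul1r mulr_ge0 ?gdiff_ge0 // divr_ge0 // ltW.
  rewrite iter_bdif_etagS.
  have h1 := IH e.+1 n; have h2 := B L i 1 e n isT.
  have e1 : (e.+1 + i = e + i.+1)%N by lia.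
  have e2 : (e + 1 + i = e + i.+1)%N by lia.
  rewrite e1 in h1; rewrite e2 in h2.
  rewrite addrAC; apply: le_trans (ler_normD _ _) _.
  have := lerD (h1 h ln) (h2 h ln); rewrite exprS; congr (_ <= _); ring.
exists (2 ^+ l * C); first by rewrite mulr_gt0 ?exprn_gt0.
move=> L i n il ln.
have -> : bd i (trial L) n = bd i (etag L 0 0) n.
  by apply: eq_iter_bdif => k; rewrite /trial /etag /= subn0 mulrC.
apply: le_trans (D L i 0 n il ln) _.
rewrite ler_wpM2r ?gdiff_ge0 // mulrA ler_wpM2r ?invr_ge0 //.
by rewrite ler_wpM2r ?(ltW C0) // ler_weXn2l // ler1n.
Qed.

Lemma trial_small L n : (n < l)%N -> trial L n = 0.
Proof. by move=> nl; rewrite /trial gdiff_small // mul0r. Qed.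

Lemma trial_large L n : (2 ^ L <= n)%N -> trial L n = 0.
Proof. by move=> Ln; rewrite /trial eta_large // mulr0. Qed.

Lemma cvg_iter_trial i n : (bd i (trial L) n) @[L --> \oo] --> g i n.
Proof.
apply: (@cvg_iter_bdif R (fun L => trial L) (g 0)) => {}n.
rewrite -[X in _ --> X]mulr1; apply: cvgM; first exact: cvg_cst.
exact: cvg_eta.
Qed.

Definition ctrial L n : R[i] := ((trial L n)%:C)%C.

Lemma iter_bdif_complex (y : nat -> R) i n :
  iter i (@bdif R[i]) (fun k => ((y k)%:C)%C) n = ((bd i y n)%:C)%C.
Proof.
by elim: i n => [|i IH] n //=; rewrite /bdif !IH -rmorphB.
Qed.

Let zeta L i n := bd i (trial L) n / g i n.

Lemma ratio_ctrial L i n : (i <= l)%N -> (l <= n)%N ->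
  ratio l p (ctrial L) i n = g i n * `|zeta L i n| `^ p.
Proof.
move=> il ln; have g0 := gdiff_gt0 s01 l0 il ln.
rewrite /ratio /ctrial iter_bdif_complex cmod_real /zeta normrM normfV.
rewrite (ger0_norm (ltW g0)) powRM ?invr_ge0 ?(ltW g0) //.
rewrite -[(g i n)^-1]powR_inv1 ?(ltW g0) // -powRrM mulN1r.
rewrite -[(g i n `^ (p - 1))^-1]powRN mulrCA powR_1D //.
by congr (_ * _ `^ _); ring.
Qed.

(** zeta_i(n) is the mean of x = zeta_(i+1)(n) and y = zeta_i(n-1) with weights g_(i+1)(n) and
    g_i(n-1), so the Picone term is a Jensen gap of |.|^p. Both x and y are within O(1/L) of the
    cut-off, hence of each other, and the modulus of continuity supplies the extra L^(-e). *)
Lemma picone_ctrial_le : exists K e : R, [/\ 0 < K, 0 < e &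
  forall L i n, (i < l)%N -> (l <= n)%N ->
    picone l p (ctrial L) i n <= K * g i.+1 n * L.+1%:R `^ (- (1 + e))].
Proof.
have [K K0 hK] := trial_close.
have c0 : 0 < p - 1 by rewrite subr_gt0.
have p0 : 0 < p by apply: lt_trans p1.
have [C [e [C0 e0 hC]]] := sgpow_modulus (1 + K) c0.
pose K2 := 2 * (l.+1)`!%:R + 2 * K.
have K20 : 0 < K2 by rewrite addr_gt0 // mulr_gt0 // ltr0n fact_gt0.
exists (p * (C * K2 `^ e * K2)), e; split => //.
  by rewrite !mulr_gt0 // powR_gt0.
move=> L i n il ln; have L0 : 0 < L.+1%:R :> R by [].
have rhs0 : 0 <= p * (C * K2 `^ e * K2) * g i.+1 n * L.+1%:R `^ (- (1 + e)).
  by rewrite !mulr_ge0 ?powR_ge0 ?gdiff_ge0 // ltW.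
have vl : vanish_below l (ctrial L).
  by move=> k kl; rewrite /ctrial trial_small.
have [eln|nl] := eqVneq l n.
  by move: rhs0; rewrite -eln (picone_at_l p1 l0 _ vl).
have ln1 : (l <= n.-1)%N by lia.
have zb j k : (j <= l)%N -> (l <= k)%N -> `|zeta L j k - eta R l L k| <= K /
    L.+1%:R.
  move=> jl lk; have g0 := gdiff_gt0 s01 l0 jl lk.
  rewrite -(ler_pM2r g0) -{1}(ger0_norm (ltW g0)) -normrM mulrBl.
  by rewrite /zeta divfK ?gt_eqF //; apply: hK.
have KL : K / L.+1%:R <= K by rewrite ler_pdivrMr // ler_peMr ?(ltW K0) //
    ler1n.
have zB j k : (j <= l)%N -> (l <= k)%N -> `|zeta L j k| <= 1 + K.
  move=> jl lk; have h := zb j k jl lk.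
  rewrite -[zeta L j k](subrK (eta R l L k)) addrC.
  apply: le_trans (ler_normD _ _) _; apply: lerD; last exact: le_trans KL.
  by rewrite ger0_norm ?eta_ge0 // eta_le1.
rewrite /picone !ratio_ctrial //; [|exact: ltnW|exact: ltnW].
set x := zeta L i.+1 n; set y := zeta L i n.-1.
have ga := gdiff_gt0 s01 l0 il ln; have gb := gdiff_gt0 s01 l0 (ltnW il) ln1.
have gE : g i n = g i.+1 n + g i n.-1 by rewrite gdiffS; ring.
have zE : zeta L i n = (g i.+1 n * x + g i n.-1 * y) / (g i.+1 n + g i n.-1).
  rewrite -gE /x /y /zeta [g i.+1 n * _]mulrC divfK ?gt_eqF //.
  by rewrite [g i n.-1 * _]mulrC divfK ?gt_eqF // /= /bdif subrK.
rewrite zE gE; apply: le_trans (convexity_gap _ _ p1 ga gb) _.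
have xy : `|x - y| <= K2 / L.+1%:R.
  have h1 := zb i.+1 n il ln; have h2 := zb i n.-1 (ltnW il) ln1.
  have h3 : `|eta R l L n - eta R l L n.-1| <= 2 * (l.+1)`!%:R / L.+1%:R.
    have := @iter_bdif_eta_le R l L 1 n isT l0 (leq_trans l0 ln).
    rewrite expr1; apply: le_trans.
    by rewrite ler_peMl // ler1n (leq_trans l0).
  have -> : x - y = (x - eta R l L n) - (y - eta R l L n.-1) +
    (eta R l L n - eta R l L n.-1) by ring.
  apply: le_trans (ler_normD _ _) _.
  have -> : K2 / L.+1%:R = K / L.+1%:R + K / L.+1%:R + 2 * (l.+1)`!%:R /
      L.+1%:R.
    by rewrite /K2; ring.
  by apply: lerD => //; apply: le_trans (ler_normB _ _) _; apply: lerD.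
have hm : `|sgpow (p - 1) x - sgpow (p - 1) y| <= C * (K2 / L.+1%:R) `^ e.
  apply: le_trans (hC x y _ _) _; [exact: zB|by apply: zB; rewrite ?(ltnW il)|].
  rewrite ler_pM2l // ge0_ler_powR ?nnegrE ?(ltW e0) //.
  by rewrite divr_ge0 // ltW.
apply: le_trans (_ : p * g i.+1 n * (C * (K2 / L.+1%:R) `^ e * (K2 / L.+1%:R))
    <= _).
  rewrite ler_pM2l ?mulr_gt0 //; exact: ler_pM.
rewrite powRM ?invr_ge0 ?(ltW K20) //.
have LE : L.+1%:R `^ (- (1 + e)) = L.+1%:R^-1 `^ e * L.+1%:R^-1.
  rewrite -powR_inv1 ?(ltW L0) // -powRrM mulN1r powR_add //.
  by congr (_ `^ _); ring.
by rewrite LE le_eqVlt; apply/orP; left; apply/eqP; ring.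
Qed.

Lemma vanish_ctrial L : vanish_below l (ctrial L).
Proof. by move=> n nl; rewrite /ctrial trial_small. Qed.

Lemma ctrial_large L n : (2 ^ L <= n)%N -> ctrial L n = 0.
Proof. by move=> nl; rewrite /ctrial trial_large. Qed.

Lemma trial_defect :
  level l p (ctrial L) 0 (2 ^ L.+1) - level l p (ctrial L) l (2 ^ L.+1)
    @[L --> \oo] --> (0 : R).
Proof.
have [K [e [K0 e0 hK]]] := picone_ctrial_le.
have [C C0 hC] := wdiff_gdiff p1 l0 cmA.
pose B := l%:R * (K * C * 2) : R.
have L0 (L : nat) : 0 < L.+1%:R :> R by [].
have cB : B * L.+1%:R `^ (- e) @[L --> \oo] --> (0 : R).
  rewrite -[X in _ --> X](mulr0 B); apply: cvgM; first exact: cvg_cst.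
  rewrite (_ : (fun _ => _) = (fun L : nat => (L.+1%:R^-1 : R) `^ e)); last
      first.
    by apply/funext => L; rewrite -powR_inv1 // -powRrM mulN1r.
  apply/cvgrPdist_le => /= eps eps0.
  have d0 : 0 < eps `^ e^-1 by rewrite powR_gt0.
  have /cvgrPdist_le/(_ _ d0) := @cvg_harmonic R.
  apply: filterS => L /=; rewrite !sub0r !normrN => h.
  rewrite ger0_norm ?powR_ge0 //.
  rewrite ger0_norm ?invr_ge0 // /harmonic in h.
  apply: le_trans (ge0_ler_powR (ltW e0) _ _ h) _; rewrite ?nnegrE ?invr_ge0 //.
    exact: powR_ge0.
  by rewrite -powRrM mulVf ?gt_eqF // powRr1 // ltW.
apply: (squeeze_cvgr _ (cvg_cst 0) cB); apply: nearW => L.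
have TM : (2 ^ L < 2 ^ L.+1)%N by rewrite ltn_exp2l.
have vl := vanish_ctrial L; have vT := @ctrial_large L.
apply/andP; split; first by rewrite subr_ge0 (weight_ineq p1 l0 cmA vl vT TM).
rewrite (level_chain p1 l0 vl vT TM) addrAC subrr add0r.
apply: le_trans (_ : \sum_(k < l) K * C * 2 * L.+1%:R `^ (- e) <= _); last
    first.
  rewrite sumr_const card_ord -[leLHS]mulr_natl /B le_eqVlt.
  by apply/orP; left; apply/eqP; ring.
apply: ler_sum => k _.
apply: le_trans (_ : \sum_(m < 2 ^ L.+1) K * L.+1%:R `^ (- (1 + e)) *
    (C * m.+1%:R^-1) <= _).
  apply: ler_sum => m _.
  have kl : (l - k.+1 < l)%N by have := ltn_ord k; lia.
  have h1 := hK L _ (l + m)%N kl (leq_addr _ _).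
  have h2 := hC k m (ltn_ord k).
  have e1 : ((l - k.+1).+1 = l - k)%N by have := ltn_ord k; lia.
  rewrite e1 in h1.
  have a0 := wdiff_ge0 cmA m (ltnW (ltn_ord k)).
  apply: le_trans (ler_wpM2l a0 h1) _.
  have -> : a k m * (K * g (l - k) (l + m) * L.+1%:R `^ (- (1 + e))) =
    K * L.+1%:R `^ (- (1 + e)) * (a k m * g (l - k) (l + m)) by ring.
  rewrite ler_pM2l ?mulr_gt0 ?powR_gt0 //; apply: le_trans h2 _.
  rewrite ler_pM2l // lef_pV2 ?posrE ?ltr0n ?addn_gt0 ?l0 //.
  by rewrite ler_nat -add1n leq_add2r.
rewrite -mulr_sumr -mulr_sumr.
(* The sum of 1/n over 2^(L+1) indices is at most L + 2 <= 2 (L + 1), which reduces (L+1)^(-(1+e))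
   to (L+1)^(-e). *)
have h := harmonic_sum_le R L.+1.
have h2 : L.+2%:R <= 2 * L.+1%:R :> R.
  have : 1 <= L.+1%:R :> R by rewrite ler1n.
  by rewrite -[L.+2%:R]natr1; lra.
have KC : 0 < K * L.+1%:R `^ (- (1 + e)) * C by rewrite !mulr_gt0 ?powR_gt0.
rewrite mulrA; apply: le_trans (ler_wpM2l (ltW KC) (le_trans h h2)) _.
have -> : K * L.+1%:R `^ (- (1 + e)) * C * (2 * L.+1%:R) =
  K * C * 2 * (L.+1%:R * L.+1%:R `^ (- (1 + e))) by ring.
by rewrite powR_1D // (_ : 1 + - (1 + e) = - e) //; ring.
Qed.

End TestSequence.

(** * The weight *)

Section Bridge.
Variables (R : realType) (l : nat).

Lemma iter_nabla_neg (V : zmodType) (u : int -> V) i (n : int) :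
  (forall k : int, k < l%:Z -> u k = 0) -> n < l%:Z -> iter i (@nabla V) u n =
      0.
Proof.
move=> u0; elim: i n => [|i IH] n nl /=; first exact: u0.
by rewrite /nabla !IH ?subr0 //; lia.
Qed.

Lemma iter_nabla_nat (V : zmodType) (u : int -> V) i (n : nat) : (0 < l)%N ->
  (forall k : int, k < l%:Z -> u k = 0) ->
  iter i (@nabla V) u n%:Z = iter i (@bdif V) (fun k : nat => u k%:Z) n.
Proof.
move=> l0 u0; elim: i n => [|i IH] n //=.
rewrite /nabla /bdif -!IH; case: n => [|n] /=.
  by rewrite !(iter_nabla_neg i u0) //; lia.
by congr (_ - iter i (@nabla V) u _); lia.
Qed.

Lemma iter_div1_nat (F : int -> R[i]) (f : nat -> R) i m :
  (forall k : nat, F (l + k)%N%:Z = ((f k)%:C)%C) ->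
  iter i (@div1 _) F (l + m)%N%:Z = (((-1) ^+ i * iter i (@fdif R) f m)%:C)%C.
Proof.
move=> h; elim: i m => [|i IH] m /=; first by rewrite mul1r.
rewrite /div1 (_ : (l + m)%N%:Z + 1 = (l + m.+1)%N%:Z); last by lia.
rewrite !IH -rmorphB /fdif; congr (_%:C)%C.
by rewrite exprS; ring.
Qed.

Lemma eseries_fin (f : nat -> R) N : (l <= N)%N ->
  (forall n, (N <= n)%N -> f n = 0) ->
  (\sum_(l <= n <oo) (f n)%:E = (\sum_(m < N - l) f (l + m)%N)%:E)%E.
Proof.
move=> lN fN.
apply: (@lim_near_cst (\bar R)); first exact: ereal_hausdorff.
exists N => // n /= Nn.
rewrite (@big_cat_nat _ _ _ N) //=.
have -> : (\sum_(N <= i < n) (f i)%:E = 0)%E.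
  by rewrite big_nat big1 // => i /andP[Ni _]; rewrite fN.
rewrite adde0 sumEFin; congr _%:E.
rewrite -[in LHS](add0n l) big_addn big_mkord.
by apply: eq_bigr => i _; rewrite addnC.
Qed.

Lemma H0_bound (m : nat) (u : int -> R[i]) : H0 m u ->
  exists T : nat, forall n : nat, (T <= n)%N -> u n%:Z = 0.
Proof.
move=> [/finite_seqP[r rE] _]; exists (\sum_(i <- r) `|i|.+1)%N => n Tn.
apply/eqP/negPn/negP => un.
have : n%:Z \in r by have : [set n | u n != 0] n%:Z by []; rewrite rE.
move=> nr; move: Tn; rewrite (big_rem _ nr) /=; lia.
Qed.

Variable p : R.
Hypotheses (p1 : 1 < p) (l0 : (0 < l)%N).
Local Notation s := (p^-1).
Local Notation g := (gdiff l s).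

Lemma gtilde_neg (n : int) : n < l%:Z -> gtilde l p n = 0.
Proof.
move=> nl; rewrite /gtilde; case: ifP => // n0.
case: n nl n0 => // n nl _.
(* At n = 0 no factor of the product vanishes; the value 0 comes from the power, as 1 - 1/p is not
   0. For 0 < n < l the factor j = n vanishes. *)
have [->|nn] := eqVneq n 0%N.
  rewrite powR0 ?mul0r // subr_eq0 eq_sym invr_eq1.
  by rewrite gt_eqF.
rewrite (bigD1_seq n) ?iota_uniq //=; last first.
  by rewrite mem_index_iota lt0n nn.
by rewrite subrr mul0r mulr0.
Qed.

Lemma gtilde_nat (n : nat) : gtilde l p n%:Z = g 0 n.
Proof.
have [nl|ln] := ltnP n l; first by rewrite gtilde_neg ?gdiff_small.
have n0 : 0 < n%:R :> R by rewrite ltr0n (leq_trans l0).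
rewrite /gtilde /= /gdiff /= /gseq.
rewrite -[n%:~R]/(n%:R) -powR_1D // -mulrA mulrC -mulrA mulrC; congr (_ * _).
have h : forall k, (k < l)%N -> n%:R * (\prod_(1 <= j < k.+1) (n%:R - j%:R)) =
    (n ^_ k.+1)%:R :> R.
  elim=> [|k IH] kl; first by rewrite big_geq // mulr1 ffactn1.
  rewrite big_nat_recr //= mulrA IH; last exact: ltnW.
  rewrite [in RHS]ffactnSr natrM natrB //; exact: ltnW (leq_trans kl ln).
have := h l.-1; rewrite prednK // => /(_ (leqnn _)) <-.
by rewrite mulrC.
Qed.

Lemma gtildeE : (fun k : nat => ((gtilde l p k%:Z)%:C)%C) =
  (fun k => ((g 0 k)%:C)%C).
Proof. by apply/funext => k; rewrite gtilde_nat. Qed.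

Lemma rhotildeE (n : nat) : (l <= n)%N -> rhotilde l p n = weight l p n.
Proof.
move=> ln; rewrite /rhotilde /weight gtilde_nat; congr (_ / _).
rewrite -(subnKC ln) addKn; set m := (n - l)%N.
have u0 k : k < l%:Z -> ((gtilde l p k)%:C)%C = 0 :> R[i].
  by move=> kl; rewrite gtilde_neg.
rewrite /plaplacian (@iter_div1_nat _ (fun k => g l (l + k) `^ (p - 1))).
  rewrite -[(-1) ^+ l]/(((-1) ^+ l : R[i])).
  have -> : (-1) ^+ l = (((-1) ^+ l : R)%:C)%C :> R[i].
    by rewrite rmorphXn rmorphN rmorph1.
  rewrite -rmorphM /= mulrA -exprMn mulrNN mulr1 expr1n mul1r.
  by rewrite /wdiff.
move=> k; rewrite (iter_nabla_nat _ _ l0 u0) gtildeE iter_bdif_complex.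
have h0 := gdiff_gt0 (invp01 p1) l0 (leqnn l) (leq_addr k l).
rewrite (_ : iter l (@bdif R) _ (l + k) = g l (l + k)) //.
rewrite /spow cmod_real ger0_norm ?(ltW h0) // -rmorphM /=; congr (_%:C)%C.
by rewrite powR_1D //; congr (_ `^ _); ring.
Qed.

End Bridge.

(** * The four properties of the weight *)

Section MainSteps.
Variables (R : realType) (l : nat) (p : R).
Hypotheses (p1 : 1 < p) (l0 : (0 < l)%N).
Local Notation s := (p^-1).
Local Notation g := (gdiff l s).
Local Notation a := (wdiff l p).
Hypothesis cmA : cmon l (a 0).

Let p0 : 0 < p. Proof. exact: lt_trans p1. Qed.

Implicit Type u : int -> R[i].

Definition emb (y : nat -> R[i]) : int -> R[i] :=
  fun n => if n is Posz k then y k else 0.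

Lemma H0_emb m T (y : nat -> R[i]) : (forall k, (k < m)%N -> y k = 0) ->
  (forall k, (T <= k)%N -> y k = 0) -> H0 m (emb y).
Proof.
move=> ym yT; split; last first.
  by case=> k //= km; apply: ym; rewrite -ltz_nat.
apply: (@sub_finite_set _ _ [set` [seq k%:Z | k <- iota 0 T]]); last exact:
    finite_seq.
case=> k /=; last by rewrite eqxx.
move=> yk; apply/mapP; exists k => //; rewrite mem_iota /= add0n ltnNge.
by apply: contra yk => /yT ->.
Qed.

Lemma H0_vanish u : H0 l u -> vanish_below l (fun k : nat => u k%:Z).
Proof. by move=> [_ h] n nl; apply: h; rewrite ltz_nat. Qed.

Lemma energyE u T M : H0 l u -> (forall n : nat, (T <= n)%N -> u n%:Z = 0) ->
  (T < M)%N -> energy l p u = (level l p (fun k : nat => u k%:Z) 0 M)%:E.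
Proof.
move=> [_ hu] uT TM; rewrite (level0E p1 l0) /energy.
rewrite (@eseries_fin _ _ (fun n : nat => cmod (iter l (@nabla _) u n%:Z) `^ p)
  (l + M)) ?leq_addr ?addKn //.
  congr _%:E; apply: eq_bigr => m _.
  by rewrite (iter_nabla_nat l _ l0 hu).
move=> n ln; rewrite (iter_nabla_nat l _ l0 hu).
rewrite (iter_bdif_large (T := T)) ?cmod0 ?powR0 ?gt_eqF //.
by lia.
Qed.

Lemma wnormE rho u T M : (forall n : nat, (T <= n)%N -> u n%:Z = 0) ->
  (T < M)%N -> wnorm l p rho u =
    (\sum_(m < M) rho (l + m)%N * cmod (u (l + m)%N%:Z) `^ p)%:E.
Proof.
move=> uT TM; rewrite /wnorm.
rewrite (@eseries_fin _ _ (fun n : nat => rho n * cmod (u n%:Z) `^ p)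
  (l + M)) ?leq_addr ?addKn //.
move=> n ln; rewrite uT ?cmod0 ?powR0 ?mulr0 ?gt_eqF //; lia.
Qed.

Lemma wnorm_rhotildeE u T M : (forall n : nat, (T <= n)%N -> u n%:Z = 0) ->
  (T < M)%N ->
  wnorm l p (rhotilde l p) u = (level l p (fun k : nat => u k%:Z) l M)%:E.
Proof.
move=> uT TM; rewrite (wnormE _ uT TM) levellE; congr _%:E.
by apply: eq_bigr => m _; rewrite rhotildeE ?leq_addr.
Qed.

Lemma rhotilde_weight : hrb_weight l p (rhotilde l p).
Proof.
split=> [n ln|u hu]; first by rewrite rhotildeE // weight_ge0.
have [T uT] := H0_bound hu; have vu := H0_vanish hu.
rewrite (energyE hu uT (ltnSn T)) (wnorm_rhotildeE uT (ltnSn T)) lee_fin.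
exact: (weight_ineq p1 l0 cmA vu uT (ltnSn T)).
Qed.

Lemma rhotilde_non_attainable : non_attainable l p (rhotilde l p).
Proof.
move=> u hu; have [T uT] := H0_bound hu; have vu := H0_vanish hu.
rewrite (energyE hu uT (ltnSn T)) (wnorm_rhotildeE uT (ltnSn T)) => -[] e n.
have h := weight_strict p1 l0 cmA vu uT (ltnSn T) (esym e).
by case: n => k; [exact: h|apply: hu.2].
Qed.

(** An excess d of [rho'] at n0 makes d |trial(n0)|^p at most the defect of the trial sequence,
    which tends to 0 while trial(n0) tends to g(n0) > 0. *)
Lemma rhotilde_critical : critical l p (rhotilde l p).
Proof.
move=> rho' [rho0 hrho] le n0 ln0.
apply/eqP; rewrite eq_le le // andbT -subr_le0.
set d := rho' n0 - _.
have g0 := gdiff_gt0 (invp01 p1) l0 (leq0n l) ln0.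
have bound L : d * cmod (ctrial l p L n0) `^ p <=
    level l p (ctrial l p L) 0 (2 ^ L.+1) - level l p (ctrial l p L) l (2 ^
        L.+1).
  have TM : (2 ^ L < 2 ^ L.+1)%N by rewrite ltn_exp2l.
  have vl : vanish_below l (ctrial l p L) by exact: vanish_ctrial.
  have vT := @ctrial_large R l p L.
  have hu : H0 l (emb (ctrial l p L)) by apply: H0_emb vl vT.
  (* For small L the index n0 may lie beyond the range of summation; the left side is then 0 and the
     defect is nonnegative. *)
  have [n0M|Mn0] := ltnP (n0 - l) (2 ^ L.+1); last first.
    rewrite vT ?cmod0 ?powR0 ?mulr0 ?subr_ge0 ?gt_eqF //.
      exact: (weight_ineq p1 l0 cmA vl vT TM).
    by lia.
  have := hrho _ hu.
  rewrite (energyE hu vT TM) (wnormE _ (u := emb _) vT TM) lee_fin levellE.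
  rewrite -/(emb (ctrial l p L)) /= => h.
  have := lerB h (lexx (\sum_(m < 2 ^ L.+1) weight l p (l + m) *
    cmod (ctrial l p L (l + m)%N) `^ p)).
  apply: le_trans; rewrite -sumrB.
  rewrite (bigD1 (Ordinal n0M)) //= subnKC // -mulrBl -rhotildeE // -/d lerDl.
  apply: sumr_ge0 => m _; rewrite -mulrBl -rhotildeE ?leq_addr //.
  by rewrite mulr_ge0 ?powR_ge0 // subr_ge0 le // leq_addr.
have c1 : d * cmod (ctrial l p L n0) `^ p @[L --> \oo] --> d * g 0 n0 `^ p.
  apply: cvgM; first exact: cvg_cst.
  apply: powR_cvg => //.
  rewrite (_ : (fun _ => _) = (fun L => trial l p L n0)).
    exact: (@cvg_iter_trial R l p 0 n0).
  apply/funext => L; rewrite /ctrial cmod_real ger0_norm // /trial mulr_ge0 //.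
    exact: ltW.
  exact: eta_ge0.
have : d * g 0 n0 `^ p <= 0.
  by apply: (ler_cvg_to c1 (trial_defect p1 l0 cmA)); apply: nearW.
by rewrite pmulr_lle0 ?powR_gt0.
Qed.

Lemma iter_bdif_bound (y : nat -> R) (B : R) i n :
  (forall k, (k <= n)%N -> `|y k| <= B) -> `|iter i (@bdif R) y n| <= 2 ^+ i *
      B.
Proof.
elim: i n => [|i IH] n h; first by rewrite mul1r; apply: h.
rewrite /= /bdif; apply: le_trans (ler_normB _ _) _.
have h1 := IH n h; have h2 : `|iter i (@bdif R) y n.-1| <= 2 ^+ i * B.
  by apply: IH => k kn; apply: h; apply: leq_trans kn (leq_pred _).
by rewrite exprS; lra.
Qed.

Lemma iter_bdif_local (y z : nat -> R) i n :
  (forall k, (n - i <= k)%N -> y k = z k) ->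
  iter i (@bdif R) y n = iter i (@bdif R) z n.
Proof.
elim: i n => [|i IH] n h; first by apply: h; rewrite subn0.
by rewrite /= /bdif !IH // => k kn; apply: h; lia.
Qed.

Lemma harmonic_sum_ge K : K%:R / 2 <= \sum_(m < 2 ^ K) m.+1%:R^-1 :> R.
Proof.
elim: K => [|K IH]; first by rewrite mul0r sumr_ge0.
rewrite -(big_mkord xpredT (fun m => m.+1%:R^-1)) /=.
rewrite (big_cat_nat (n := (2 ^ K)%N)) //=; last by rewrite leq_exp2l.
rewrite big_mkord -[K.+1%:R]natr1 mulrDl; apply: lerD => //.
apply: le_trans (_ : \sum_(2 ^ K <= m < 2 ^ K.+1) (2 ^ K.+1)%:R^-1 <= _).
  rewrite sumr_const_nat (_ : (2 ^ K.+1 - 2 ^ K = 2 ^ K)%N); last first.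
    by rewrite expnS mul2n -addnn addnK.
  rewrite -[leRHS]mulr_natl.
  have : (2 ^ K)%:R != 0 :> R by rewrite pnatr_eq0 -lt0n expn_gt0.
  rewrite expnS natrM; move: ((2 ^ K)%:R : R) => x x0.
  by rewrite le_eqVlt; apply/orP; left; apply/eqP; field.
rewrite [leLHS]big_nat [leRHS]big_nat; apply: ler_sum => m /andP[m1 m2].
by rewrite lef_pV2 ?posrE ?ltr0n ?expn_gt0 // ler_nat.
Qed.

(** As s p = 1, h^p is at least c^p / n, and l + j <= l (j + 1) reduces the sum to the harmonic
    one. *)
Lemma top_energy_unbounded (B : R) :
  exists J, B <= \sum_(j < J) g l (l + j) `^ p.
Proof.
have [c c0 hc] := gdiff_top_lower (invp01 p1) l0.
pose d := c `^ p / l%:R.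
have lR : 0 < l%:R :> R by rewrite ltr0n.
have d0 : 0 < d by rewrite divr_gt0 // powR_gt0.
pose K := (Num.truncn (2 * (Num.max B 0 / d))).+1.
have q0 : 0 <= 2 * (Num.max B 0 / d).
  by rewrite mulr_ge0 // divr_ge0 ?(ltW d0) // le_max lexx orbT.
have hK : 2 * (Num.max B 0 / d) <= K%:R.
  by apply: ltW; have /andP[] := truncn_itv q0.
exists (2 ^ K)%N; apply: le_trans (_ : d * (K%:R / 2) <= _).
  apply: le_trans (_ : Num.max B 0 <= _); first by rewrite le_max lexx.
  rewrite mulrA ler_pdivlMr // mulrC -ler_pdivrMl //.
  by apply: le_trans hK; rewrite le_eqVlt; apply/orP; left; apply/eqP; ring.
apply: le_trans (ler_wpM2l (ltW d0) (harmonic_sum_ge K)) _.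
rewrite mulr_sumr; apply: ler_sum => j _.
have n0 : 0 < (l + j)%:R :> R by rewrite ltr0n addn_gt0 l0.
apply: le_trans (_ : (c * (l + j)%:R `^ (- s)) `^ p <= _); last first.
  rewrite ge0_ler_powR ?nnegrE ?(ltW p0) //.
  - by rewrite mulr_ge0 ?powR_ge0 // ltW.
  - by rewrite gdiff_ge0 // invp01.
  - by rewrite hc // leq_addr.
rewrite powRM ?powR_ge0 ?(ltW c0) // -powRrM mulNr mulVf ?gt_eqF //.
rewrite powR_inv1 ?(ltW n0) // /d -mulrA ler_pM2l ?powR_gt0 //.
rewrite -invfM lef_pV2 ?posrE ?mulr_gt0 // -natrM ler_nat; nia.
Qed.

Lemma sum_if_le (M m : nat) (f : nat -> R) : (forall j, 0 <= f j) ->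
  \sum_(j < M) (if (j < m)%N then f j else 0) <= \sum_(j < m) f j.
Proof.
move=> f0.
have -> : \sum_(j < M) (if (j < m)%N then f j else 0) = \sum_(j < minn M m) f j.
  elim: M => [|M IH]; first by rewrite min0n !big_ord0.
  rewrite big_ord_recr /= IH; case: ltnP => h.
    by rewrite !(minn_idPl _) ?big_ord_recr //; exact: ltnW.
  by rewrite !(minn_idPr _) ?addr0 //; exact: leqW.
rewrite -!(big_mkord xpredT f) [leRHS](big_cat_nat (n := minn M m)) ?geq_minr
    //=.
by rewrite lerDl sumr_ge0.
Qed.

Lemma cvg_sum_ord (F : nat -> nat -> R) (f : nat -> R) J :
  (forall j, F j L @[L --> \oo] --> f j) ->
  \sum_(j < J) F j L @[L --> \oo] --> \sum_(j < J) f j.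
Proof.
move=> h; elim: J => [|J IH].
  rewrite big_ord0 (_ : (fun _ => _) = cst 0); first exact: cvg_cst.
  by apply/funext => L; rewrite big_ord0.
rewrite big_ord_recr (_ : (fun _ => _) = (fun L => \sum_(j < J) F j L + F J L)).
  exact: cvgD.
by apply/funext => L; rewrite big_ord_recr.
Qed.

(** On a window of J terms the energy of the trial sequence converges to that of g, which is at
    least B + 1 there; all other terms are nonnegative. *)
Lemma trial_energy_large (B : R) :
  \forall L \near \oo, B <= level l p (ctrial l p L) 0 (2 ^ L.+1).
Proof.
have [J hJ] := top_energy_unbounded (B + 1).
pose E L := \sum_(j < J) cmod (iter l (@bdif _) (ctrial l p L) (l + j)%N) `^ p.
have cE : E L @[L --> \oo] --> \sum_(j < J) g l (l + j) `^ p.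
  apply: (@cvg_sum_ord (fun j L =>
    cmod (iter l (@bdif _) (ctrial l p L) (l + j)%N) `^ p)
    (fun j => g l (l + j) `^ p)) => j; apply: powR_cvg.
    by apply: gdiff_top_gt0; rewrite ?leq_addr // invp01.
  have hg := @cvg_iter_trial R l p l (l + j).
  have gp : 0 <= g l (l + j) by apply: gdiff_top_ge0 => //; apply: invp01.
  have := cvg_norm hg; rewrite (ger0_norm gp).
  have e L : cmod (iter l (@bdif _) (ctrial l p L) (l + j)%N) =
      `|iter l (@bdif R) (trial l p L) (l + j)%N|.
    by rewrite /ctrial iter_bdif_complex cmod_real.
  by move=> hn; rewrite (eq_cvg _ _ e); exact: hn.
have hE : \forall L \near \oo, B <= E L.
  move/cvgrPdist_le : cE => /(_ 1 ltr01); apply: filterS => L.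
  rewrite ler_norml => /andP[_ h2]; lra.
near=> L.
have h1 : B <= E L by near: L.
have h2 : (J <= L)%N by near: L; exists J.
apply: le_trans h1 _; rewrite (level0E p1 l0).
have JM : (J <= 2 ^ L.+1)%N by apply: leq_trans h2 _; apply: ltnW (ltn_trans
    (ltnSn _) (ltn_expl _ _)).
rewrite /E -[in leRHS](subnKC JM) -(big_mkord xpredT (fun j => cmod (iter l
    (@bdif _) (ctrial l p L) (l + j)%N) `^ p)).
rewrite -(big_mkord xpredT (fun j => cmod (iter l (@bdif _) (ctrial l p L) (l +
    j)%N) `^ p)).
rewrite [leRHS](big_cat_nat (n := J)) ?leq_addr //= lerDl sumr_ge0 // => j _.
exact: powR_ge0.
Unshelve. all: end_near.
Qed.

(** Setting the trial sequence to 0 below m raises the energy by at most C1 and lowers the norm by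
    at most C2, both independent of L, whereas the energy is unbounded in L and the defect
    eventually at most 1. *)
Lemma rhotilde_optimal : optimal_near_infinity l p (rhotilde l p).
Proof.
move=> m eps lm eps0.
(* Bounds the l-th difference of the truncated sequence at l + j for j < m, the only indices where
   truncation is felt: the binomial coefficients add up to 2^l, and each value is at most g(m +
   l). *)
pose B0 := 2 ^+ l * g 0 (m + l).
have g0 n : 0 <= g 0 n by apply: gdiff_ge0 => //; apply: invp01.
have B00 : 0 <= B0 by rewrite mulr_ge0 ?exprn_ge0.
pose C1 := \sum_(j < m) B0 `^ p.
pose C2 := \sum_(j < m) weight l p (l + j) * g 0 (l + j) `^ p.
have C20 : 0 <= C2.
  by apply: sumr_ge0 => j _; rewrite mulr_ge0 ?powR_ge0 ?weight_ge0.
have C10 : 0 <= C1 by apply: sumr_ge0 => j _; apply: powR_ge0.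
(* The truncated norm is at least Big - 1 - C2, hence above (C1 + C2 + 1)/eps, while energy minus
   norm is at most C1 + C2 + 1. *)
pose Big := (C1 + C2 + 1) / eps + C2 + 2.
have [L [hD hE]] : exists L,
    level l p (ctrial l p L) 0 (2 ^ L.+1) -
      level l p (ctrial l p L) l (2 ^ L.+1) <= 1 /\
    Big <= level l p (ctrial l p L) 0 (2 ^ L.+1).
  have h1 := trial_energy_large Big.
  have /cvgrPdist_le/(_ 1 ltr01) h2 := trial_defect p1 l0 cmA.
  near \oo => L; exists L; split; last by near: L.
  have : `|0 - (level l p (ctrial l p L) 0 (2 ^ L.+1) -
      level l p (ctrial l p L) l (2 ^ L.+1))| <= 1 by near: L.
  by rewrite sub0r normrN; apply: le_trans; apply: ler_norm.
set M := (2 ^ L.+1)%N in hD hE.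
have TM : (2 ^ L < M)%N by rewrite ltn_exp2l.
pose w k : R := if (k < m)%N then 0 else trial l p L k.
pose y k : R[i] := ((w k)%:C)%C.
have yT k : (2 ^ L <= k)%N -> y k = 0.
  by move=> kL; rewrite /y /w trial_large // if_same.
have ym k : (k < m)%N -> y k = 0 by move=> km; rewrite /y /w km.
have yl k : (k < l)%N -> y k = 0 by move=> kl; apply: ym; apply: leq_trans lm.
exists (emb y); first exact: H0_emb ym yT.
have hu : H0 l (emb y) by apply: H0_emb yl yT.
rewrite (energyE (u := emb y) hu yT TM).
rewrite (wnorm_rhotildeE (u := emb y) yT TM) -EFinM lte_fin.
change (fun k : nat => emb y k) with y.
set EL := level l p (ctrial l p L) 0 M in hD hE.
set WL := level l p (ctrial l p L) l M in hD.
have tr0 k : 0 <= trial l p L k by rewrite /trial mulr_ge0 // eta_ge0.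
have trg k : trial l p L k <= g 0 k.
  by rewrite /trial -[leRHS]mulr1 ler_wpM2l // eta_le1.
have hEw : level l p y 0 M <= EL + C1.
  rewrite /EL !(level0E p1 l0).
  apply: le_trans (lerD (lexx _) (@sum_if_le M m (fun=> B0 `^ p) (fun=> powR_ge0
      B0 p))).
  rewrite -big_split /=; apply: ler_sum => j _.
  rewrite /y /ctrial !iter_bdif_complex !cmod_real.
  case: ltnP => jm.
    apply: ler_wpDl; first exact: powR_ge0.
    rewrite ge0_ler_powR ?nnegrE ?(ltW p0) //.
    apply: iter_bdif_bound => k kn; rewrite /w; case: ifP => _.
      by rewrite normr0.
    rewrite ger0_norm //; apply: le_trans (trg k) _.
    by apply: gdiff_incr => //; [apply: invp01|lia].
  rewrite addr0 le_eqVlt; apply/orP; left; apply/eqP; congr (`|_| `^ _).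
  apply: iter_bdif_local => k kn; rewrite /w.
  by have -> : (k < m)%N = false by apply/negbTE; rewrite -leqNgt; lia.
have hWw : WL - C2 <= level l p y l M.
  rewrite lerBlDr /WL !levellE.
  have f0 j : 0 <= weight l p (l + j) * g 0 (l + j) `^ p.
    by rewrite mulr_ge0 ?powR_ge0 ?weight_ge0.
  apply: le_trans (lerD (lexx _) (@sum_if_le M m _ f0)).
  rewrite -big_split; apply: ler_sum => j _.
  change (weight l p (l + j) * cmod (ctrial l p L (l + j)%N) `^ p <=
    weight l p (l + j) * cmod (y (l + j)%N) `^ p +
    if (j < m)%N then weight l p (l + j) * g 0 (l + j) `^ p else 0).
  have wp := weight_ge0 cmA (l + j)%N.
  rewrite /y /ctrial !cmod_real /w (ger0_norm (tr0 _)).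
  have tp : 0 <= trial l p L (l + j) `^ p by exact: powR_ge0.
  case: ifP => jm; last first.
    rewrite (ger0_norm (tr0 _)) lerDl; case: ifP => // _; exact: f0.
  rewrite normr0 powR0 ?gt_eqF // mulr0 add0r.
  have -> : (j < m)%N by apply: leq_ltn_trans jm; rewrite leq_addl.
  by rewrite ler_wpM2l // ge0_ler_powR ?nnegrE ?(ltW p0).
have e1 : 0 < (C1 + C2 + 1) / eps by rewrite divr_gt0 //; lra.
have h1 : (C1 + C2 + 1) / eps < level l p y l M by rewrite /Big in hE; lra.
rewrite ltr_pdivrMr // in h1; lra.
Unshelve. all: end_near.
Qed.

End MainSteps.

Theorem theorem5p1 (R : realType) (l : nat) (p : R)
    (hlp : [\/ [/\ (1 <= l)%N, p \is a Num.int & 2 <= p],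
               (3 <= l <= 7)%N /\ 2 < p
             | (1 <= l <= 2)%N /\ 1 < p]) :
  [/\ hrb_weight l p (rhotilde l p),
      critical l p (rhotilde l p),
      non_attainable l p (rhotilde l p)
    & optimal_near_infinity l p (rhotilde l p)].
Proof.
have [l0 p1] : (0 < l)%N /\ 1 < p.
  by case: hlp => [[? _ ?]|[/andP[? ?] ?]|[/andP[? ?] ?]]; split; [|lra|lia|lra|
      |].
have cmA : cmon l (wdiff l p 0).
  apply: (cmon_gdiff_powR (invp01 p1) l0).
    by move=> m; apply: (gdiff_top_gt0 (invp01 p1) l0); apply: leq_addr.
  (* The power taken of h is p - 1: a natural number in case (i), at least 1 in case (ii), merely
     positive in case (iii). *)
  case: hlp => [[_ pint p2]|[/andP[_ l7] p2]|[/andP[_ l2] _]].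
  - have pnat : p \is a Num.nat by rewrite -intrEge0 // (le_trans _ p2).
    have /natrP[[|N] pN] := pnat; first by move: p1; rewrite pN ltr10.
    by apply: Or31; exists N; rewrite pN -natr1 addrK.
  - by apply: Or32; split=> //; lra.
  - by apply: Or33; split=> //; lra.
split.
- exact: rhotilde_weight.
- exact: rhotilde_critical.
- exact: rhotilde_non_attainable.
- exact: rhotilde_optimal.
Qed.
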